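(* Let $n\ge 1$ and $k\ge 0$ be integers with $2^k<n$, and let $d(n,k)=\nu_2\big(\big\lfloor \frac{n}{2^k}\big\rfloor\big)$. Let $\lambda$ be an odd partition of $n-2^k$. Then $e(\lambda,2^k)\ne 0$ if and only if there exists a $d(n,k)$-good partition in the $k$th row $\mathcal{Q}_2^{(k)}(\lambda)$ of the $2$-quotient tower of $\lambda$. In this case, $e(\lambda,2^k)=2^k$ if $d(n,k)=0$, and $e(\lambda,2^k)=2$ if $d(n,k)>0$.
   Context: A partition $\lambda$ of $n$ is odd if the irreducible complex character $\chi^\lambda$ of $\mathfrak{S}_n$ has odd degree; the empty partition is considered odd. $\nu_2(a)$ is the exponent of the highest power of $2$ dividing the positive integer $a$. The map $f_k^n$ ($2^k<n$): for an odd partition $\mu$ of $n$ there is exactly one $2^k$-hook of $\mu$ whose removal leaves an odd partition of $n-2^k$ (known result), and $f_k^n(\mu)$ is that partition. (Equivalently $\chi^{f_k^n(\mu)}$ is the unique odd-degree irreducible constituent of the restriction of $\chi^\mu$ to $\mathfrak{S}_{n-2^k}$ appearing with odd multiplicity.) For an odd partition $\lambda$ of $n-2^k$, $e(\lambda,2^k)$ is the number of odd partitions $\mu$ of $n$ with $f_k^n(\mu)=\lambda$. $C_e(\lambda)$ is the $e$-core of $\lambda$ (obtained by successively removing $e$-hooks until none is left). The $2$-quotient $Q_2(\lambda)=(\lambda_0,\lambda_1)$ is the usual one: take a $\beta$-set $X=\{\lambda_i+s-i: 1\le i\le s\}$ of $\lambda$ (parts padded by zeros) with $s$ even; $\lambda_j$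 is the partition with $\beta$-set $\{x: 2x+j\in X\}$, $j=0,1$. The $2$-quotient tower has rows $\mathcal{Q}_2^{(k)}(\lambda)=(\lambda^{(k)}_0,\dots,\lambda^{(k)}_{2^k-1})$, $k\ge0$, given by $\lambda_0^{(0)}=\lambda$ and $Q_2(\lambda_i^{(k)})=(\lambda^{(k+1)}_{2i},\lambda^{(k+1)}_{2i+1})$. For $d\ge0$, an odd partition $\lambda$ is $d$-good if (i) $|\lambda|\equiv 2^d-1 \pmod{2^{d+1}}$ and (ii) $C_{2^d}(\lambda)$ is a hook partition, i.e. of the form $(a,1^b)$, where the empty partition also counts as a hook partition. *)

(* Defs.v *)
From HB Require Import structures.
From mathcomp Require Import all_boot all_order all_algebra.
From mathcomp Require Import all_fingroup all_solvable all_field all_character.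

Set Implicit Arguments.
Unset Strict Implicit.
Unset Printing Implicit Defensive.

Import Order.TTheory GRing.Theory Num.Theory.

Local Open Scope nat_scope.

(* Partitions are weakly decreasing sequences of positive integers.  Rows and
   columns of Young diagrams are numbered from 0. *)
Definition is_partn (n : nat) (la : seq nat) : bool :=
  [&& sorted geq la, 0 \notin la & sumn la == n].

Definition col_len (la : seq nat) (j : nat) : nat := count (ltn j) la.

Definition conj_partn (la : seq nat) : seq nat :=
  mkseq (col_len la) (head 0 la).

(* [reshape_index a x] is the index of the block containing x when
   {0, ..., sumn a - 1} is cut into consecutive blocks of lengths a_0, a_1, ... *)
Definition young_set (n : nat) (a : seq nat) : {set 'S_n} :=
  [set s : 'S_n | [forall x : 'I_n,
     reshape_index a (s x) == reshape_index a x]].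

Lemma young_group_set (n : nat) (a : seq nat) : group_set (young_set n a).
Proof.
apply/group_setP; split=> [|s t].
  by rewrite inE; apply/forallP=> x; rewrite perm1.
rewrite !inE => /forallP sP /forallP tP; apply/forallP=> x.
by rewrite permM (eqP (tP _)).
Qed.

Canonical young_group (n : nat) (a : seq nat) : {group 'S_n} :=
  Group (young_group_set n a).

Lemma sign_class_fun (n : nat) :
  is_class_fun <<[set: 'S_n]>>%g [ffun s : 'S_n => ((-1) ^+ s)%R : algC].
Proof.
rewrite genGid; apply: intro_class_fun => [s t _ _|s]; last by rewrite inE.
by rewrite odd_permJ.
Qed.

Definition sign_char (n : nat) : 'CF([set: 'S_n]) := Cfun 0 (sign_class_fun n).

(* ['chi_i] is the irreducible character labelled by la, in the sense of
   James and Kerber: the unique common irreducible constituent of the trivial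
   character of the Young subgroup of la and the sign character of the Young
   subgroup of the conjugate partition, both induced to the symmetric group. *)
Definition is_chi (la : seq nat) (i : Iirr [set: 'S_(sumn la)]) : bool :=
  let n := sumn la in
  let triv : 'CF(young_group n la) := 1%R in
  let sgn := ('Res[young_group n (conj_partn la)] (sign_char n))%R in
  (i \in irr_constt ('Ind[[set: 'S_n]] triv)%R) &&
  (i \in irr_constt ('Ind[[set: 'S_n]] sgn)%R).

Definition odd_partn (la : seq nat) : bool :=
  [exists i : Iirr [set: 'S_(sumn la)],
     is_chi i && odd (Num.truncn ('chi_i 1%g)%R)].

Definition boxes (la : seq nat) : seq (nat * nat) :=
  [seq (i, j) | i <- iota 0 (size la), j <- iota 0 (nth 0 la i)].

Definition hook_length (la : seq nat) (b : nat * nat) : nat :=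
  (nth 0 la b.1 - b.2) + (col_len la b.2 - b.1) - 1.

(* Removal of the rim hook from the foot of column b.2 to the end of row b.1:
   a row met by it, other than the lowest, becomes the next row minus one box,
   and the lowest is cut down to length b.2. *)
Definition remove_hook (la : seq nat) (b : nat * nat) : seq nat :=
  let bot := (col_len la b.2).-1 in
  let new_row r :=
    if b.1 <= r < bot then (nth 0 la r.+1).-1
    else if r == bot then b.2
    else nth 0 la r in
  [seq p <- mkseq new_row (size la) | 0 < p].

(* One entry for each e-hook of la. *)
Definition hook_removals (e : nat) (la : seq nat) : seq (seq nat) :=
  [seq remove_hook la b | b <- boxes la & hook_length la b == e].

(* For e > 0, [sumn la] steps suffice to exhaust the e-hooks; the result does
   not depend on the hook chosen at each step. *)
Definition core (e : nat) (la : seq nat) : seq nat :=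
  iter (sumn la) (fun nu => head nu (hook_removals e nu)) la.

Definition is_hook (la : seq nat) : bool := all (pred1 1) (behead la).

(* The default [::] is never reached when mu is odd and 2 ^ k < sumn mu: then
   the filtered list has exactly one entry. *)
Definition f_map (k : nat) (mu : seq nat) : seq nat :=
  head [::] [seq nu <- hook_removals (2 ^ k) mu | odd_partn nu].

(* A partition of n has at most n parts, each of them at most n. *)
Definition e_num (n k : nat) (la : seq nat) : nat :=
  #|[set s : n.-bseq 'I_n.+1 |
      let mu := [seq val p | p <- s] in
      [&& is_partn n mu, odd_partn mu & f_map k mu == la]]|.

(* Beta-sets are listed in decreasing order. *)
Definition beta_set (s : nat) (la : seq nat) : seq nat :=
  mkseq (fun i => nth 0 la i + (s - i.+1)) s.

Definition partn_of_beta (X : seq nat) : seq nat :=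
  [seq p <- mkseq (fun i => nth 0 X i - (size X - i.+1)) (size X) | 0 < p].

(* The beta-set of la taken here has size la, or one more element, whichever
   is even. *)
Definition quotient2 (la : seq nat) (j : bool) : seq nat :=
  let X := beta_set (size la + odd (size la)) la in
  partn_of_beta [seq x./2 | x <- X & odd x == j].

Fixpoint quotient_row (k : nat) (la : seq nat) : seq (seq nat) :=
  if k is k'.+1 then
    flatten [seq [:: quotient2 nu false; quotient2 nu true]
            | nu <- quotient_row k' la]
  else [:: la].

Definition good (d : nat) (la : seq nat) : bool :=
  [&& odd_partn la, sumn la == 2 ^ d - 1 %[mod 2 ^ d.+1]
    & is_hook (core (2 ^ d) la)].

Definition d_num (n k : nat) : nat := logn 2 (n %/ 2 ^ k).

(* Main.v *)
Require Import Defs.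
From mathcomp Require Import all_boot all_order all_algebra.
From mathcomp Require Import all_fingroup all_solvable all_field all_character.
From mathcomp Require Import finmap mpoly zify ring.

(** Let [s_la] be the alternating sum of the permutation characters on the
    cosets of Young subgroups given by the Jacobi-Trudi determinant.  Counting
    orbits shows that [s_la] has norm 1 and pairs to 1 with both induced
    characters defining [chi_la], so [chi_la] is [s_la] up to sign and its
    degree is the coefficient of x^(la + delta) in
    a_delta (x_1 + ... + x_m)^n.  Since (x_1 + ... + x_m)^(2^k) is
    x_1^(2^k) + ... + x_m^(2^k) modulo 2, [la] is odd if and only if it has an
    odd number of 2^k-hooks whose removal leaves an odd partition.

    On beta-sets this recursion shows that [la] is odd exactly when its 2-core
    has size at most 1, both components of its 2-quotient are odd, and their
    sizes have disjoint binary expansions.  Hence adding a 2^k-hook to an odd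
    partition and keeping it odd amounts to adding one box to those components
    of row [k] whose size has its lowest zero bit at [d].  For one box,
    stripping the largest 2-power hook preserves the number of odd extensions
    as long as the sizes of both partitions lie between the same powers of 2;
    this ends at size 2^d - 1, with the 2^d-core, and the odd partitions of
    2^d are the hooks. *)

Set Implicit Arguments.
Unset Strict Implicit.
Unset Printing Implicit Defensive.

Import Order.TTheory GRing.Theory Num.Theory.

Local Open Scope nat_scope.

(** * Alternants and complete symmetric polynomials *)

(** No full theory of symmetric functions is needed for [s_la], only the unitriangularity of Kostka
    numbers: the coefficient at la + delta in a_delta h_b is evaluated only where b agrees with la
    or exceeds it at the first difference, and every Jacobi-Trudi term but the identity lengthens
    the first row that it moves. The sign left open by norm 1 disappears in the parity. The
    exponents in la + delta form a beta-set. Alternation makes a coefficient with repeated exponents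
    vanish and allows the others to be sorted, so that lowering one exponent by 2^k is the removal
    of a 2^k-hook. Stripping the largest 2-power hook works because a partition of size at least 2^r
    and below 2^(r+1) has at most one 2^r-hook, whose removal decides oddness; what has to be
    compared is this removal before and after a box is added. Bead sets are kept large enough to
    contain 0, ..., 2^k - 1: otherwise hooks added in new rows below the diagram would be missed.
    The 2-quotient moreover requires an even number of beads, hence the lemmas on padding. *)

Lemma geq_transitive : transitive geq.
Proof. exact: rev_trans leq_trans. Qed.

(** Reindexing along [h] gives S = -S, and there is no 2-torsion; fixed points of [h] thus take care
    of themselves. *)
Lemma big_sign_involution (R : numDomainType) (T : finType) (h : T -> T)
    (P : pred T) (f : T -> R) :
  involutive h -> (forall x, P x -> P (h x)) ->
  (forall x, f (h x) = (- f x)%R) -> (\sum_(x | P x) f x = 0)%R.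
Proof.
move=> hK Ph fh; set S := (X in X = _).
suff: (S *+ 2 == 0)%R by rewrite mulrn_eq0 => /eqP.
rewrite mulr2n {1}/S (reindex_inj (inv_inj hK)) /=.
rewrite (eq_bigl P) => [|x]; last first.
  by apply/idP/idP=> [/Ph|/Ph //]; rewrite hK.
by rewrite (eq_bigr _ (fun x _ => fh x)) sumrN addNr.
Qed.

Lemma nth_sorted_geq (la : seq nat) i j :
  sorted geq la -> i <= j -> nth 0 la j <= nth 0 la i.
Proof.
move=> sla leij; have [ltj|gej] := ltnP j (size la);
  last by rewrite nth_default.
have geq_refl : reflexive geq by move=> x /=.
by apply: (sorted_leq_nth geq_transitive geq_refl); rewrite ?inE //;
  apply: leq_ltn_trans ltj.
Qed.

Lemma sumn_head_behead (la : seq nat) : sumn la = head 0 la + sumn (behead la).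
Proof. by case: la. Qed.

Section Alternants.

Variable m : nat.

Local Notation "mu # s" := [multinom mu (s i) | i < m]
  (at level 40, left associativity, format "mu # s").

Definition staircase (s : 'S_m) : 'X_{1..m} := [multinom m - (s i).+1 | i < m].

Definition beta_mnm (la : seq nat) : 'X_{1..m} :=
  [multinom nth 0 la i + (m - i.+1) | i < m].

Local Open Scope ring_scope.

Definition alternating (R : comNzRingType) (F : {mpoly R[m]}) :=
  forall s : 'S_m, msym s F = (-1) ^+ s *: F.

Definition vdm (R : comNzRingType) : {mpoly R[m]} :=
  \sum_(s : 'S_m) (-1) ^+ s *: 'X_[staircase s].

Definition hsym (R : comNzRingType) (r : nat) : {mpoly R[m]} :=
  \sum_(k : 'X_{1..m < r.+1} | mdeg k == r) 'X_[k].

Lemma vdm_alternating (R : comNzRingType) : alternating (vdm R).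
Proof.
move=> s; rewrite /vdm linear_sum scaler_sumr /=.
rewrite (reindex_inj (mulgI s)) /=; apply: eq_bigr => t _.
rewrite msymZ msymX odd_permM signr_addb scalerA; congr (_ *: 'X_[_]).
by apply/mnmP=> i; rewrite !mnmE permM permKV.
Qed.

Lemma mcoeff_sum_mdeg (R : comNzRingType) N r k : (r < N)%N ->
  (\sum_(j : 'X_{1..m < N} | mdeg j == r) 'X_[j] : {mpoly R[m]})@_k
  = (mdeg k == r)%:R.
Proof.
move=> ltrN; rewrite linear_sum /=; case: (eqVneq (mdeg k) r) => [e|ne].
  have ltk : (mdeg k < N)%N by rewrite e.
  rewrite (bigD1 (BMultinom ltk)) /= ?e // mcoeffX eqxx big1 ?addr0 //.
  move=> j /andP[_ ne]; rewrite mcoeffX; case: eqP => // ejk; case/eqP: ne.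
  exact: val_inj.
rewrite big1 // => j /eqP ej; rewrite mcoeffX; case: eqP => // ejk.
by rewrite -ejk ej eqxx in ne.
Qed.

Lemma mcoeff_hsym (R : comNzRingType) r k : (hsym R r)@_k = (mdeg k == r)%:R.
Proof. exact: mcoeff_sum_mdeg. Qed.

(** A degree bound common to all factors lets a product of complete symmetric polynomials be
    expanded over a single finite type of exponents. *)
Lemma hsymE (R : comNzRingType) N r : (r < N)%N ->
  hsym R r = \sum_(k : 'X_{1..m < N} | mdeg k == r) 'X_[k].
Proof.
by move=> ltrN; apply/mpolyP=> k; rewrite mcoeff_hsym mcoeff_sum_mdeg.
Qed.

Lemma hsym_symmetric (R : comNzRingType) r (s : 'S_m) :
  msym s (hsym R r) = hsym R r.
Proof. by apply/mpolyP=> k; rewrite mcoeff_sym !mcoeff_hsym mdeg_mperm. Qed.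

Lemma alternatingM (R : comNzRingType) (F G : {mpoly R[m]}) :
  alternating F -> (forall s, msym s G = G) -> alternating (F * G).
Proof. by move=> aF sG s; rewrite msymM aF sG scalerAl. Qed.

Lemma mcoeff_alternating (R : comNzRingType) (F : {mpoly R[m]}) (s : 'S_m)
    (mu : 'X_{1..m}) :
  alternating F -> F@_(mu # s) = (-1) ^+ s * F@_mu.
Proof. by move=> aF; rewrite -mcoeff_sym aF mcoeffZ. Qed.

Lemma mdeg_le (a b : 'X_{1..m}) : (a <= b)%MM -> (mdeg a <= mdeg b)%N.
Proof. by move/submK <-; rewrite mdegD leq_addl. Qed.

Lemma mdeg_sub (a b : 'X_{1..m}) :
  (a <= b)%MM -> mdeg (b - a)%MM = (mdeg b - mdeg a)%N.
Proof. by move/submK => e; rewrite -{2}e mdegD addnK. Qed.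

Lemma mcoeffM_hsym (R : comNzRingType) (F : {mpoly R[m]}) r mu :
  (F * hsym R r)@_mu =
  \sum_(nu : 'X_{1..m < (mdeg mu).+1} |
        (nu <= mu)%MM && (mdeg nu + r == mdeg mu)%N) F@_nu.
Proof.
rewrite mcoeffM.
rewrite -(pair_big_dep xpredT (fun a b => mu == (bmnm a + bmnm b)%MM)
  (fun (a b : 'X_{1..m < (mdeg mu).+1}) => F@_a * (hsym R r)@_b)) /=.
rewrite [RHS]big_mkcond /=; apply: eq_bigr => a _.
case: (boolP (bmnm a <= mu)%MM) => [le|nle]; last first.
  rewrite big1 // => b /eqP e; case/mnm_lepP: nle => i.
  by have /mnmP/(_ i) := e; rewrite mnmDE => ->; rewrite leq_addr.
have lt : (mdeg (mu - bmnm a)%MM < (mdeg mu).+1)%N.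
  by rewrite ltnS mdeg_sub // leq_subr.
rewrite (bigD1 (BMultinom lt)) /=; last by rewrite addmC submK.
rewrite big1 ?addr0 => [|b /andP[/eqP e ne]]; last first.
  case/eqP: ne; apply: val_inj => /=; apply/mnmP=> i.
  by have /mnmP/(_ i) := e; rewrite mnmBE mnmDE => ->; rewrite addKn.
rewrite mcoeff_hsym mdeg_sub //= -(eqn_add2l (mdeg (bmnm a))).
by rewrite subnKC ?mdeg_le // eq_sym; case: eqP; rewrite ?mulr1 ?mulr0.
Qed.

(** Exponents include the staircase, so this strict inequality together with [nu <= mu] is the
    horizontal strip condition of Pieri's rule. Only rows before [i] are tested, which permits
    induction on [i]. *)
Definition interlaced (mu nu : 'X_{1..m}) (i : nat) : bool :=
  [forall a : 'I_m, forall b : 'I_m,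
    (val b == a.+1) && (a < i)%N ==> (mu b < nu a)%N].

(* Sign-reversing involution: swap the entries i and i+1 of nu at the first
   place i where interlacing fails. *)
Lemma mcoeffM_hsym_interlaced (R : numDomainType) (F : {mpoly R[m]}) r
    (mu : 'X_{1..m}) i :
  alternating F -> (forall a b : 'I_m, (a <= b)%N -> (mu b <= mu a)%N) ->
  (F * hsym R r)@_mu =
  \sum_(nu : 'X_{1..m < (mdeg mu).+1} |
        [&& (nu <= mu)%MM, (mdeg nu + r == mdeg mu)%N & interlaced mu nu i])
     F@_nu.
Proof.
move=> aF hmu; rewrite mcoeffM_hsym; elim: i => [|i ->].
  apply: eq_bigl => nu; rewrite [interlaced _ _ _](_ : _ = true) ?andbT //.
  by apply/forallP=> a; apply/forallP=> b; rewrite andbF.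
have [lt|ge] := ltnP i.+1 m; last first.
  apply: eq_bigl => nu; congr [&& _, _ & _].
  apply/eq_forallb=> a; apply/eq_forallb=> b; congr (_ ==> _).
  by case: eqP => //= e; have := ltn_ord b; lia.
pose a := Ordinal (ltnW lt); pose b := Ordinal lt.
rewrite (bigID (fun nu : 'X_{1..m < (mdeg mu).+1} => mu b < bmnm nu a)%N) /=.
rewrite [X in _ + X](_ : _ = 0) ?addr0.
  apply: eq_bigl => nu; rewrite -!andbA; congr [&& _, _ & _].
  apply/andP/forallP => [[/forallP H lab] a'|H].
    apply/forallP=> b'; apply/implyP=> /andP[/eqP e]; rewrite ltnS leq_eqVlt.
    case/predU1P=> [ea|lta].
      have -> : a' = a by apply: val_inj.
      by have -> : b' = b by apply: val_inj; rewrite e ea.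
    by have /forallP/(_ b') := H a'; rewrite e eqxx lta.
  split; last by have /forallP/(_ b) := H a; rewrite /= eqxx leqnn.
  apply/forallP=> a'; apply/forallP=> b'; apply/implyP=> /andP[/eqP e lta].
  by have /forallP/(_ b') := H a'; rewrite e eqxx /= ltnS (ltnW lta).
pose t := tperm a b.
have dt (nu : 'X_{1..m < (mdeg mu).+1}) :
    (mdeg (bmnm nu # t) < (mdeg mu).+1)%N.
  by rewrite mdeg_mperm bmdeg.
pose h nu := BMultinom (dt nu).
apply: (@big_sign_involution _ _ h) => [nu|nu|nu].
- by apply: val_inj; apply/mnmP=> j /=; rewrite !mnmE tpermK.
- case/andP=> /and3P[le1 e1 il] nlt; rewrite -leqNgt in nlt.
  have leab : (mu b <= mu a)%N by apply: hmu => /=; lia.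
  have le j := mnm_lepP le1 j.
  rewrite /h /= mdeg_mperm e1 /= -leqNgt mnmE tpermL (le b) andbT.
  apply/andP; split.
    apply/mnm_lepP=> j; rewrite mnmE /t; case: tpermP => [->|->|_ _] //.
      exact: leq_trans (le b) leab.
  apply/forallP=> a'; apply/forallP=> b'; apply/implyP=> /andP[/eqP e lta].
  rewrite mnmE tpermD; last first.
  - by apply/eqP=> e'; move: lta; rewrite -e' /=; lia.
  - by apply/eqP=> e'; move: lta; rewrite -e' /=; lia.
  by have /forallP/(_ b') := forallP il a'; rewrite e eqxx lta.
- rewrite /= (mcoeff_alternating _ _ aF) odd_tperm.
  by rewrite -val_eqE /= neq_ltn ltnSn expr1 mulN1r.
Qed.

Definition padded (la : seq nat) := sorted geq la /\ (size la <= m)%N.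

Lemma beta_mnm_homo la : sorted geq la ->
  forall a b : 'I_m, (a <= b)%N -> (beta_mnm la b <= beta_mnm la a)%N.
Proof.
move=> sla a b leab; rewrite !mnmE; apply: leq_add; last by lia.
exact: nth_sorted_geq.
Qed.

Lemma mdeg_beta_mnm la : (size la <= m)%N ->
  mdeg (beta_mnm la) = (sumn la + \sum_(i < m) (m - i.+1))%N.
Proof.
move=> sz; rewrite mdegE (eq_bigr (fun i : 'I_m => nth 0 la i + (m - i.+1)))%N.
  rewrite big_split /=; congr (_ + _)%N.
  rewrite sumnE (big_nth 0%N) big_mkord (big_ord_widen _ (nth 0%N la) sz).
  rewrite [LHS](bigID (fun i : 'I_m => i < size la)%N) /=.
  by rewrite [X in (_ + X)%N]big1 ?addn0 // => i; rewrite -leqNgt => h;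
    rewrite nth_default.
by move=> i _; rewrite mnmE.
Qed.

(** The strict inequality makes up exactly for the staircase dropping by one per row. *)
Lemma interlaced_beta_ge la nu : (size la <= m)%N ->
  interlaced (beta_mnm la) nu m -> (beta_mnm (behead la) <= nu)%MM.
Proof.
move=> sz il; apply/mnm_lepP=> i; rewrite mnmE nth_behead.
have [lt|ge] := ltnP i.+1 m; last first.
  by rewrite nth_default ?(leq_trans sz) //; have := ltn_ord i; lia.
have /forallP/(_ (Ordinal lt)) := forallP il i.
by rewrite /= eqxx ltn_ord mnmE /=; lia.
Qed.

(** A horizontal strip leaves at least [behead la], hence has at most [head 0 la] boxes. *)
Lemma mcoeffM_hsym_gt (R : numDomainType) (F : {mpoly R[m]}) r la :
  alternating F -> padded la -> (head 0 la < r)%N ->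
  (F * hsym R r)@_(beta_mnm la) = 0.
Proof.
move=> aF [sla sz] ltr; rewrite (mcoeffM_hsym_interlaced _ m) //; last first.
  exact: beta_mnm_homo.
rewrite big1 // => nu /and3P[_ /eqP e /(interlaced_beta_ge sz) le].
have := mdeg_le le; have := mdeg_beta_mnm sz.
have /mdeg_beta_mnm : (size (behead la) <= m)%N by rewrite size_behead; lia.
by have := sumn_head_behead la; lia.
Qed.

(** A horizontal strip with the maximal number of boxes leaves exactly [behead la], so a single term
    survives. *)
Lemma mcoeffM_hsym_head (R : numDomainType) (F : {mpoly R[m]}) la :
  alternating F -> padded la ->
  (F * hsym R (head 0%N la))@_(beta_mnm la) = F@_(beta_mnm (behead la)).
Proof.
move=> aF [sla sz]; rewrite (mcoeffM_hsym_interlaced _ m) //; last first.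
  exact: beta_mnm_homo.
have szb : (size (behead la) <= m)%N by rewrite size_behead; lia.
have dB : (mdeg (beta_mnm (behead la)) + head 0 la = mdeg (beta_mnm la))%N.
  by rewrite !mdeg_beta_mnm //; have := sumn_head_behead la; lia.
have lt : (mdeg (beta_mnm (behead la)) < (mdeg (beta_mnm la)).+1)%N by lia.
rewrite (bigD1 (BMultinom lt)) /=.
  rewrite big1 ?addr0 // => nu /andP[/and3P[_ /eqP e]].
  move=> /(interlaced_beta_ge sz) le /eqP[]; apply: val_inj => /=.
  have /eqP : mdeg (bmnm nu - beta_mnm (behead la))%MM = 0%N.
    by rewrite mdeg_sub //; lia.
  by rewrite mdeg_eq0 => /eqP z; have := submK le; rewrite z add0m.
rewrite dB eqxx /=; apply/andP; split.
  apply/mnm_lepP=> i; rewrite !mnmE leq_add2r nth_behead.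
  exact: nth_sorted_geq.
apply/forallP=> a; apply/forallP=> b; apply/implyP=> /andP[/eqP e _].
have eb : nat_of_ord b = a.+1 by [].
by rewrite !mnmE nth_behead -e ltn_add2l; have := ltn_ord b; lia.
Qed.

End Alternants.

Lemma perm_first_moved m (s : 'S_m) : s != 1%g ->
  exists j : 'I_m, j < s j /\ forall i : 'I_m, i < j -> s i = i.
Proof.
move=> ne; have [i0 Pi0] : exists i, s i != i.
  apply/existsP; rewrite -negb_forall; apply: contra ne => /forallP h.
  by apply/eqP/permP=> i; rewrite perm1; apply/eqP.
case: (@arg_minnP _ i0 (fun i => s i != i) (fun i : 'I_m => val i) Pi0).
move=> j nej minj; have fixj (i : 'I_m) : i < j -> s i = i.
  by move=> lti; apply/eqP/negPn/negP=> /minj; rewrite leqNgt lti.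
exists j; split=> //; rewrite ltn_neqAle eq_sym nej /= leqNgt.
by apply/negP=> lt; case/eqP: nej; apply: (@perm_inj _ s); apply: fixj.
Qed.

(** * Unitriangularity of Kostka numbers *)

Section Kostka.

Variables (m : nat) (R : numDomainType).

Local Open Scope ring_scope.

Lemma staircase_inj : injective (@staircase m).
Proof.
move=> s t /mnmP e; apply/permP=> i; apply: val_inj => /=.
by have := e i; rewrite !mnmE; have := ltn_ord (s i); have := ltn_ord (t i);
  lia.
Qed.

Lemma beta_mnm_nil : beta_mnm m [::] = staircase 1.
Proof. by apply/mnmP=> i; rewrite !mnmE perm1 nth_nil. Qed.

Lemma mcoeff_vdm_nil : (vdm m R)@_(beta_mnm m [::]) = 1.
Proof.
rewrite beta_mnm_nil /vdm linear_sum (bigD1 1%g) //= mcoeffZ mcoeffX eqxx.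
rewrite odd_perm1 mulr1 big1 ?addr0 // => s ne.
by rewrite mcoeffZ mcoeffX (inj_eq staircase_inj) (negPf ne) mulr0.
Qed.

Definition hprod (bs : seq nat) : {mpoly R[m]} := \prod_(b <- bs) hsym m R b.

Lemma vdm_hprod_alternating bs : alternating (vdm m R * hprod bs).
Proof.
apply: alternatingM; first exact: vdm_alternating.
move=> s; rewrite /hprod rmorph_prod; apply: eq_bigr => b _.
exact: hsym_symmetric.
Qed.

Lemma padded_behead la : padded m la -> padded m (behead la).
Proof.
case=> sla sz; split; last by rewrite size_behead; lia.
by case: la sla {sz} => //= x l /path_sorted.
Qed.

Lemma mcoeff_vdm_hprod_cons la b bs :
  (vdm m R * hprod (b :: bs))@_(beta_mnm m la) =
  (vdm m R * hprod bs * hsym m R b)@_(beta_mnm m la).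
Proof. by rewrite /hprod big_cons mulrCA mulrC. Qed.

(** The coefficient is the Kostka number of shape [la] and weight [bs]; a factor whose degree is the
    first row strips that row. Comparing through [nth] allows [bs] to end in zeros. *)
Lemma mcoeff_vdm_hprod_refl la bs :
  padded m la -> (size la <= size bs)%N ->
    (forall i, nth 0%N bs i = nth 0%N la i) ->
  (vdm m R * hprod bs)@_(beta_mnm m la) = 1.
Proof.
elim: bs la => [|b bs IH] la pla sz e.
  by case: la sz {pla e} => // _; rewrite /hprod big_nil mulr1 mcoeff_vdm_nil.
rewrite mcoeff_vdm_hprod_cons.
have -> : b = head 0%N la by have := e 0%N; rewrite nth0.
rewrite mcoeffM_hsym_head //; last exact: vdm_hprod_alternating.
apply: IH; first exact: padded_behead.
  by rewrite size_behead -subn1; move: sz => /=; lia.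
by move=> i; rewrite nth_behead -e.
Qed.

(** Once the common rows are stripped, the factor of degree [nth 0 bs j] is too long for the rows
    left. *)
Lemma mcoeff_vdm_hprod_gt la bs j :
  padded m la -> (j < size bs)%N ->
  (forall i, (i < j)%N -> nth 0%N bs i = nth 0%N la i) ->
  (nth 0%N la j < nth 0%N bs j)%N ->
  (vdm m R * hprod bs)@_(beta_mnm m la) = 0.
Proof.
elim: bs la j => [|b bs IH] la j pla //= ltj e lt.
rewrite mcoeff_vdm_hprod_cons.
case: j => [|j] in ltj e lt *.
  apply: mcoeffM_hsym_gt => //; first exact: vdm_hprod_alternating.
have -> : b = head 0%N la by have := e 0%N isT; rewrite nth0.
rewrite mcoeffM_hsym_head //; last exact: vdm_hprod_alternating.
apply: (IH _ j) => //; first exact: padded_behead.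
  by move=> i lti; rewrite nth_behead -e.
by rewrite nth_behead.
Qed.

Lemma mcoeffXM (k mu : 'X_{1..m}) (G : {mpoly R[m]}) :
  ('X_[k] * G)@_mu = if (k <= mu)%MM then G@_(mu - k)%MM else 0.
Proof.
case: ifP => [le|nle].
  by rewrite mulrC -{1}(submK le) addmC mcoeffMX.
rewrite mcoeffM big1 // => a /eqP e; rewrite mcoeffX.
case: eqP => [ea|_]; last by rewrite mul0r.
by case/mnm_lepP: nle => i; rewrite e mnmDE ea leq_addr.
Qed.

Lemma mcoeff_vdmM (G : {mpoly R[m]}) mu :
  (vdm m R * G)@_mu =
  \sum_(s : 'S_m | (staircase s <= mu)%MM) (-1) ^+ s * G@_(mu - staircase s)%MM.
Proof.
rewrite /vdm mulr_suml linear_sum [RHS]big_mkcond /=; apply: eq_bigr => s _.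
by rewrite -scalerAl mcoeffZ mcoeffXM; case: ifP => //; rewrite mulr0.
Qed.

(* The first row moved by s is lengthened. *)
Lemma mcoeff_vdm_hprod_perm la (s : 'S_m) :
  padded m la -> (staircase s <= beta_mnm m la)%MM ->
  (vdm m R * hprod (beta_mnm m la - staircase s)%MM)@_(beta_mnm m la)
  = (s == 1%g)%:R.
Proof.
move=> pla le; set bs := tval _.
have szbs : size bs = m by rewrite size_tuple.
have nbs (i : 'I_m) : nth 0%N bs i =
  (nth 0%N la i + (m - i.+1) - (m - (s i).+1))%N.
  by rewrite /bs -mnm_nth mnmBE !mnmE.
case: (eqVneq s 1%g) => [e|ne].
  apply: mcoeff_vdm_hprod_refl => //; first by rewrite szbs; case: pla.
  move=> i; have [lt|ge] := ltnP i m.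
    by rewrite (nbs (Ordinal lt)) e perm1 /= addnK.
  by rewrite !nth_default ?szbs //; case: pla => _ sz; apply: leq_trans ge.
have [j [ltj fixj]] := perm_first_moved ne.
apply: (@mcoeff_vdm_hprod_gt _ _ j) => //; first by rewrite szbs.
  move=> i lti; have ltm := ltn_trans lti (ltn_ord j).
  by rewrite (nbs (Ordinal ltm)) fixj //= addnK.
by rewrite nbs; have := ltn_ord (s j); lia.
Qed.

End Kostka.

(** * Permutation characters and Young subgroups *)

Section Words.

Variables (n : nat) (T : finType).
Implicit Types (u v : {ffun 'I_n -> T}) (g : 'S_n).

(** Words of fixed content stand for the cosets of a Young subgroup: permutations act on positions,
    and the stabilizer of a word is a conjugate of that subgroup. *)
Definition wperm u g : {ffun 'I_n -> T} := [ffun x => u (g x)].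

Definition wcount u (t : T) : nat := \sum_(x < n) (u x == t).

Definition wstab u : {set 'S_n} := [set g | wperm u g == u].

Lemma wpermM u g h : wperm (wperm u g) h = wperm u (h * g)%g.
Proof. by apply/ffunP=> x; rewrite !ffunE permM. Qed.

Lemma wperm1 u : wperm u 1%g = u.
Proof. by apply/ffunP=> x; rewrite ffunE perm1. Qed.

Lemma wpermK g : cancel (wperm^~ g) (wperm^~ g^-1%g).
Proof. by move=> u; rewrite wpermM mulVg wperm1. Qed.

Lemma wcount_perm u g t : wcount (wperm u g) t = wcount u t.
Proof.
rewrite /wcount [RHS](reindex_inj (@perm_inj _ g)).
by apply: eq_bigr => x _; rewrite ffunE.
Qed.

Lemma wcountE u t : wcount u t = count_mem t (codom u).
Proof.
rewrite /wcount codomE count_map -sum1_count big_enum_cond [RHS]big_mkcond /=.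
by apply: eq_bigr => x _; case: (u x == t).
Qed.

Lemma wcount_conj u v : wcount u =1 wcount v -> exists g, wperm u g = v.
Proof.
have E (w : {ffun 'I_n -> T}) t : count_mem t [tuple w x | x < n] = wcount w t.
  by rewrite wcountE codomE -val_ord_tuple.
move=> e; have : perm_eq [tuple v x | x < n] [tuple u x | x < n].
  by apply/allP=> t _; rewrite /= !E e.
case/tuple_permP=> g eg; exists g; apply/ffunP=> x; rewrite ffunE.
have := congr1 (fun s => nth (u x) s x) eg.
by rewrite -!tnth_nth !tnth_mktuple => ->.
Qed.

Lemma card_wconj u v :
  wcount u =1 wcount v -> #|[set g | wperm u g == v]| = #|wstab u|.
Proof.
case/wcount_conj=> g0 <-; rewrite -(card_lcoset (wstab u) g0).
apply: eq_card => g; rewrite mem_lcoset !inE -wpermM.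
by rewrite -[RHS](inj_eq (can_inj (wpermK g0))) !wpermM mulgV mul1g.
Qed.

Lemma card_wstab u v : wcount u =1 wcount v -> #|wstab v| = #|wstab u|.
Proof.
move=> e; rewrite -(card_wconj e); case/wcount_conj: e => g0 <-.
rewrite -(card_rcoset (wstab _) g0); apply: eq_card => g.
rewrite mem_rcoset !inE wpermM mulgKV.
by [].
Qed.

(** The words with the content of [u] form one orbit, so the sum is orbit size times stabilizer
    size. *)
Lemma sum_card_wstab u :
  \sum_(v | [forall t, wcount v t == wcount u t]) #|wstab v| = n`!.
Proof.
rewrite -card_Sn -[RHS]sum1_card.
rewrite (partition_big (wperm u) (fun v =>
  [forall t, wcount v t == wcount u t])).
  apply: eq_bigr => v /forallP e.
  have e' : wcount u =1 wcount v by move=> t; rewrite (eqP (e t)).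
  by rewrite (card_wstab e') -(card_wconj e') -sum1_card; apply: eq_bigl => g;
    rewrite inE.
by move=> g _; apply/forallP=> t; rewrite wcount_perm.
Qed.

Lemma exists_wcount (c : T -> nat) :
  \sum_t c t = n -> exists u, wcount u =1 c.
Proof.
move=> sc; pose s := flatten [seq nseq (c t) t | t <- enum T].
have sz : size s == n.
  rewrite size_flatten /shape -map_comp sumnE big_map big_enum /= -sc.
  by apply/eqP; apply: eq_bigr => t _; rewrite size_nseq.
pose u := [ffun x : 'I_n => tnth (Tuple sz) x].
exists u => t; rewrite wcountE.
have -> : codom u = s.
  rewrite codomE (eq_map (g := tnth (Tuple sz))) => [|x]; last by rewrite ffunE.
  by rewrite map_tnth_enum.
rewrite /s count_flatten -map_comp sumnE big_map big_enum /= (bigD1 t) //=.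
rewrite count_nseq /= eqxx mul1n big1 ?addn0 // => t' ne.
by rewrite count_nseq /= (negPf ne).
Qed.

Lemma wstab_inj u : injective u -> wstab u = [set 1%g].
Proof.
move=> iu; apply/setP=> g; rewrite !inE; apply/eqP/eqP=> [e|->];
  last exact: wperm1.
by apply/permP=> x; rewrite perm1; apply: iu; rewrite -[in RHS]e ffunE.
Qed.

Local Open Scope ring_scope.

(** If [u] takes the same value at [x] and [y], multiplication by [tperm x y] is a sign-reversing
    bijection of its stabilizer. *)
Lemma sum_sign_wstab u :
  \sum_(g in wstab u) (-1) ^+ g = (injectiveb u)%:R :> algC.
Proof.
case: (boolP (injectiveb u)) => [/injectiveP iu|/injectivePn [x [y nxy e]]].
  by rewrite wstab_inj // big_set1 odd_perm1.
apply: (@big_sign_involution _ _ (fun g => tperm x y * g)%g) => [g|g|g].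
- by rewrite mulgA tperm2 mul1g.
- rewrite !inE -wpermM => /eqP ->; apply/eqP/ffunP=> z; rewrite ffunE.
  by case: tpermP => [->|->|].
- by rewrite odd_permM odd_tperm nxy signr_addb mulN1r.
Qed.

(** Burnside's double count of pairs of a word and a permutation fixing it, weighted by [f]. *)
Lemma sum_wfix (A : pred {ffun 'I_n -> T}) (f : 'S_n -> algC) :
  \sum_g f g * #|[set u | A u && (wperm u g == u)]|%:R =
  \sum_(u | A u) \sum_(g in wstab u) f g.
Proof.
rewrite (exchange_big_dep predT) //=; apply: eq_bigr => g _.
rewrite -sum1_card natr_sum mulr_sumr big_mkcond [RHS]big_mkcond /=.
by apply: eq_bigr => u _; rewrite !inE; case: ifP; rewrite ?mulr1.
Qed.

End Words.

Lemma reshape_index_cons (c : nat) (a : seq nat) i :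
  reshape_index (c :: a) i = if i < c then 0 else (reshape_index a (i - c)).+1.
Proof.
rewrite /reshape_index /= subn_eq0; case: ltnP => // le.
by rewrite subSn.
Qed.

Lemma sum_reshape_index (a : seq nat) i :
  \sum_(x < sumn a) (reshape_index a x == i) = nth 0 a i.
Proof.
elim: a i => [|c a IH] i; first by rewrite big_ord0 nth_nil.
rewrite /= big_split_ord /=.
rewrite (eq_bigr (fun=> (0 == i) : nat)) => [|x _]; last first.
  by rewrite reshape_index_cons ltn_ord.
rewrite [X in _ + X](eq_bigr (fun x : 'I_(sumn a) =>
    ((reshape_index a x).+1 == i) : nat)) => [|x _]; last first.
  by rewrite reshape_index_cons ltnNge leq_addr /= addKn.
rewrite sum_nat_const card_ord; case: i => [|i].
  by rewrite muln1 big1 ?addn0.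
by rewrite muln0 add0n /= -IH.
Qed.

Section Content.

Variables (n m : nat).
Implicit Types (w : {ffun 'I_n -> 'I_m}).

Definition content w : 'X_{1..m} := [multinom wcount w i | i < m].

Definition mnm_of_seq (a : seq nat) : 'X_{1..m} := [multinom nth 0 a i | i < m].

Lemma content_sum w : content w = (\sum_(x < n) U_(w x))%MM.
Proof.
apply/mnmP=> i; rewrite mnmE mnm_sumE; apply: eq_bigr => x _.
by rewrite mnm1E.
Qed.

Lemma content_perm w g : content (wperm w g) = content w.
Proof. by apply/mnmP=> i; rewrite !mnmE wcount_perm. Qed.

Local Open Scope ring_scope.

Lemma mcoeff_powersum_exp (R : comNzRingType) mu :
  ((\sum_(i < m) 'X_i) ^+ n : {mpoly R[m]})@_mu
  = #|[set w | content w == mu]|%:R.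
Proof.
have -> : (\sum_(i < m) 'X_i) ^+ n = \sum_w 'X_[content w] :> {mpoly R[m]}.
  rewrite -[n in LHS]card_ord -prodr_const bigA_distr_bigA /=.
  apply: eq_bigr => w _; rewrite content_sum.
  by rewrite (big_morph _ (@mpolyXD _ _) (@mpolyX0 _ _)).
rewrite linear_sum -sum1_card natr_sum [RHS]big_mkcond /=.
by apply: eq_bigr => w _; rewrite mcoeffX inE; case: eqP.
Qed.

Lemma exists_young_word (a : seq nat) :
  sumn a = n -> (size a <= m)%N ->
  exists w0 : {ffun 'I_n -> 'I_m},
    young_set n a = wstab w0 /\ content w0 = mnm_of_seq a.
Proof.
move=> sa sz.
have lt (x : 'I_n) : (reshape_index a x < m)%N.
  by apply: leq_trans sz; apply: reshape_indexP; rewrite sa.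
exists [ffun x => Ordinal (lt x)]; split.
  apply/setP=> g; rewrite !inE; apply/forallP/eqP=> [h|h x].
    by apply/ffunP=> x; rewrite !ffunE; apply: val_inj => /=; apply/eqP.
  by have /ffunP/(_ x) := h; rewrite !ffunE => /(congr1 val) /= ->.
apply/mnmP=> i; rewrite !mnmE -sum_reshape_index sa.
by apply: eq_bigr => x _; rewrite ffunE.
Qed.

Definition hchar (a : seq nat) : 'CF([set: 'S_n]) :=
  'Ind[[set: 'S_n]] (1 : 'CF(young_group n a)).

(** Induction sums over all conjugators [y]. Those that carry the base word to a given word form a
    coset of its stabilizer, so after division each fixed word counts once. *)
Lemma hcharE (a : seq nat) (g : 'S_n) :
  sumn a = n -> (size a <= m)%N ->
  hchar a g = #|[set w | (content w == mnm_of_seq a) && (wperm w g == w)]|%:R.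
Proof.
move=> sa sz; have [w0 [eY <-]] := exists_young_word sa sz.
rewrite /hchar cfIndE ?subsetT //.
have -> : #|young_group n a| = #|wstab w0| by rewrite -eY.
apply: (@mulfI _ #|wstab w0|%:R).
  rewrite pnatr_eq0 -lt0n; apply/card_gt0P; exists 1%g.
  by rewrite inE wperm1.
rewrite mulVKf; last first.
  rewrite pnatr_eq0 -lt0n; apply/card_gt0P; exists 1%g.
  by rewrite inE wperm1.
rewrite (eq_bigr (fun y => (wperm (wperm w0 y) g == wperm w0 y)%:R));
  last first.
  move=> y _; rewrite cfun1E; congr (_ %:R : algC); congr (nat_of_bool _).
  transitivity ((g ^ y)%g \in wstab w0); first by rewrite -eY.
  rewrite inE -(inj_eq (can_inj (wpermK y))) !wpermM; congr (wperm _ _ == _).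
  by rewrite conjgE !mulgA mulgV mul1g.
rewrite -natrM -natr_sum; congr (_ %:R).
rewrite (partition_big (wperm w0) (fun w => content w == content w0)) /=;
  last first.
  by move=> y _; rewrite content_perm.
rewrite mulnC -sum1_card big_distrl /= [RHS]big_mkcond /= big_mkcond /=.
apply: eq_bigr => w _; rewrite inE; case: eqP => //= e.
rewrite (eq_bigr (fun=> (wperm w g == w) : nat)) => [|y /andP[_ /eqP ->] //].
rewrite sum_nat_const.
have ew : wcount w0 =1 wcount w.
  by move=> i; have /mnmP/(_ i) := e; rewrite !mnmE.
rewrite mul1n -(card_wconj ew); case: ifP => _; rewrite ?muln1 ?muln0 //.
by apply: eq_card => y; rewrite inE unfold_in /= in_setT.
Qed.

End Content.

(** * Pairs of words and matrices with given margins *)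

Section PairWords.

Variables (n m p : nat).
Implicit Types (u : {ffun 'I_n -> 'I_m * 'I_p}).

Definition fstw u : {ffun 'I_n -> 'I_m} := [ffun x => (u x).1].
Definition sndw u : {ffun 'I_n -> 'I_p} := [ffun x => (u x).2].

Definition margins (al : 'X_{1..m}) (be : 'X_{1..p}) : pred {ffun 'I_n ->
  'I_m * 'I_p} :=
  fun u => (content (fstw u) == al) && (content (sndw u) == be).

Definition pairw (ww : {ffun 'I_n -> 'I_m} * {ffun 'I_n -> 'I_p}) :
  {ffun 'I_n -> 'I_m * 'I_p} := [ffun x => (ww.1 x, ww.2 x)].

Lemma pairw_bij : bijective pairw.
Proof.
exists (fun u => (fstw u, sndw u)) => [[w v]|u].
  by congr (_, _); apply/ffunP=> x; rewrite !ffunE.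
by apply/ffunP=> x; rewrite !ffunE; case: (u x).
Qed.

Lemma fstw_pairw ww : fstw (pairw ww) = ww.1.
Proof. by apply/ffunP=> x; rewrite !ffunE. Qed.

Lemma sndw_pairw ww : sndw (pairw ww) = ww.2.
Proof. by apply/ffunP=> x; rewrite !ffunE. Qed.

Lemma wperm_pairw ww g : wperm (pairw ww) g = pairw (wperm ww.1 g,
  wperm ww.2 g).
Proof. by apply/ffunP=> x; rewrite !ffunE. Qed.

Lemma card_margins al be (g : 'S_n) :
  #|[set u | margins al be u && (wperm u g == u)]| =
  #|[set w | (content w == al) && (wperm w g == w)]| *
  #|[set v | (content v == be) && (wperm v g == v)]|.
Proof.
rewrite -cardsX -(on_card_preimset (f := pairw)); last first.
  by case: pairw_bij => h h1 h2; exists h => ? _; rewrite ?h1 ?h2.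
apply: eq_card => -[w v]; rewrite !inE /= /margins fstw_pairw sndw_pairw /=.
rewrite wperm_pairw /= (inj_eq (bij_inj pairw_bij)) xpair_eqE.
by rewrite andbACA.
Qed.

Lemma mdeg_column u (j : 'I_p) :
  mdeg [multinom wcount u (i, j) | i < m] = content (sndw u) j.
Proof.
rewrite mdegE mnmE /wcount (eq_bigr (fun i => \sum_(x < n) (u x == (i, j))));
  last first.
  by move=> i _; rewrite mnmE.
rewrite exchange_big /=; apply: eq_bigr => x _; rewrite ffunE.
rewrite (bigD1 (u x).1) //= big1 ?addn0 => [|i ne].
  by case: (u x) => a b; rewrite xpair_eqE eqxx.
by case: (u x) ne => a b /= ne; rewrite xpair_eqE eq_sym (negPf ne).
Qed.

Lemma mdeg_column_lt u (j : 'I_p) :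
  mdeg [multinom wcount u (i, j) | i < m] < n.+1.
Proof.
rewrite mdeg_column mnmE ltnS -[n in X in _ <= X]card_ord -sum1_card.
by apply: leq_sum => x _; case: eqP.
Qed.

(** The matrix of multiplicities of the letter pairs, each column being stored as an exponent. Words
    lie in the same orbit exactly when their matrices agree. *)
Definition columns u : {ffun 'I_p -> 'X_{1..m < n.+1}} :=
  [ffun j => BMultinom (mdeg_column_lt u j)].

Definition column_margins (al : 'X_{1..m}) (be : 'X_{1..p})
    (f : {ffun 'I_p -> 'X_{1..m < n.+1}}) :=
  [forall j, mdeg (f j) == be j] && ((\sum_j bmnm (f j))%MM == al).

Lemma margins_columns al be u : margins al be u =
  column_margins al be (columns u).
Proof.
rewrite /margins andbC; congr (_ && _).
  apply/eqP/forallP=> [<- j|h].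
    by rewrite ffunE /= mdeg_column.
  by apply/mnmP=> j; rewrite -mdeg_column; have := h j; rewrite ffunE => /eqP.
congr (_ == _); apply/mnmP=> i; rewrite mnm_sumE mnmE.
rewrite (eq_bigr (fun j => \sum_(x < n) (u x == (i, j)))); last first.
  by move=> j _; rewrite ffunE /= mnmE.
rewrite exchange_big /=; apply: eq_bigr => x _; rewrite ffunE.
rewrite (bigD1 (u x).2) //= big1 ?addn0 => [|j ne].
  by case: (u x) => a b; rewrite xpair_eqE eqxx andbT.
by case: (u x) ne => a b /= ne;
  rewrite xpair_eqE [b == j]eq_sym (negPf ne) andbF.
Qed.

(** Each admissible matrix is one orbit of words, and by [sum_card_wstab] an orbit contributes
    n!. *)
Lemma sum_margins_wstab al (be : 'X_{1..p}) : mdeg be = n ->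
  \sum_(u | margins al be u) #|wstab u| =
    n`! * #|[set f | column_margins al be f]|.
Proof.
move=> sb; rewrite (partition_big columns (column_margins al be)) => [|u];
  last first.
  by rewrite margins_columns.
rewrite mulnC -sum1_card big_distrl /= [RHS]big_mkcond [LHS]big_mkcond /=.
apply: eq_bigr => f _; rewrite inE; case: ifP => // cf; rewrite mul1n.
have [u0 eu0] : exists u0 : {ffun 'I_n -> 'I_m * 'I_p}, wcount u0 =1 (fun ij =>
  f ij.2 ij.1).
  apply: exists_wcount; case/andP: cf => /forallP h _.
  rewrite -(pair_bigA _ (fun i j => f j i)) exchange_big /= -[RHS]sb [RHS]mdegE.
  by apply: eq_bigr => j _; rewrite -(eqP (h j)) mdegE.
have ef : columns u0 = f.
  apply/ffunP=> j; apply: val_inj; apply/mnmP=> i.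
  by rewrite ffunE /= mnmE eu0.
rewrite -(sum_card_wstab u0); apply: eq_bigl => u; apply/andP/forallP.
  case=> _ /eqP eu [i j]; rewrite eu0 -eu ffunE /= mnmE.
  by [].
move=> h; have -> : columns u = f.
  by rewrite -ef; apply/ffunP=> j; apply: val_inj; apply/mnmP=> i;
    rewrite !ffunE /= !mnmE; apply/eqP.
rewrite eqxx; split=> //; rewrite margins_columns.
suff -> : columns u = f by [].
by rewrite -ef; apply/ffunP=> j; apply: val_inj; apply/mnmP=> i;
  rewrite !ffunE /= !mnmE; apply/eqP.
Qed.

Local Open Scope ring_scope.

(** Expanding the product picks one monomial from each factor; these are the columns of a matrix
    with the prescribed margins. *)
Lemma mcoeff_hprod (R : numDomainType) al (be : 'X_{1..p}) : mdeg be = n ->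
  (hprod m R be)@_al = #|[set f | column_margins al be f]|%:R.
Proof.
move=> sb; rewrite /hprod big_tuple.
rewrite (eq_bigr (fun j => \sum_(k :
  'X_{1..m < n.+1} | mdeg k == be j) 'X_[k])).
  rewrite bigA_distr_big_dep /=.
  rewrite linear_sum -sum1_card natr_sum big_mkcond [RHS]big_mkcond /=.
  apply: eq_bigr => f _; rewrite inE.
  rewrite -(big_morph _ (@mpolyXD _ _) (@mpolyX0 _ _)) mcoeffX /column_margins.
  rewrite [in LHS](_ : [forall x, _] = [forall j, mdeg (f j) == be j]) //.
  by rewrite inE; case: ifP => //= _; case: eqP.
move=> j _; apply: hsymE; rewrite -sb -mnm_tnth ltnS mdegE (bigD1 j) //=.
exact: leq_addr.
Qed.

End PairWords.

(** * Inner products of permutation characters *)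

Section InnerProducts.

Variable n : nat.

Local Open Scope ring_scope.

Lemma sign_charE (g : 'S_n) : sign_char n g = (-1) ^+ g.
Proof. by rewrite cfunE. Qed.

(** Both sides count the orbits on pairs of words, that is, the matrices with margins [a] and
    [b]. *)
Lemma cfdot_hchar m (a b : seq nat) :
  sumn a = n -> (size a <= m)%N -> sumn b = n ->
  '[hchar n a, hchar n b] = (hprod m algC b)@_(mnm_of_seq m a).
Proof.
move=> sa sz sb; rewrite cfdotE cardsT card_Sn.
have mb : mdeg (mnm_of_seq (size b) b) = n.
  rewrite -sb mdegE sumnE (big_nth 0%N) big_mkord.
  by apply: eq_bigr => i _; rewrite mnmE.
have eb : b = mnm_of_seq (size b) b.
  apply: (@eq_from_nth _ 0%N) => [|i lti]; first by rewrite size_tuple.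
  by rewrite -[i]/(val (Ordinal lti)) -mnm_nth mnmE.
rewrite [in RHS]eb (mcoeff_hprod _ _ mb).
apply: (@mulfI _ n`!%:R); first by rewrite pnatr_eq0 -lt0n fact_gt0.
rewrite mulVKf ?pnatr_eq0 -?lt0n ?fact_gt0 //.
rewrite -natrM -(sum_margins_wstab _ mb) natr_sum.
rewrite (eq_bigr (fun u => \sum_(g in wstab u) 1)); last first.
  by move=> u _; rewrite -sum1_card natr_sum.
rewrite -(sum_wfix _ (fun=> 1)) big_mkcond /=; apply: eq_bigr => g _.
rewrite inE mul1r (hcharE _ sa sz) (hcharE _ sb (leqnn _)) conjC_nat -natrM.
by rewrite card_margins.
Qed.

(** With the sign, [sum_sign_wstab] leaves only the injective pair words, whose matrices have
    entries 0 and 1. *)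
Lemma cfdot_hchar_sign m p (a b : seq nat) :
  sumn a = n -> (size a <= m)%N -> sumn b = n -> (size b <= p)%N ->
  '[hchar n a, hchar n b * sign_char n] =
  n`!%:R^-1 * #|[set u : {ffun 'I_n -> 'I_m * 'I_p} |
     margins (mnm_of_seq _ a) (mnm_of_seq _ b) u && injectiveb u]|%:R.
Proof.
move=> sa sza sb szb; rewrite cfdotE cardsT card_Sn; congr (_ * _).
rewrite -sum1_card natr_sum [RHS]big_mkcond /=.
rewrite (eq_bigr (fun u => if margins (mnm_of_seq m a) (mnm_of_seq p b) u then
   \sum_(g in wstab u) (-1) ^+ g else 0 : algC)); last first.
  move=> u _; rewrite inE sum_sign_wstab.
  by case: (margins _ _ u) => //=; case: injectiveb.
rewrite -big_mkcond -sum_wfix /= [LHS]big_mkcond /=; apply: eq_bigr => g _.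
rewrite inE cfunE (hcharE _ sa sza) (hcharE _ sb szb) rmorphM /= conjC_nat.
rewrite sign_charE rmorph_sign mulrA -natrM mulrC.
by rewrite card_margins.
Qed.

End InnerProducts.

(** * Irreducible characters labelled by partitions *)

Lemma ltn_col_len (la : seq nat) i j :
  sorted geq la -> (i < col_len la j) = (j < nth 0 la i).
Proof.
rewrite /col_len; elim: la i => [|x la IH] i sla /=; first by rewrite nth_nil.
have sla' := path_sorted sla.
case: i => [|i] /=.
  case: (ltnP j x) => [//|lejx]; rewrite add0n; apply/negbTE; rewrite -eqn0Ngt.
  rewrite -leqn0 leqNgt -has_count; apply/hasP=> -[y yla /= ltjy].
  have /allP/(_ y yla) /= := order_path_min geq_transitive sla.
  by move=> h; move: (leq_trans ltjy (leq_trans h lejx)); rewrite ltnn.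
case: (ltnP j x) => [_|lejx]; first by rewrite add1n ltnS IH.
rewrite add0n; have -> : (j < nth 0 la i) = false.
  apply/negbTE; rewrite -leqNgt; apply: leq_trans lejx.
  have := @nth_sorted_geq (x :: la) 0 i.+1 sla isT; exact.
have := IH i sla'; have -> : (j < nth 0 la i) = false.
  apply/negbTE; rewrite -leqNgt; apply: leq_trans lejx.
  have := @nth_sorted_geq (x :: la) 0 i.+1 sla isT; exact.
by move/negbT; rewrite -leqNgt => h; apply/negbTE; rewrite -leqNgt;
  apply: leq_trans h _.
Qed.

Lemma sum_ltn_ord m k : \sum_(i < m) (i < k) = minn m k.
Proof.
rewrite -(big_mkord xpredT (fun i => nat_of_bool (i < k))).
elim: m => [|m IH]; first by rewrite big_nil min0n.
by rewrite big_nat_recr //= IH; case: ltnP; lia.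
Qed.

Lemma nth_conj_partn (la : seq nat) c :
  sorted geq la -> nth 0 (conj_partn la) c = col_len la c.
Proof.
move=> sla; have [lt|ge] := ltnP c (head 0 la); first by rewrite nth_mkseq.
rewrite nth_default ?size_mkseq //; apply/esym/eqP; rewrite -leqn0 leqNgt.
by rewrite ltn_col_len // nth0 -leqNgt.
Qed.

Lemma sum_nth_cond m (la : seq nat) : size la <= m ->
  sumn la = \sum_(i < m) nth 0 la i.
Proof.
move=> sz; rewrite sumnE (big_nth 0) big_mkord (big_ord_widen _ (nth 0 la) sz).
by rewrite big_mkcond; apply: eq_bigr => i _; case: ltnP => // h;
  rewrite nth_default.
Qed.

Lemma nth_le_head (la : seq nat) i : sorted geq la -> nth 0 la i <= head 0 la.
Proof. by move=> sla; rewrite -nth0; apply: nth_sorted_geq. Qed.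

Lemma sum_col_len m (la : seq nat) c : sorted geq la -> size la <= m ->
  col_len la c = \sum_(i < m) (c < nth 0 la i).
Proof.
move=> sla sz; rewrite (eq_bigr (fun i : 'I_m => (i < col_len la c) : nat)).
  rewrite sum_ltn_ord; apply/esym/minn_idPr; apply: leq_trans sz.
  exact: count_size.
by move=> i _; rewrite ltn_col_len.
Qed.

Lemma sumn_conj_partn (la : seq nat) : sorted geq la ->
  sumn (conj_partn la) = sumn la.
Proof.
move=> sla; rewrite (@sum_nth_cond (head 0 la)) ?size_mkseq //.
rewrite (eq_bigr (fun c : 'I_(head 0 la) => \sum_(i < size la) (c < nth 0 la
  i))).
  rewrite exchange_big (sum_nth_cond (leqnn (size la)));
    apply: eq_bigr => i _ /=.
  by rewrite sum_ltn_ord; apply/minn_idPr/nth_le_head.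
by move=> c _; rewrite nth_conj_partn // (sum_col_len _ sla (leqnn _)).
Qed.

Lemma sum_pair_set (I J : finType) (A : {set I * J}) (F : I * J -> nat) :
  \sum_(ij in A) F ij = \sum_i \sum_j (if (i, j) \in A then F (i, j) else 0).
Proof. by rewrite big_mkcond pair_bigA; apply: eq_bigr => -[]. Qed.

(** * Zero-one matrices whose column sums are the conjugate partition *)

Section RowColumn.

Variables (n m : nat) (la : seq nat).
Hypotheses (sla : sorted geq la) (sz : size la <= m) (sn : sumn la = n).

Let p := head 0 la.
Implicit Types u : {ffun 'I_n -> 'I_m * 'I_p}.

Let incol u j (c : 'I_p) := \sum_(x < n) (((u x).2 == c) && ((u x).1 < j)).

(** [incol u j c] counts the letters of column [c] in the first [j] rows. An injective word uses
    each cell at most once, whence the bound [j]. *)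
Lemma incol_le u j c : injective u ->
  content (sndw u) = mnm_of_seq p (conj_partn la) ->
  incol u j c <= minn j (col_len la c).
Proof.
move=> iu cu; rewrite leq_min; apply/andP; split; last first.
  have /mnmP/(_ c) := cu; rewrite !mnmE nth_conj_partn // => <-.
  by apply: leq_sum => x _; rewrite ffunE; case: eqP; case: ltnP.
rewrite /incol -big_mkcond /= sum1_card -(card_in_imset (f := fun x => (u
  x).1)).
  apply: (@leq_trans #|[set i : 'I_m | i < j]|).
    apply/subset_leq_card/subsetP=> i /imsetP[x].
    by rewrite unfold_in => /andP[_ lt] ->; rewrite inE.
  rewrite -sum1_card big_mkcond /=; apply: (@leq_trans (minn m j)).
    by rewrite -sum_ltn_ord; apply: leq_sum => i _; rewrite inE; case: ifP.
  exact: geq_minr.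
move=> x y; rewrite !unfold_in => /andP[/eqP ex _] /andP[/eqP ey _] e.
by apply: iu; rewrite [u x]surjective_pairing [u y]surjective_pairing e ex ey.
Qed.

Lemma sum_incol u j : \sum_c incol u j c =
  \sum_(i < m | i < j) content (fstw u) i.
Proof.
rewrite /incol exchange_big /= [RHS](eq_bigr (fun i => \sum_(x < n) ((u x).1 ==
  i))).
  rewrite [RHS]exchange_big /=; apply: eq_bigr => x _.
  rewrite (bigD1 (u x).2) //= eqxx big1 ?addn0 => [|c ne]; last first.
    by rewrite eq_sym (negPf ne).
  rewrite big_mkcond (bigD1 (u x).1) //= eqxx big1 ?addn0 => [|i ne].
    by case: ltnP.
  by rewrite eq_sym (negPf ne); case: ifP.
by move=> i _; rewrite mnmE; apply: eq_bigr => x _; rewrite ffunE.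
Qed.

Lemma sum_minn_col j :
  \sum_(c < p) minn j (col_len la c) = \sum_(i < m | i < j) nth 0 la i.
Proof.
rewrite (eq_bigr (fun c : 'I_p => \sum_(i < m | i < j) (c < nth 0 la i))).
  rewrite exchange_big; apply: eq_bigr => i _ /=.
  by rewrite sum_ltn_ord; apply/minn_idPr/nth_le_head.
move=> c _; rewrite big_mkcond.
rewrite (eq_bigr (fun i : 'I_m => (i < minn j (col_len la c)) : nat)).
  rewrite sum_ltn_ord; apply/esym/minn_idPr; rewrite geq_min; apply/orP; right.
  by apply: leq_trans sz; apply: count_size.
by move=> i _; rewrite leq_min ltn_col_len //; case: ifP.
Qed.

(** The dominance half of the Gale-Ryser theorem, obtained by adding the column bounds. *)
Lemma sum_content_le u j : injective u ->
  content (sndw u) = mnm_of_seq p (conj_partn la) ->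
  \sum_(i < m | i < j) content (fstw u) i <= \sum_(i < m | i < j) nth 0 la i.
Proof.
move=> iu cu; rewrite -sum_incol -sum_minn_col.
by apply: leq_sum => c _; apply: incol_le.
Qed.

Let young_diagram : {set 'I_m * 'I_p} := [set ic :
  'I_m * 'I_p | ic.2 < nth 0 la ic.1].

Lemma card_young_diagram : #|young_diagram| = n.
Proof.
rewrite -sn (sum_nth_cond sz) -sum1_card sum_pair_set.
apply: eq_bigr => i _; rewrite -[RHS](minn_idPr (nth_le_head i sla))
  -sum_ltn_ord.
by apply: eq_bigr => c _; rewrite inE /=; case: ifP.
Qed.

(** For row sums [la] the column bounds add up to an equality, so each is tight; at
    [j := col_len la c] this puts every letter of column [c] inside the diagram. Conversely an
    injection of n positions into n cells is onto, which gives the margins. *)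
Lemma margins_diagram u : injective u ->
  margins (mnm_of_seq m la) (mnm_of_seq p (conj_partn la)) u =
  (u \in ffun_on (mem young_diagram)).
Proof.
move=> iu; apply/andP/ffun_onP.
  case=> /eqP c1 /eqP c2 x; rewrite inE.
  set c := (u x).2; set j := col_len la c.
  have : \sum_c incol u j c == \sum_(c < p) minn j (col_len la c).
    rewrite sum_incol sum_minn_col c1; apply/eqP; apply: eq_bigr => i _.
    by rewrite mnmE.
  rewrite (leqif_sum (fun c _ => leqif_eq (incol_le j c iu c2))).
  move=> /forallP/(_ c)/=; rewrite minnn => /eqP ec.
  have : content (sndw u) c = j by rewrite c2 mnmE nth_conj_partn.
  rewrite -ec mnmE => /eqP; rewrite eq_sym /incol.
  rewrite (leqif_sum (C := fun x => (((u x).2 == c)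
    && ((u x).1 < j)) == ((u x).2 == c))) => [|y _].
    by move=> /forallP/(_ x)/=; rewrite eqxx /= ltn_col_len // => /eqP.
  by rewrite ffunE /leqif; case: eqP; case: ltnP.
move=> uR.
have eR : u @: setT = young_diagram.
  apply/eqP; rewrite eqEcard card_young_diagram card_imset // cardsT card_ord
    leqnn andbT.
  by apply/subsetP=> ic /imsetP[x _ ->]; apply: uR.
have sumR (F : 'I_m * 'I_p ->
  nat) : \sum_(x < n) F (u x) = \sum_(ic in young_diagram) F ic.
  rewrite -eR big_imset /=; last by move=> x y _ _; apply: iu.
  by apply: eq_bigl => x; rewrite inE.
split; apply/eqP/mnmP=> i; rewrite !mnmE.
  rewrite /wcount (eq_bigr (fun x => ((u x).1 == i) : nat)) => [|x _];
    last by rewrite ffunE.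
  rewrite (sumR (fun ic => ic.1 == i)) sum_pair_set.
  rewrite (bigD1 i) //= eqxx [X in _ + X]big1 ?addn0 => [|a ne]; last first.
    by rewrite big1 // => c _; rewrite (negPf ne); case: ifP.
  rewrite -[RHS](minn_idPr (nth_le_head i sla)) -sum_ltn_ord.
  by apply: eq_bigr => c _; rewrite inE /=; case: ifP.
rewrite nth_conj_partn // (sum_col_len _ sla sz).
rewrite /wcount (eq_bigr (fun x => ((u x).2 == i) : nat)) => [|x _];
  last by rewrite ffunE.
rewrite (sumR (fun ic => ic.2 == i)) sum_pair_set.
apply: eq_bigr => a _; rewrite (bigD1 i) //= inE eqxx big1 ?addn0 /= => [|c ne].
  by case: ifP.
by rewrite (negPf ne); case: ifP.
Qed.

Lemma card_inj_margins :
  #|[set u : {ffun 'I_n -> 'I_m * 'I_p} |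
     margins (mnm_of_seq m la) (mnm_of_seq p (conj_partn la)) u
       && injectiveb u]|
  = n`!.
Proof.
transitivity #|[set u : {ffun 'I_n -> 'I_m * 'I_p} in
                  ffun_on (mem young_diagram) | injectiveb u]|.
  apply: eq_card => u; rewrite inE [RHS]inE.
  case: (boolP (injectiveb u)) => [/injectiveP iu|]; last by rewrite !andbF.
  by rewrite !andbT margins_diagram.
by rewrite card_inj_ffuns_on card_ord card_young_diagram ffactnn.
Qed.

Lemma card_inj_margins_gt (al : 'X_{1..m}) j :
  \sum_(i < m | i < j) nth 0 la i < \sum_(i < m | i < j) al i ->
  #|[set u : {ffun 'I_n -> 'I_m * 'I_p} |
     margins al (mnm_of_seq p (conj_partn la)) u && injectiveb u]| = 0.
Proof.
move=> lt; apply: eq_card0 => u; rewrite !inE; apply/negbTE/negP.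
case/andP=> /andP[/eqP e1 /eqP e2] /injectiveP iu.
by have := sum_content_le j iu e2; rewrite e1 leqNgt lt.
Qed.

End RowColumn.

Lemma sign_mx_repr n :
  mx_repr [set: 'S_n] (fun g : 'S_n => ((-1) ^+ g)%:M%R : 'M[algC]_1).
Proof.
split=> [|g h _ _]; first by rewrite odd_perm1.
by rewrite odd_permM signr_addb scalar_mxM.
Qed.

Lemma sign_char_char n : sign_char n \is a character.
Proof.
suff -> : sign_char n = cfRepr (MxRepresentation (sign_mx_repr n)).
  exact: cfRepr_char.
apply/cfunP=> g; rewrite sign_charE cfunE in_setT /= /repr_mx /=.
by rewrite mxtrace_scalar mulr1n.
Qed.

(** * The Jacobi-Trudi character *)

Section SpechtCharacter.

Variables (n m : nat) (la : seq nat).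
Hypotheses (sla : sorted geq la) (sz : size la <= m) (sn : sumn la = n).

Local Open Scope ring_scope.

Let pla : padded m la. Proof. by []. Qed.
Let be := beta_mnm m la.
Let row (s : 'S_m) : seq nat := (be - staircase s)%MM.

Lemma size_row s : size (row s) = m.
Proof. by rewrite size_tuple. Qed.

Lemma mnm_of_row s : mnm_of_seq m (row s) = (be - staircase s)%MM.
Proof. by apply/mnmP=> i; rewrite mnmE -mnm_nth. Qed.

Lemma mdeg_staircase (s : 'S_m) : mdeg (staircase s) =
  (\sum_(i < m) (m - i.+1))%N.
Proof.
rewrite mdegE [RHS](reindex_inj (@perm_inj _ s)).
by apply: eq_bigr => i _; rewrite mnmE.
Qed.

Lemma sumn_row s : (staircase s <= be)%MM -> sumn (row s) = n.
Proof.
move=> le; have := mdeg_sub le.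
rewrite mdeg_staircase mdeg_beta_mnm // sn addnK => <-.
rewrite (@sum_nth_cond m) ?size_row // mdegE.
by apply: eq_bigr => i _; rewrite -mnm_nth.
Qed.

(* Jacobi-Trudi determinant: row [s] has entries la_i + s(i) - i, and the terms
   with a negative entry are dropped. *)
Definition specht_char : 'CF([set: 'S_n]) :=
  \sum_(s : 'S_m | (staircase s <= be)%MM) (-1) ^+ s *: hchar n (row s).

Lemma hchar_char a : hchar n a \is a character.
Proof. by apply: cfInd_char; apply: rpred1. Qed.

Lemma specht_vchar : specht_char \in 'Z[irr [set: 'S_n]]%g.
Proof.
apply: rpred_sum => s _; rewrite rpredZsign.
exact/char_vchar/hchar_char.
Qed.

(** The signs and rows are those of the expansion of a_delta, so the alternating sum of inner
    products is multiplication by a_delta. *)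
Lemma cfdot_specht_hchar (b : seq nat) : sumn b = n ->
  '[specht_char, hchar n b] = (vdm m algC * hprod m algC b)@_be.
Proof.
move=> sb; rewrite cfdot_suml mcoeff_vdmM; apply: eq_bigr => s le.
by rewrite cfdotZl (@cfdot_hchar _ m) ?sumn_row ?size_row // mnm_of_row.
Qed.

Lemma staircase1_le : (staircase 1 <= be)%MM.
Proof. by apply/mnm_lepP=> i; rewrite !mnmE perm1 leq_addl. Qed.

(** After expansion of the second factor, [mcoeff_vdm_hprod_perm] leaves only the identity term. *)
Lemma cfnorm_specht : '[specht_char] = 1.
Proof.
rewrite {2}/specht_char cfdot_sumr (bigD1 1%g) ?staircase1_le //=.
rewrite cfdotZr rmorph_sign odd_perm1 mul1r cfdot_specht_hchar ?sumn_row
  ?staircase1_le //.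
rewrite mcoeff_vdm_hprod_perm ?staircase1_le // eqxx big1 ?addr0 // =>
  s /andP[le ne].
rewrite cfdotZr cfdot_specht_hchar ?sumn_row //.
by rewrite mcoeff_vdm_hprod_perm // (negPf ne) mulr0.
Qed.

Lemma cfdot_specht_hchar_self : '[specht_char, hchar n la] = 1.
Proof.
rewrite cfdot_specht_hchar //; exact: mcoeff_vdm_hprod_refl.
Qed.

Lemma size_conj : size (conj_partn la) = head 0%N la.
Proof. exact: size_mkseq. Qed.

Lemma fact_neq0 : n`!%:R != 0 :> algC.
Proof. by rewrite pnatr_eq0 -lt0n fact_gt0. Qed.

Lemma cfdot_hchar_sign_conj :
  '[hchar n la, hchar n (conj_partn la) * sign_char n] = 1.
Proof.
rewrite (@cfdot_hchar_sign _ m (head 0%N la)) ?sumn_conj_partn ?size_conj //.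
by rewrite card_inj_margins // mulVf ?fact_neq0.
Qed.

Lemma row1 : mnm_of_seq m (row 1) = mnm_of_seq m la.
Proof. by rewrite mnm_of_row; apply/mnmP=> i;
  rewrite mnmBE !mnmE perm1 addnK. Qed.

(** For [s] other than the identity the first moved row is lengthened, so a partial row sum exceeds
    that of [la] and no zero-one matrix exists. *)
Lemma cfdot_specht_sign_conj :
  '[specht_char, hchar n (conj_partn la) * sign_char n] = 1.
Proof.
rewrite cfdot_suml (bigD1 1%g) ?staircase1_le //= cfdotZl odd_perm1 mul1r.
rewrite (@cfdot_hchar_sign _ m (head 0%N la)) ?sumn_conj_partn ?size_conj
  ?size_row //;
  last by rewrite sumn_row ?staircase1_le.
rewrite row1 card_inj_margins // mulVf ?fact_neq0 // big1 ?addr0 // =>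
  s /andP[le ne].
rewrite cfdotZl (@cfdot_hchar_sign _ m (head 0%N la)) ?sumn_conj_partn
  ?size_conj ?size_row //;
  last by rewrite sumn_row.
suff [j lt] : exists j, (\sum_(i < m | i < j) nth 0 la i <
    \sum_(i < m | i < j) mnm_of_seq m (row s) i)%N.
  by rewrite (card_inj_margins_gt _ sla sz lt) mulr0 mulr0.
have [j [ltj fixj]] := perm_first_moved ne.
exists j.+1; rewrite mnm_of_row (bigD1 j) //= [X in (_ < X)%N](bigD1 j) //=.
rewrite -addSn; apply: leq_add.
  by rewrite mnmBE !mnmE; have := ltn_ord (s j); lia.
apply: leq_sum => i /andP[lei nei]; rewrite mnmBE !mnmE.
by rewrite fixj ?addnK // ltn_neqAle nei /= -ltnS.
Qed.

Definition specht_deg : int := (vdm m int * (\sum_(i < m) 'X_i) ^+ n)@_be.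

Lemma specht_char1 : specht_char 1%g = specht_deg%:~R.
Proof.
rewrite /specht_deg mcoeff_vdmM /specht_char sum_cfunE rmorph_sum /=.
apply: eq_bigr => s le; rewrite cfunE rmorphM rmorph_sign; congr (_ * _).
rewrite mcoeff_powersum_exp (@hcharE _ m) ?sumn_row ?size_row // mnm_of_row.
rewrite rmorph_nat; congr (_ %:R).
by apply: eq_card => w; rewrite !inE wperm1 eqxx andbT.
Qed.

End SpechtCharacter.

Section OddPartitions.

Local Open Scope ring_scope.

(** Norm 1 makes [specht_char] plus or minus an irreducible character, which occurs in both induced
    characters. A second common constituent would raise their inner product, which is 1, to at least
    2. The absolute value removes the sign. *)
Lemma odd_partn_specht_deg (m : nat) (la : seq nat) :
  sorted geq la -> (size la <= m)%N ->
  odd_partn la = odd `|specht_deg (sumn la) m la|%N.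
Proof.
move=> sla sz; set n := sumn la; pose S := specht_char n m la.
have sn : sumn la = n by [].
have [b [i0 eS]] := vchar_norm1P (specht_vchar n m la) (cfnorm_specht sla sz
  sn).
have sign_neq0 : (-1) ^+ b != 0 :> algC by rewrite signr_eq0.
have H0 : '[hchar n la, 'chi_i0] != 0.
  apply/eqP=> h; have := cfdot_specht_hchar_self sla sz sn.
  rewrite eS cfdotZl cfdotC h conjC0 mulr0 => /eqP.
  by rewrite eq_sym oner_eq0.
have E0 : '[hchar n (conj_partn la) * sign_char n, 'chi_i0] != 0.
  apply/eqP=> h; have := cfdot_specht_sign_conj sla sz sn.
  rewrite eS cfdotZl cfdotC h conjC0 mulr0 => /eqP.
  by rewrite eq_sym oner_eq0.
set H := hchar n la in H0; set E := _ * _ in E0.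
have charE : E \is a character.
  by apply: rpredM; [apply: hchar_char | apply: sign_char_char].
have eE : 'Ind[[set: 'S_n]] ('Res[young_group n (conj_partn la)] (sign_char n))
  = E.
  by rewrite -[X in 'Ind[_] X]mul1r cfIndM ?subsetT.
have is_chiE (i : Iirr [set: 'S_n]) :
    @is_chi la i = ('[H, 'chi_i] != 0) && ('[E, 'chi_i] != 0).
  by rewrite /is_chi !irr_consttE eE.
have chi_uniq (i : Iirr [set: 'S_n]) : @is_chi la i = (i == i0).
  rewrite is_chiE; apply/idP/eqP=> [/andP[Hi Ei]|->]; last by rewrite H0.
  apply/eqP/negPn/negP=> ne; have := cfdot_hchar_sign_conj sla sz sn.
  rewrite -/H -/E cfdot_sum_irr (bigD1 i0) //= (bigD1 i) //=.
  have cH : H \is a character := hchar_char n la.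
  have pos (phi : 'CF([set: 'S_n])) j :
      phi \is a character -> '[phi, 'chi_j] != 0 -> 1 <= '[phi, 'chi_j].
    move=> cphi; have /natrP[k ->] := Cnat_cfdot_char_irr j cphi.
    by rewrite pnatr_eq0 -lt0n ler1n.
  have nneg (phi : 'CF([set: 'S_n])) j :
      phi \is a character -> 0 <= '[phi, 'chi_j].
    by move=> cphi; apply/natr_ge0/Cnat_cfdot_char_irr.
  have term j : '[H, 'chi_j] * '[E, 'chi_j]^* = '[H, 'chi_j] * '[E, 'chi_j].
    by rewrite conj_natr // Cnat_cfdot_char_irr.
  rewrite !term => e; suff le21 :
    2%:R <= 1 :> algC by have := ler_nat algC 2 1; rewrite le21.
  rewrite -[X in _ <= X]e addrA; apply: ler_wpDr.
    by apply: sumr_ge0 => j _; rewrite term mulr_ge0 ?nneg.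
  by apply: (@lerD _ 1 _ 1); rewrite -[1]mulr1 ler_pM ?pos.
have deg0 : `|specht_deg n m la|%:R = 'chi_i0 1%g.
  have /natrP[k ek] := Cnat_irr1 i0; rewrite ek; congr (_ %:R).
  have := specht_char1 sz sn; rewrite eS cfunE ek => /(congr1 Num.norm).
  rewrite normrM normr_sign mul1r normr_nat -intr_norm.
  by rewrite -abszE -pmulrn => /eqP; rewrite eqr_nat => /eqP.
rewrite /odd_partn; apply/existsP/idP => [[i]|od].
  by rewrite chi_uniq => /andP[/eqP ->]; rewrite -deg0 natrK.
by exists i0; rewrite chi_uniq eqxx -deg0 natrK.
Qed.

End OddPartitions.

(** * Degrees modulo 2 *)

Section ParityRecursion.

Local Open Scope ring_scope.

Lemma odd_abszD (a b : int) : odd `|a + b| = odd `|a| (+) odd `|b|.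
Proof. lia. Qed.

Lemma odd_abszMn2 (a : int) : odd `|a *+ 2| = false.
Proof. lia. Qed.

Lemma odd_absz_sum (I : Type) (r : seq I) (P : pred I) (F : I -> int) :
  odd `|\sum_(i <- r | P i) F i| = odd (\sum_(i <- r | P i) odd `|F i|)%N.
Proof.
elim: r => [|x r IH]; first by rewrite !big_nil.
rewrite !big_cons; case: ifP => // _.
by rewrite odd_abszD IH oddD oddb.
Qed.

(** Repeated squaring; the remainder is explicit because the congruence is later read off integer
    coefficients. *)
Lemma sum_exp_2exp (R : comNzRingType) (I : finType) (x : I -> R) k :
  exists r, (\sum_i x i) ^+ (2 ^ k) = \sum_i x i ^+ (2 ^ k) + r *+ 2.
Proof.
have sq (J : seq I) (y : I -> R) :
    exists r, (\sum_(i <- J) y i) ^+ 2 = \sum_(i <- J) y i ^+ 2 + r *+ 2.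
  elim: J => [|j J [r e]]; first by exists 0;
    rewrite !big_nil expr0n mul0rn addr0.
  exists (y j * (\sum_(i <- J) y i) + r); rewrite !big_cons sqrrD e.
  ring.
elim: k => [|k [r e]]; first by exists 0; rewrite mul0rn addr0; apply: eq_bigr.
have [r' e'] := sq (index_enum I) (fun i => x i ^+ (2 ^ k)).
exists (r' + (\sum_i x i ^+ (2 ^ k)) * r *+ 2 + r ^+ 2 *+ 2).
rewrite expnSr exprM e sqrrD e'.
rewrite (eq_bigr (fun i => x i ^+ (2 ^ k * 2))) => [|i _];
  last by rewrite exprM.
ring.
Qed.

Variable m : nat.

(** The coefficient of [specht_deg] at an arbitrary exponent, since lowering one entry of la + delta
    may destroy its order. *)
Definition sdeg n (mu : 'X_{1..m}) :
  int := (vdm m int * (\sum_(i < m) 'X_i) ^+ n)@_mu.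

Lemma sdeg_alternating n :
  alternating (vdm m int * (\sum_(i < m) 'X_i) ^+ n).
Proof.
apply: alternatingM; first exact: vdm_alternating.
move=> s; rewrite rmorphXn rmorph_sum /=; congr (_ ^+ _).
rewrite [RHS](reindex_inj (@perm_inj _ s)) /=; apply: eq_bigr => i _.
rewrite msymX; congr 'X_[_]; apply/mnmP=> j; rewrite !mnmE.
by rewrite -(inj_eq (@perm_inj _ s)) permKV.
Qed.

Lemma absz_sdeg_perm n (mu nu : 'X_{1..m}) :
  perm_eq mu nu -> `|sdeg n mu|%N = `|sdeg n nu|%N.
Proof.
case/tuple_permP=> s e.
have -> : mu = [multinom nu (s i) | i < m].
  apply/mnmP=> i; rewrite mnmE (mnm_nth 0%N) e -tnth_nth tnth_mktuple.
  by rewrite mnm_tnth.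
rewrite /sdeg (mcoeff_alternating _ _ (sdeg_alternating n)) abszM.
by rewrite -signr_odd abszX; case: (odd _); rewrite ?mul1n.
Qed.

Lemma sdeg_eq0 n (mu : 'X_{1..m}) i j : i != j -> mu i = mu j -> sdeg n mu = 0.
Proof.
move=> ne e; have := mcoeff_alternating (tperm i j) mu (sdeg_alternating n).
rewrite odd_tperm ne expr1 mulN1r.
have -> : [multinom mu (tperm i j k) | k < m] = mu.
  by apply/mnmP=> k; rewrite mnmE; case: tpermP => [->|->|].
by rewrite /sdeg; set c := (X in X = _) => h; lia.
Qed.

Lemma odd_sdeg_rec n k (mu : 'X_{1..m}) : (2 ^ k <= n)%N ->
  odd `|sdeg n mu| =
  odd (\sum_(i < m | 2 ^ k <= mu i) odd `|sdeg (n - 2 ^ k) (mu - U_(i) *+ 2 ^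
    k)%MM|)%N.
Proof.
move=> le; rewrite {1}/sdeg -{1}(subnK le) exprD.
have [r ->] := sum_exp_2exp (fun i : 'I_m => 'X_i : {mpoly int[m]}) k.
rewrite mulrA mulrDr mcoeffD mulrnAr mcoeffMn odd_abszD odd_abszMn2 addbF.
rewrite mulr_sumr linear_sum /= odd_absz_sum; congr (odd _).
rewrite [RHS]big_mkcond /=; apply: eq_bigr => i _.
rewrite mpolyXn mulrC mcoeffXM.
have -> : (U_(i) *+ 2 ^ k <= mu)%MM = (2 ^ k <= mu i)%N.
  apply/mnm_lepP/idP=> [/(_ i)|h j]; rewrite mulmnE mnm1E ?eqxx ?mul1n //.
  by case: eqP => [<-|_]; rewrite ?mul1n // mul0n.
by case: ifP.
Qed.

Lemma sdeg0 : sdeg 0 (beta_mnm m [::]) = 1.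
Proof. by rewrite /sdeg expr0 mulr1 mcoeff_vdm_nil. Qed.

End ParityRecursion.

(** * Beta-sets *)

Lemma nth_filter_pos (l : seq nat) i :
  sorted geq l -> nth 0 [seq p <- l | 0 < p] i = nth 0 l i.
Proof.
elim: l i => //= x l IH i sl; have sl' := path_sorted sl.
case: x sl => [|x] sl /=; last by case: i => //= i; apply: IH.
rewrite IH //; have all0 j : nth 0 l j = 0.
  have := @nth_sorted_geq (0 :: l) 0 j.+1 sl isT; rewrite /= leqn0.
  by move/eqP.
by case: i => [|i] /=; rewrite !all0.
Qed.

Definition is_partition (la : seq nat) := sorted geq la && (0 \notin la).

Lemma eq_is_partition (la nu : seq nat) : is_partition la -> is_partition nu ->
  (forall i, nth 0 la i = nth 0 nu i) -> la = nu.
Proof.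
case/andP=> _ z1 /andP[_ z2] e.
have pos (l : seq nat) i : 0 \notin l -> (0 < nth 0 l i) = (i < size l).
  move=> z; case: (ltnP i (size l)) => [lt|ge]; last by rewrite nth_default.
  by rewrite lt0n; apply: contra z => /eqP <-; apply: mem_nth.
apply: (@eq_from_nth _ 0) => [|i _]; last exact: e.
case: (ltngtP (size la) (size nu)) => // lt.
  by move: (lt); rewrite -(pos _ _ z2) -e nth_default.
by move: (lt); rewrite -(pos _ _ z1) e nth_default.
Qed.

Lemma is_partition_beta (xs : seq nat) :
  sorted gtn xs -> is_partition (partn_of_beta xs) /\
  (forall i, i < size xs -> nth 0 (partn_of_beta xs) i =
    nth 0 xs i - (size xs - i.+1)).
Proof.
move=> sx; set l := mkseq (fun i => nth 0 xs i - (size xs - i.+1)) (size xs).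
have sl : sorted geq l.
  apply/(sortedP 0) => i; rewrite size_mkseq => lti.
  rewrite !nth_mkseq //; last exact: ltnW.
  have /(sortedP 0)/(_ i lti)/= := sx; rewrite /geq /=; lia.
split=> [|i lti]; last by rewrite /partn_of_beta nth_filter_pos // nth_mkseq.
rewrite /is_partition mem_filter andbT /partn_of_beta sorted_filter //.
exact: geq_transitive.
Qed.

Lemma size_partn_of_beta xs : size (partn_of_beta xs) <= size xs.
Proof.
by rewrite size_filter (leq_trans (count_size _ _)) // size_mkseq.
Qed.

Lemma gtn_sorted_ge (xs : seq nat) i : sorted gtn xs -> i < size xs ->
  size xs - i.+1 <= nth 0 xs i.
Proof.
move=> sx lti; have [k ek] : exists k, size xs - i.+1 = k by eexists.
elim: k i lti ek => [|k IH] i lti ek; first by rewrite ek.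
have lti1 : i.+1 < size xs by lia.
have := IH i.+1 lti1; have /(sortedP 0)/(_ i lti1)/= := sx; lia.
Qed.

Lemma beta_set_partn (xs : seq nat) :
  sorted gtn xs -> beta_set (size xs) (partn_of_beta xs) = xs.
Proof.
move=> sx; have [_ e] := is_partition_beta sx.
apply: (@eq_from_nth _ 0) => [|i]; rewrite size_mkseq // => lti.
by rewrite nth_mkseq // e // subnK // gtn_sorted_ge.
Qed.

Lemma sorted_beta_set m la : sorted geq la -> sorted gtn (beta_set m la).
Proof.
move=> sla; apply/(sortedP 0) => i; rewrite size_mkseq => lti.
rewrite !nth_mkseq //; last exact: ltnW.
have := @nth_sorted_geq la i i.+1 sla (leqnSn _); rewrite /=; lia.
Qed.

Lemma partn_of_beta_set m la :
  is_partition la -> size la <= m -> partn_of_beta (beta_set m la) = la.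
Proof.
move=> pla sz; have /andP[sla _] := pla.
have [pb e] := is_partition_beta (sorted_beta_set m sla).
apply: eq_is_partition => // i; have [lt|ge] := ltnP i m.
  by rewrite e size_mkseq // nth_mkseq // addnK.
by rewrite !nth_default ?(leq_trans sz) // (leq_trans (size_partn_of_beta _))
  ?size_mkseq.
Qed.

(** Unordered, so that removing or adding a hook replaces a single element and nothing is sorted
    again. *)
Definition beads m (la : seq nat) :
  {fset nat} := [fset x | x in beta_set m la]%fset.

Definition bead_partn (X : {fset nat}) : seq nat := partn_of_beta (sort geq X).

Lemma mem_beads m la x : (x \in beads m la) = (x \in beta_set m la).
Proof. by rewrite in_fset. Qed.

Lemma sorted_sort_fset (X : {fset nat}) : sorted gtn (sort geq X).
Proof.
rewrite gtn_sorted_uniq_geq sort_uniq fset_uniq /=.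
by apply: sort_sorted => a b; apply: leq_total.
Qed.

Lemma sort_beads m la : sorted geq la -> sort geq (beads m la) = beta_set m la.
Proof.
move=> sla; have sb := sorted_beta_set m sla.
apply: (sorted_eq (leT := gtn)) => //.
- by move=> a b c /= h1 h2; apply: ltn_trans h2 h1.
- by move=> a b /=; lia.
- exact: sorted_sort_fset.
rewrite perm_sort; apply: uniq_perm; rewrite ?fset_uniq //.
  by move: sb; rewrite gtn_sorted_uniq_geq => /andP[].
by move=> x; rewrite mem_beads.
Qed.

Lemma card_beads m la : sorted geq la -> #|` beads m la| = m.
Proof.
by move=> sla; rewrite -(size_sort geq) sort_beads // size_mkseq.
Qed.

Lemma bead_partn_beads m la : is_partition la -> size la <= m ->
  bead_partn (beads m la) = la.
Proof.
move=> pla sz; have /andP[sla _] := pla.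
by rewrite /bead_partn sort_beads // partn_of_beta_set.
Qed.

Lemma beadsK (X : {fset nat}) : beads #|` X| (bead_partn X) = X.
Proof.
apply/fsetP=> x; rewrite mem_beads /bead_partn -(size_sort geq).
by rewrite beta_set_partn ?sorted_sort_fset // mem_sort.
Qed.

Lemma is_partition_bead_partn (X : {fset nat}) : is_partition (bead_partn X).
Proof. by case: (is_partition_beta (sorted_sort_fset X)). Qed.

Lemma size_bead_partn (X : {fset nat}) : size (bead_partn X) <= #|` X|.
Proof. by rewrite (leq_trans (size_partn_of_beta _)) // size_sort. Qed.

Lemma bead_partn_inj (X Y : {fset nat}) : #|` X| = #|` Y| ->
  bead_partn X = bead_partn Y -> X = Y.
Proof. by move=> e1 e2; rewrite -(beadsK X) -(beadsK Y) e1 e2. Qed.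

Definition bead_sum (X : {fset nat}) := \sum_(x <- X) x.

Definition weight (X : {fset nat}) := sumn (bead_partn X).

(** For a fixed number of beads, weight and sum of positions differ by a constant, so a slide
    changes both alike. *)
Lemma bead_sumE X : bead_sum X = weight X + \sum_(i < #|` X|) (#|` X| - i.+1).
Proof.
rewrite /bead_sum -(perm_big _ (permEl (perm_sort geq X))) /=.
rewrite -{1}(beadsK X) sort_beads;
  last by have /andP[] := is_partition_bead_partn X.
rewrite big_map big_split /= -(big_mkord xpredT (fun i => #|` X| - i.+1)).
rewrite /weight (sum_nth_cond (size_bead_partn X)) -(big_mkord xpredT (nth 0
  (bead_partn X))).
by rewrite /index_iota subn0.
Qed.

Definition slide (X : {fset nat}) (x y : nat) :
  {fset nat} := (y |` (X `\ x))%fset.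

Lemma in_slide X x y z : (z \in slide X x y) =
  (z == y) || (z != x) && (z \in X).
Proof. by rewrite !inE. Qed.

Lemma card_slide X x y : x \in X -> y \notin X -> #|` slide X x y| = #|` X|.
Proof.
move=> xX yX; rewrite cardfsU1 !inE (negPf yX) andbF add1n.
by rewrite [RHS](cardfsD1 x) xX.
Qed.

Lemma bead_sum_slide X x y : x \in X -> y \notin X ->
  bead_sum (slide X x y) + x = bead_sum X + y.
Proof.
move=> xX yX; rewrite /bead_sum /slide big_fsetU1 /=;
  last by rewrite !inE (negPf yX) andbF.
by rewrite [in RHS](big_fsetD1 x) //=; lia.
Qed.

Lemma weight_slide X x y : x \in X -> y \notin X ->
  weight (slide X x y) + x = weight X + y.
Proof.
move=> xX yX; have := bead_sum_slide xX yX; rewrite !bead_sumE card_slide //;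
  lia.
Qed.

Lemma mvK X x y : x \in X -> y \notin X -> slide (slide X x y) y x = X.
Proof.
move=> xX yX; apply/fsetP=> z; rewrite !in_slide.
case: (eqVneq z x) => [->|nzx]; first by rewrite xX.
by case: (eqVneq z y) => [->|] //=; rewrite (negPf yX).
Qed.

Definition odd_beads (X : {fset nat}) : bool := odd_partn (bead_partn X).

Definition is_bead_hook (X : {fset nat}) q x := (q <= x) && (x - q \notin X).

Lemma odd_partnE m (la : seq nat) : is_partition la -> size la <= m ->
  odd_partn la = odd `|sdeg (sumn la) (beta_mnm m la)|.
Proof. by case/andP=> sla _ sz; rewrite (odd_partn_specht_deg sla sz). Qed.

Lemma odd_beads_weight0 X : weight X = 0 -> odd_beads X.
Proof.
move=> z; have e : bead_partn X = [::].
  have /andP[] := is_partition_bead_partn X; move: z; rewrite /weight.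
  by case: (bead_partn X) => // -[] // n l; rewrite inE.
by rewrite /odd_beads e (@odd_partnE 0) // sdeg0.
Qed.

Lemma sum_nat_cond_leq (I : Type) (r : seq I) (P : pred I) (F : I -> bool) :
  \sum_(i <- r | P i) F i = \sum_(i <- r) (P i && F i).
Proof. by rewrite big_mkcond; apply: eq_bigr => i _; case: (P i). Qed.

(** Lowering the exponent [x] by 2^k either hits another exponent, and alternation gives 0, or
    yields, up to order and sign, the beads of the partition without that hook. *)
Lemma odd_beads_rec X k : 2 ^ k <= weight X ->
  odd_beads X = odd (\sum_(x <- X | is_bead_hook X (2 ^ k) x) odd_beads (slide
    X x (x - 2 ^ k))).
Proof.
move=> le; set q := 2 ^ k in le *; have q0 : 0 < q by rewrite expn_gt0.
pose m := #|` X|; pose la := bead_partn X; pose mu := beta_mnm m la.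
have pla : is_partition la := is_partition_bead_partn X.
have sz : size la <= m := size_bead_partn X.
have sla : sorted geq la by case/andP: pla.
have emu : beta_set m la = sort geq X by rewrite -sort_beads // beadsK.
have muE (i : 'I_m) : mu i = nth 0 (sort geq X) i.
  by rewrite mnmE -emu nth_mkseq.
have szs : size (sort geq X) = m by rewrite size_sort.
have us : uniq (sort geq X) by rewrite sort_uniq fset_uniq.
rewrite /odd_beads (@odd_partnE m) // (@odd_sdeg_rec _ _ k) // -/q;
  congr (odd _).
rewrite sum_nat_cond_leq -(perm_big _ (permEl (perm_sort geq X))) /=.
rewrite (big_nth 0) szs big_mkord big_mkcond /=; apply: eq_bigr => i _.
rewrite -muE /is_bead_hook; set x := mu i.
have xX : x \in X by rewrite /x muE -(mem_sort geq) mem_nth // szs.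
case: ifP => //= leq_x; set nu := (mu - _)%MM.
have nui : nu i = x - q by rewrite mnmBE mulmnE mnm1E eqxx mul1n.
have nuj j : j != i -> nu j = mu j.
  by move=> ne; rewrite mnmBE mulmnE mnm1E eq_sym (negPf ne) mul0n subn0.
case: (boolP (x - q \in X)) => [yX|nyX] /=.
  have ltj : index (x - q) (sort geq X) < m by rewrite -szs index_mem mem_sort.
  have ej : mu (Ordinal ltj) = x - q by rewrite muE nth_index // mem_sort.
  have ne : Ordinal ltj != i.
    by apply/eqP=> e; move: ej; rewrite e -/x; move: leq_x q0; lia.
  by rewrite (@sdeg_eq0 _ _ _ (Ordinal ltj) i) // nui nuj.
set Y := slide X x (x - q).
have cY : #|` Y| = m by rewrite card_slide.
have sY : size (bead_partn Y) <= m by rewrite -cY size_bead_partn.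
have eY : beta_set m (bead_partn Y) = sort geq Y.
  by rewrite -sort_beads; [rewrite -cY beadsK | case/andP:
    (is_partition_bead_partn Y)].
rewrite (@odd_partnE m) ?is_partition_bead_partn //.
have -> : sumn (bead_partn Y) = weight X - q.
  by have := weight_slide xX nyX; rewrite -/Y /weight; move: leq_x le;
    rewrite /weight; lia.
congr (odd _ : nat); apply: absz_sdeg_perm.
have bE (l : seq nat) : beta_mnm m l = beta_set m l :> seq nat.
  apply: (@eq_from_nth _ 0); rewrite size_tuple ?size_mkseq // => j ltj.
  by rewrite -[j]/(val (Ordinal ltj)) -mnm_nth mnmE nth_mkseq.
rewrite bE eY; apply: uniq_perm; rewrite ?sort_uniq ?fset_uniq //.
  rewrite (_ : (nu : seq nat) = [tuple nu j | j < m]); last first.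
    apply: (@eq_from_nth _ 0); rewrite !size_tuple // => j ltj.
    by rewrite -[j]/(val (Ordinal ltj)) -mnm_nth -tnth_nth tnth_mktuple.
  rewrite map_inj_uniq ?enum_uniq // => a b.
  have inj (c d : 'I_m) : mu c = mu d -> c = d.
    by rewrite !muE => /eqP; rewrite nth_uniq ?szs // => /eqP /val_inj.
  have mX c : mu c \in X by rewrite muE -(mem_sort geq) mem_nth ?szs.
  case: (eqVneq a i) => [->|na]; case: (eqVneq b i) => [->|nb] //.
  - by rewrite nui nuj // => e; case/negP: nyX; rewrite e.
  - by rewrite nui nuj // => e; case/negP: nyX; rewrite -e.
  by rewrite !nuj //; apply: inj.
move=> z; rewrite mem_sort in_slide.
apply/(nthP 0)/idP => [[j]|].
  rewrite size_tuple => ltj <-;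
    have -> : nth 0 nu j = nu (Ordinal ltj) by rewrite (mnm_nth 0).
  case: (eqVneq (Ordinal ltj) i) => [->|ne]; first by rewrite nui eqxx.
  rewrite nuj // muE -[_ \in X](mem_sort geq) mem_nth ?szs // andbT /x muE.
  by rewrite nth_uniq ?szs // -val_eqE in ne *; rewrite ne orbT.
case/predU1P=> [->|/andP[nzx zX]].
  by exists i; rewrite ?size_tuple // -mnm_nth nui.
have ltj : index z (sort geq X) < m by rewrite -szs index_mem mem_sort.
exists (index z (sort geq X)); rewrite ?size_tuple //.
rewrite -[index z _]/(val (Ordinal ltj)) -mnm_nth nuj ?muE ?nth_index ?mem_sort
  //.
by apply: contra nzx => /eqP e; rewrite /x -e muE nth_index ?mem_sort.
Qed.

(** * Hooks of the diagram as moves of beads *)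

Section HookRemovals.

Variables (m : nat) (la : seq nat).
Hypotheses (pla : is_partition la) (sz : size la <= m).

Let sla : sorted geq la. Proof. by case/andP: pla. Qed.
Let X := beads m la.
Let bead i := nth 0 la i + (m - i.+1).
(** The empty position attached to column [j]: below it lie [j] empty positions and
    [m - col_len la j] beads. The hook of box (i, j) is the move of [bead i] down to [gap j]. *)
Let gap j := j + (m - col_len la j).

Lemma mem_bead i : i < m -> bead i \in X.
Proof.
move=> lti; rewrite mem_beads; apply/mapP; exists i => //.
by rewrite mem_iota.
Qed.

Lemma beadP x : x \in X -> exists2 i, i < m & x = bead i.
Proof.
rewrite mem_beads => /mapP[i]; rewrite mem_iota add0n => lti ->.
by exists i.
Qed.

Lemma col_len_le j : col_len la j <= size la.
Proof. exact: count_size. Qed.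

Lemma bead_gtn i j : i < j -> j < m -> bead j < bead i.
Proof.
by move=> lt ltm; have := nth_sorted_geq sla (ltnW lt); rewrite /bead; lia.
Qed.

Lemma gap_notin j : gap j \notin X.
Proof.
apply/negP=> /beadP[r ltr]; rewrite /gap /bead.
have := ltn_col_len r j sla; have := col_len_le j.
by case: ltnP; case: ltnP; lia.
Qed.

Lemma hook_length_bead i j : j < nth 0 la i ->
  hook_length la (i, j) = bead i - gap j /\ gap j < bead i.
Proof.
move=> lt; have := ltn_col_len i j sla; rewrite lt => lti.
by have := col_len_le j; rewrite /hook_length /bead /gap /=; lia.
Qed.

(** Of the [m] beads [c] lie above [y], hence [m - c] below it, and the number [y - (m - c)] of
    empty positions below [y] is the column sought. *)
Lemma gap_complete i y : i < m -> y < bead i -> y \notin X ->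
  exists2 j, j < nth 0 la i & y = gap j.
Proof.
move=> lti lty nyX; pose bs := beta_set m la; pose c := col_len bs y.
have sgb : sorted geq bs.
  by have := sorted_beta_set m sla; rewrite gtn_sorted_uniq_geq => /andP[].
have nb r : r < m -> nth 0 bs r = bead r by move=> ltr; rewrite nth_mkseq.
have cE r : r < m -> (r < c) = (y < bead r).
  by move=> ltr; rewrite ltn_col_len // nb.
have ltc : i < c by rewrite cE.
have lec : c <= m by rewrite (leq_trans (count_size _ _)) // size_mkseq.
have lemc : m - c <= y.
  have [ltcm|] := ltnP c m; last by lia.
  have := cE c ltcm; rewrite ltnn => /esym/negbT; rewrite -leqNgt.
  rewrite leq_eqVlt => /predU1P[e|]; last by rewrite {1}/bead; lia.
  by case/negP: nyX; rewrite -e; apply: mem_bead.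
have ecol : col_len la (y - (m - c)) = c.
  apply/eqP; rewrite eqn_leq; apply/andP; split; rewrite leqNgt; apply/negP.
    rewrite ltn_col_len // => lt.
    have [ltcm|gecm] := ltnP c m.
      have := cE c ltcm; rewrite ltnn => /esym/negbT; rewrite -leqNgt.
      rewrite leq_eqVlt => /predU1P[e|]; last by rewrite {1}/bead; lia.
      by case/negP: nyX; rewrite -e; apply: mem_bead.
    by rewrite nth_default in lt; [ | apply: leq_trans sz gecm].
  move=> lt; have ltc1 : c.-1 < m by lia.
  have := cE c.-1 ltc1; rewrite (_ : c.-1 < c); last by lia.
  move=> /esym; rewrite /bead => h.
  have := ltn_col_len c.-1 (y - (m - c)) sla.
  by move: lt h ltc; lia.
exists (y - (m - c)); last by rewrite /gap ecol; lia.
by rewrite -ltn_col_len // ecol.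
Qed.

(** From row [i] down to the row above the foot, each row takes over the bead of the next one, and
    the foot takes [gap j]; as sets, only [bead i] is replaced. *)
Lemma remove_hook_bead i j : j < nth 0 la i ->
  remove_hook la (i, j) = bead_partn (slide X (bead i) (gap j)).
Proof.
move=> lt; have ltic : i < col_len la j by rewrite ltn_col_len.
have := col_len_le j => lec.
pose bot := (col_len la j).-1.
pose new r := if i <= r < bot then (nth 0 la r.+1).-1
  else if r == bot then j else nth 0 la r.
rewrite -[remove_hook _ _]/([seq p <- mkseq new (size la) | 0 < p]).
have ltb : bot < size la by rewrite /bot; lia.
have row r : nth 0 la r.+1 <= nth 0 la r by apply: nth_sorted_geq.
have colj r := ltn_col_len r j sla.
have newE r : new r = if i <= r < bot then (nth 0 la r.+1).-1
    else if r == bot then j else nth 0 la r by [].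
have sn : sorted geq (mkseq new (size la)).
  apply/(sortedP 0) => r; rewrite size_mkseq => ltr.
  rewrite !nth_mkseq //=; last exact: ltnW.
  have := row r; have := row r.+1; have := colj r; have := colj r.+1;
    have := colj r.+2.
  by rewrite !newE /bot; do !case: ifP; lia.
have pn : is_partition [seq p <- mkseq new (size la) | 0 < p].
  by rewrite /is_partition mem_filter andbT sorted_filter //;
    apply: geq_transitive.
have szn : size [seq p <- mkseq new (size la) | 0 < p] <= m.
  by rewrite size_filter (leq_trans (count_size _ _)) // size_mkseq.
rewrite -[LHS](bead_partn_beads pn szn); congr bead_partn; apply/fsetP=> z.
rewrite mem_beads in_slide.
have nn r : nth 0 [seq p <- mkseq new (size la) | 0 < p] r = new r.
  rewrite nth_filter_pos //; have [ltr|ger] := ltnP r (size la).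
    by rewrite nth_mkseq.
  rewrite nth_default ?size_mkseq // newE !ifN ?nth_default //; lia.
have newb r : new r + (m - r.+1) =
    if i <= r < bot then bead r.+1 else if r == bot then gap j else bead r.
  rewrite newE /bead /gap; case: ifP => h1.
    by have := colj r.+1; move: h1; rewrite /bot; lia.
  by case: ifP => // /eqP ->; rewrite /bot; lia.
apply/mapP/idP => [[r]|].
  rewrite mem_iota add0n nn => ltr ->; rewrite newb.
  case: ifP => h1.
    rewrite mem_bead ?andbT; last by lia.
    by have := @bead_gtn i r.+1; lia.
  case: ifP => [_|h2]; first by rewrite eqxx.
  rewrite mem_bead // andbT; apply/orP; right.
  have [h|h|h] := ltngtP r i; last by lia.
    by have := bead_gtn h; lia.
  by have := bead_gtn h; lia.
case/predU1P=> [->|/andP[ne /beadP[r ltr e]]].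
  exists bot; first by rewrite mem_iota; lia.
  by rewrite nn newb ltnn andbF eqxx.
have nri : r != i by apply: contra ne => /eqP <-; apply/eqP.
have [h|h] := boolP (i < r <= bot).
  exists r.-1; first by rewrite mem_iota; lia.
  rewrite nn newb ifT; last by lia.
  by rewrite e prednK //; lia.
exists r; first by rewrite mem_iota.
rewrite nn newb !ifN //; lia.
Qed.

(** A general [F] keeps multiplicities; indicator functions turn this into statements on membership
    and on numbers of hooks. *)
Lemma sum_hook_removals q (F : seq nat -> nat) : 0 < q ->
  \sum_(nu <- hook_removals q la) F nu =
  \sum_(x <- X | is_bead_hook X q x) F (bead_partn (slide X x (x - q))).
Proof.
move=> q0; rewrite /hook_removals big_map big_filter /boxes big_mkcond
  big_allpairs_dep /=.
have pX : perm_eq X [seq bead i | i <- iota 0 m].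
  apply: uniq_perm; rewrite ?fset_uniq //.
    by have := sorted_beta_set m sla; rewrite gtn_sorted_uniq_geq => /andP[].
  by move=> x; rewrite mem_beads.
rewrite (perm_big _ pX) /= big_map [RHS]big_mkcond /=.
rewrite -[m in RHS](subnKC sz) iotaD big_cat /= add0n.
(* A zero row carries no hook, since every position below its bead is occupied. *)
rewrite [X in _ = _ + X]big1_seq ?addn0 => [|i]; last first.
  rewrite mem_iota /= => lti; case: ifP => // /andP[leq /negP[]].
  have e r : size la <= r -> bead r = m - r.+1.
    by move=> ger; rewrite /bead nth_default.
  have -> : bead i - q = bead (i + q) by rewrite !e; lia.
  by apply: mem_bead; move: leq; rewrite e; lia.
rewrite big_seq [RHS]big_seq; apply: eq_bigr => i;
  rewrite mem_iota add0n => lti.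
have ltm : i < m := leq_trans lti sz.
case: ifP => [/andP[leq nX]|nh].
  have [j ltj ej] : exists2 j, j < nth 0 la i & bead i - q = gap j.
    by apply: gap_complete => //; lia.
  have [hj gj] := hook_length_bead ltj.
  rewrite (bigD1_seq j) ?iota_uniq ?mem_iota //= hj -ej subKn // eqxx.
  rewrite remove_hook_bead // -ej big1_seq ?addn0 // => j' /andP[ne].
  rewrite mem_iota add0n => ltj'; case: ifP => // /eqP.
  have [-> gj'] := hook_length_bead ltj' => e.
  have egap : gap j' = gap j by rewrite -ej; lia.
  have mono a b : a < b -> gap a < gap b.
    move=> ltab; rewrite /gap.
    have : col_len la b <= col_len la a by apply: sub_count => x /=; lia.
    by have := col_len_le a; lia.
  by case/eqP: ne; have := mono j j'; have := mono j' j; lia.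
rewrite big1_seq // => j; rewrite mem_iota add0n => ltj.
case: ifP => // /eqP; have [-> gj] := hook_length_bead ltj => e.
move/negP: nh; case; apply/andP; split; first by lia.
by have -> : bead i - q = gap j; [lia | apply: gap_notin].
Qed.

End HookRemovals.

(** * Oddness and the 2-quotient *)

(** Runner [b] of the 2-abacus; for an even number of beads it is a beta-set of component [b] of the
    2-quotient, see [quotient2_half]. *)
Definition half (b : bool) (X : {fset nat}) : {fset nat} :=
  [fset x./2 | x in X & odd x == b]%fset.

Lemma in_half b X y : (y \in half b X) = (b + y.*2 \in X).
Proof.
apply/imfsetP/idP => /= [[x]|yX].
  by rewrite inE => /andP[xX /eqP <-] ->; rewrite odd_double_half.
exists (b + y.*2); last by rewrite half_bit_double.
by rewrite inE yX oddD odd_double addbF oddb eqxx.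
Qed.

Lemma bit_double_inj b : injective (fun y => nat_of_bool b + y.*2).
Proof. by move=> y z /addnI /double_inj. Qed.

Lemma sum_half (X : {fset nat}) (F : nat -> nat) :
  \sum_(x <- X) F x = \sum_(y <- half false X) F y.*2 + \sum_(y <- half true X)
    F y.*2.+1.
Proof.
have pX : perm_eq X ([seq y.*2 | y <- half false X] ++ [seq y.*2.+1 | y <- half
  true X]).
  apply: uniq_perm; rewrite ?fset_uniq //.
    rewrite cat_uniq !map_inj_uniq ?fset_uniq ?andbT //=.
    - apply/hasPn=> x /mapP[y _ ->]; apply/mapP=> -[z _ /(congr1 odd)].
      by rewrite /= !odd_double.
    - by move=> y z [] /double_inj.
    - exact: double_inj.
  move=> x; rewrite mem_cat; apply/idP/orP=> [xX|].
    have e := odd_double_half x; case o: (odd x) e => e; [right|left];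
      apply/mapP; exists x./2; rewrite ?in_half ?e //.
  by case=> /mapP[y]; rewrite in_half => ? ->.
by rewrite (perm_big _ pX) /= big_cat !big_map.
Qed.

Lemma half_slide b X y z :
  half b (slide X (b + y.*2) (b + z.*2)) = slide (half b X) y z.
Proof.
apply/fsetP=> t; rewrite in_half !in_slide in_half.
by rewrite !(inj_eq (@bit_double_inj b)).
Qed.

Lemma halfN_slide b X y z : half (~~ b) (slide X (b + y.*2) (b + z.*2)) =
  half (~~ b) X.
Proof.
apply/fsetP=> t; rewrite !in_half in_slide.
have ne s : (~~ b + t.*2 == b + s.*2) = false by case: b; lia.
by rewrite !ne.
Qed.

Lemma is_bead_hook_half (b : bool) X q y :
  is_bead_hook X q.*2 (b + y.*2) = is_bead_hook (half b X) q y.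
Proof.
rewrite /is_bead_hook in_half (_ : (q.*2 <= _) = (q <= y)); last by case: b;
  lia.
by case: leqP => //= le; rewrite (_ : b + y.*2 - q.*2 = b + (y - q).*2) //; lia.
Qed.

Lemma bead_hook_weight X q x : x \in X -> is_bead_hook X q x -> q <= weight X.
Proof. by move=> xX /andP[le nX]; have := weight_slide xX nX; lia. Qed.

Lemma weight_slide_hook X q x : x \in X -> is_bead_hook X q x ->
  weight (slide X x (x - q)) = weight X - q.
Proof. by move=> xX /andP[le nX]; have := weight_slide xX nX; lia. Qed.

(** The witness is the bead of the last row, whose lower neighbour is empty. *)
Lemma weight_gt0_hook X : 0 < weight X -> exists2 x,
  x \in X & is_bead_hook X 1 x.
Proof.
move=> gt0; pose m := #|` X|; pose la := bead_partn X.
have pla : is_partition la := is_partition_bead_partn X;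
  have /andP[sla zla] := pla.
have sz : size la <= m := size_bead_partn X.
have s0 : 0 < size la by move: gt0; rewrite /weight -/la; case: (la).
have lap : 0 < nth 0 la (size la).-1.
  by rewrite lt0n; apply: contra zla => /eqP <-; apply: mem_nth;
    rewrite ltn_predL.
have eX : X = beads m la by rewrite beadsK.
have ltsm : (size la).-1 < m by apply: leq_trans sz; rewrite ltn_predL.
pose x := nth 0 la (size la).-1 + (m - (size la).-1.+1).
exists x.
  by rewrite eX; apply: (@mem_bead m la).
rewrite /is_bead_hook; apply/andP; split; first by rewrite /x; lia.
rewrite eX; apply/negP=> /(@beadP m la)[r ltr].
have [ger|ltr'] := leqP (size la) r; first by rewrite (nth_default _ ger); lia.
have : nth 0 la (size la).-1 <= nth 0 la r by apply: nth_sorted_geq => //; lia.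
by move: ltr' lap; lia.
Qed.

(* By Kummer's theorem: [a] and [b] have disjoint binary expansions. *)
Definition binodd a b := odd 'C(a + b, a).

Lemma binoddS a b : binodd a.+1 b.+1 = binodd a.+1 b (+) binodd a b.+1.
Proof. by rewrite /binodd addSn binS oddD addnS addSn. Qed.

Lemma binoddC a b : binodd a b = binodd b a.
Proof. by rewrite /binodd -[in RHS]bin_sub ?leq_addr // addKn addnC. Qed.

Lemma binodd0 b : binodd 0 b. Proof. by rewrite /binodd bin0. Qed.
Lemma binodda0 a : binodd a 0. Proof. by rewrite /binodd addn0 binn. Qed.

Lemma binodd_rec a b : 0 < a + b ->
  binodd a b = ((0 < a) && binodd a.-1 b) (+) ((0 < b) && binodd b.-1 a).
Proof.
case: a => [|a]; case: b => [|b] // _; rewrite ?binodd0 ?binodda0 //=.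
by rewrite binoddS [binodd b _]binoddC addbC.
Qed.

Definition half_weight b X := weight (half b X).

(* The first conjunct says that the 2-core has size at most 1. *)
Definition odd_halves (X : {fset nat}) : bool :=
  [&& weight X <= (half_weight false X + half_weight true X).*2.+1,
      binodd (half_weight false X) (half_weight true X),
        odd_beads (half false X) & odd_beads (half true X)].

Lemma sum_hooks_half (X : {fset nat}) q (F : nat -> nat) :
  \sum_(x <- X | is_bead_hook X q.*2 x) F x =
  \sum_(y <- half false X | is_bead_hook (half false X) q y) F y.*2 +
  \sum_(y <- half true X | is_bead_hook (half true X) q y) F y.*2.+1.
Proof.
rewrite big_mkcond sum_half -!big_mkcond /=.
by congr (_ + _); apply: eq_bigl => y; rewrite -is_bead_hook_half.
Qed.

(** Removing a box from a half removes a 2-hook from [X] and lowers both sides by 2. *)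
Lemma double_half_weight_le X :
  (half_weight false X + half_weight true X).*2 <= weight X.
Proof.
have [n] := ubnP (weight X); elim: n X => // n IH X ltn.
have [e0|[b gtb]] : (half_weight false X + half_weight true X = 0) \/ exists b,
  0 < half_weight b X.
- case: (posnP (half_weight false X)) => [e|]; last by right; exists false.
  case: (posnP (half_weight true X)) => [e'|]; last by right; exists true.
  by left; rewrite e e'.
- by rewrite e0.
have [y yX hy] := weight_gt0_hook gtb.
move: (hy); rewrite -is_bead_hook_half => hx; move: (yX); rewrite in_half => xX.
have e := weight_slide_hook xX hx; have ey := weight_slide_hook yX hy.
have le := bead_hook_weight xX hx; have ley := bead_hook_weight yX hy.
have ez : b + y.*2 - 1.*2 = b + (y - 1).*2 by case/andP: hy => ? _; lia.
rewrite ez in e.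
have e1 : half_weight b (slide X (b + y.*2) (b + (y - 1).*2)) =
  half_weight b X - 1.
  by rewrite /half_weight half_slide.
have e2 : half_weight (~~ b) (slide X (b + y.*2) (b + (y - 1).*2)) =
  half_weight (~~ b) X.
  by rewrite /half_weight halfN_slide.
have lt' : weight (slide X (b + y.*2) (b + (y - 1).*2)) < n by rewrite e; lia.
have := IH _ lt'; rewrite e.
by case: (b) e1 e2 gtb => /= -> -> ?; lia.
Qed.

Lemma odd_beads_weight1 X : weight X = 1 -> odd_beads X.
Proof.
move=> e; have pla := is_partition_bead_partn X.
have ela : bead_partn X = [:: 1].
  move: pla e; rewrite /is_partition /weight.
  case: (bead_partn X) => [|[|x] [|[|y] l]] //=; rewrite ?inE /= ?andbF //.
    by move=> _; rewrite addn0 => ->.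
  by move=> _; lia.
rewrite (@odd_beads_rec X 0) ?e //.
have := @sum_hook_removals _ _ pla (size_bead_partn X) 1 (fun nu =>
  odd_partn nu) isT.
rewrite beadsK /odd_beads expn0 => <-;
  rewrite ela /hook_removals /= big_cons big_nil.
have -> : remove_hook [:: 1] (0, 0) = [::] by [].
have := @odd_beads_weight0 fset0; rewrite /odd_beads /weight /bead_partn.
rewrite (_ : sort geq _ = [::]); last by apply: size0nil;
  rewrite size_sort cardfs0.
by move=> /(_ erefl) ->.
Qed.

(** The parity recursion is used with k = 1. A 2-hook of [X] is a removable box of one half, and its
    removal preserves the first conjunct of [odd_halves]. Inside that half the recursion with k = 0
    turns the sum over boxes into the parity of the half, and what remains is Pascal's rule
    [binodd_rec]. *)
Lemma odd_beadsE X : odd_beads X = odd_halves X.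
Proof.
have [n] := ubnP (weight X); elim: n X => // n IH X ltn.
have leH := double_half_weight_le X.
have [lt2|ge2] := ltnP (weight X) 2.
  have [h0 h1] : half_weight false X = 0 /\ half_weight true X = 0 by lia.
  have -> : odd_halves X = true.
    rewrite /odd_halves h0 h1 binodd0 (odd_beads_weight0 h0) (odd_beads_weight0
      h1) /= andbT; lia.
  case: (posnP (weight X)) => [|h]; first exact: odd_beads_weight0.
  by apply: odd_beads_weight1; lia.
pose K := weight X <= (half_weight false X + half_weight true X).*2.+1.
pose a b := half_weight b X.
have step b :
    odd (\sum_(y <- half b X | is_bead_hook (half b X) 1 y)
           odd_beads (slide X (b + y.*2) (b + y.*2 - 2))) =
    [&& K, 0 < a b, binodd (a b).-1 (a (~~ b)),
      odd_beads (half b X) & odd_beads (half (~~ b) X)].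
  case: (posnP (a b)) => [a0|apos] /=.
    rewrite andbF big1_seq // => y /andP[hy yX].
    by have := bead_hook_weight yX hy; rewrite -/(half_weight b X) -/(a b) a0.
  rewrite [odd_beads (half b X)](@odd_beads_rec _ 0) //.
  rewrite big_seq_cond [in RHS]big_seq_cond.
  rewrite (eq_bigr (fun y =>
    [&& K, binodd (a b).-1 (a (~~ b)) & odd_beads (half (~~ b) X)]
      * odd_beads (slide (half b X) y (y - 1)))).
    rewrite -big_distrr /= oddM oddb expn0; case: K => //=.
    by rewrite -andbA; congr (_ && _); rewrite andbC.
  move=> y /andP[yX hy]; rewrite mulnb; congr (nat_of_bool _).
  have hx : is_bead_hook X 1.*2 (b + y.*2) by rewrite is_bead_hook_half.
  have xX : b + y.*2 \in X by rewrite -in_half.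
  have ex := weight_slide_hook xX hx; have ey := weight_slide_hook yX hy.
  rewrite IH; last by rewrite ex; lia.
  have e2 : b + y.*2 - 2 = b + (y - 1).*2 by case/andP: hy => ? _; lia.
  rewrite /odd_halves e2 /K.
  have -> : weight (slide X (b + y.*2) (b + (y - 1).*2)) =
    weight X - 2 by rewrite -e2.
  move: ey apos; rewrite /a /half_weight => ey apos.
  have := half_slide b X y (y - 1); have := halfN_slide b X y (y - 1).
  case: (b) ey apos leH => /= ey apos leH -> ->; rewrite ey.
    rewrite (_ : (_ <= _) = (weight X <= (half_weight false X + half_weight
      true X).*2.+1)); last first.
      by rewrite /half_weight; lia.
    by rewrite /half_weight subn1 binoddC -!andbA; congr (_ && (_ && _));
      rewrite andbC.
  rewrite (_ : (_ <= _) = (weight X <= (half_weight false X + half_weight true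
    X).*2.+1)); last first.
    by rewrite /half_weight; lia.
  by rewrite /half_weight subn1 -!andbA; congr (_ && (_ && _)); rewrite andbC.
rewrite (@odd_beads_rec X 1) // expn1 (sum_hooks_half _ 1) oddD.
have := step false; have := step true.
under eq_bigr do rewrite add1n; move=> ->.
under eq_bigr do rewrite add0n; move=> ->.
have [hK|nK] := boolP K; last by rewrite /odd_halves -/K (negPf nK).
have apos : 0 < half_weight false X + half_weight true X.
  have hK' : weight X <= (half_weight false X + half_weight true X).*2.+1 := hK.
  rewrite lt0n; apply/eqP=> e; move: hK'; rewrite e => h.
  by have := leq_trans ge2 h.
rewrite /odd_halves -/K hK /= /a (binodd_rec apos).
set p := _ && binodd _ _; set q := _ && binodd _ _.
rewrite !andbA -/p -/q.
by case: p; case: q; case: (odd_beads _); case: (odd_beads _).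
Qed.

(** * Lucas's theorem modulo 2 and binary digits *)

Lemma odd_bin_double n m (e f : bool) :
  odd 'C(e + n.*2, f + m.*2) = odd 'C(n, m) && (f ==> e).
Proof.
elim: n m e f => [|n IH] m e f.
  by case: e; case: f; case: m => [|m] //=; rewrite ?addn0 ?bin0n //=; case: m.
have -> : e + n.+1.*2 = (e + n.*2).+2 by rewrite doubleS !addnS.
case: m => [|m].
  rewrite bin0 addn0; case: f; last by rewrite bin0.
  by rewrite bin1 /= negbK oddD odd_double addbF oddb.
have -> : f + m.+1.*2 = (f + m.*2).+2 by rewrite doubleS !addnS.
(* Pascal's rule is applied twice; the two middle terms cancel modulo 2. *)
rewrite !binS !oddD [odd 'C(n, m.+1) (+) _]addbC.
have := IH m e f; have := IH m.+1 e f.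
have -> : f + m.+1.*2 = (f + m.*2).+2 by rewrite doubleS !addnS.
move=> -> ->; case: (odd 'C(_, (f + m.*2).+1)); case: (odd 'C(n, m));
  case: (odd 'C(n, m.+1));
  by case: (f ==> e).
Qed.

Lemma odd_bin_half n m : odd 'C(n, m) = odd 'C(n./2, m./2) && (odd m ==> odd n).
Proof.
by rewrite -{1}(odd_double_half n) -{1}(odd_double_half m) odd_bin_double.
Qed.

Lemma half_add a b : ~~ (odd a && odd b) -> (a + b)./2 = a./2 + b./2.
Proof. by rewrite halfD => /negbTE ->. Qed.

Lemma binodd_half a b : binodd a b = binodd a./2 b./2 && ~~ (odd a && odd b).
Proof.
rewrite /binodd odd_bin_half oddD halfD; case oa: (odd a);
  case ob: (odd b) => //=;
  by rewrite ?andbF ?andbT ?add0n.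
Qed.

(** A binomial coefficient is odd when the binary digits of its lower entry are among those of the
    upper one, so this is transitivity of inclusion. *)
Lemma odd_bin_trans n m l : odd 'C(n, m) -> odd 'C(m, l) -> odd 'C(n, l).
Proof.
elim/ltn_ind: n m l => n IH m l h1 h2.
case: n IH h1 => [|n] IH h1; first by case: m h1 h2 => // ; case: l.
move: h1 h2; rewrite [odd 'C(_, m)]odd_bin_half => /andP[h1 o1].
rewrite [odd 'C(m, l)]odd_bin_half => /andP[h2 o2].
rewrite [odd 'C(_, l)]odd_bin_half.
apply/andP; split; last by case: (odd l) o2 o1 => //= ->.
by apply: IH h1 h2; rewrite ltn_half_double; lia.
Qed.

(* [lowz d x] says that the lowest zero bit of [x] is bit [d]. *)
Definition lowz d x := x %% 2 ^ d.+1 == 2 ^ d - 1.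

Lemma lowz0 x : lowz 0 x = ~~ odd x.
Proof. by rewrite /lowz expn1 expn0 modn2 eqb0. Qed.

Lemma lowzS d x : lowz d.+1 x = odd x && lowz d x./2.
Proof.
have p0 : 0 < 2 ^ d by rewrite expn_gt0.
rewrite /lowz; set M := 2 ^ d.+1; have eM : M = 2 * 2 ^ d by rewrite /M expnS.
have -> : x %% 2 ^ d.+2 = odd x + (x./2 %% M).*2.
  rewrite [2 ^ _]expnS -/M.
  have ltr : x./2 %% M < M by rewrite ltn_mod eM; lia.
  have {1}-> : x = (x./2 %/ M) * (2 * M) + (odd x + (x./2 %% M).*2).
    by have := odd_double_half x; have := divn_eq x./2 M; lia.
  rewrite modnMDl modn_small //; lia.
rewrite eM; case: (odd x) => /=; apply/eqP/eqP; lia.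
Qed.

Lemma lowz_logn d x : lowz d x = (logn 2 x.+1 == d).
Proof.
elim: d x => [|d IH] x.
  rewrite lowz0; case: (boolP (odd x)) => ox /=.
    by rewrite lognE /= /dvdn modn2 /= ox.
  by rewrite lognE /= /dvdn modn2 /= ox.
rewrite lowzS IH; case: (boolP (odd x)) => ox /=.
  have -> : x.+1 = 2 * x./2.+1 by have := odd_double_half x; rewrite ox; lia.
  by rewrite lognM // logn_prime //= add1n eqSS.
by rewrite lognE /= /dvdn modn2 /= ox.
Qed.

(** Adding 1 to [a] clears its trailing ones and sets its lowest zero bit. Below [d] every bit
    belongs to [a] or [b], and bit [d] is free: if the lowest zero bit of [a] lies below [d], it is
    a digit of [b] and the two collide. *)
Lemma binodd_addP d a b : binodd a b -> lowz d (a + b) ->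
  binodd a.+1 b = lowz d a.
Proof.
elim: d a b => [|d IH] a b; rewrite binodd_half => /andP[h no].
  rewrite !lowz0 oddD binodd_half => oab.
  case: (boolP (odd a)) oab no => oa; case: (boolP (odd b)) => ob //= _ _.
  by rewrite uphalf_half (negPf oa) h.
rewrite !lowzS oddD (half_add no) => /andP[oab hl].
rewrite binodd_half /= uphalf_half.
case: (boolP (odd a)) oab no => oa; case: (boolP (odd b)) => ob //= _ _.
  by rewrite andbT; apply: IH.
by rewrite andbF.
Qed.

Lemma divn_2expS x k : x %/ 2 ^ k.+1 = x./2 %/ 2 ^ k.
Proof. by rewrite expnS divnMA divn2. Qed.

Lemma binodd_divn a b k : binodd a b ->
  (a + b) %/ 2 ^ k = a %/ 2 ^ k + b %/ 2 ^ k /\ binodd (a %/ 2 ^ k) (b %/ 2 ^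
    k).
Proof.
elim: k a b => [|k IH] a b; first by rewrite expn0 !divn1.
rewrite binodd_half => /andP[h no].
by rewrite !divn_2expS (half_add no); apply: IH.
Qed.

Lemma half_add2exp a k : (a + 2 ^ k.+1)./2 = a./2 + 2 ^ k.
Proof. by rewrite half_add expnS mul2n ?doubleK // odd_double andbF. Qed.

Lemma odd_add2exp a k : odd (a + 2 ^ k.+1) = odd a.
Proof. by rewrite oddD oddX addbF. Qed.

Lemma binodd_add2exp d k a b : binodd a b -> lowz d ((a + b) %/ 2 ^ k) ->
  binodd (a + 2 ^ k) b = lowz d (a %/ 2 ^ k).
Proof.
elim: k a b => [|k IH] a b.
  by rewrite expn0 !divn1 addn1; apply: binodd_addP.
rewrite binodd_half => /andP[h no]; rewrite !divn_2expS (half_add no) => hl.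
by rewrite binodd_half half_add2exp odd_add2exp no andbT; apply: IH.
Qed.

(** Pascal's rule with step 2^k, reflecting (1 + x)^(2^k) = 1 + x^(2^k) modulo 2; halving both
    arguments leads back to step 1. *)
Lemma binodd_sub2exp k a b : 2 ^ k <= a + b ->
  binodd a b = ((2 ^ k <= a) && binodd (a - 2 ^ k) b) (+)
               ((2 ^ k <= b) && binodd (b - 2 ^ k) a).
Proof.
elim: k a b => [|k IH] a b le.
  by rewrite expn0 !subn1; apply: binodd_rec; rewrite expn0 in le.
have geE x : (2 ^ k.+1 <= x) = (2 ^ k <= x./2).
  by rewrite expnS; have := odd_double_half x; case: (odd x); lia.
have subE x : 2 ^ k.+1 <= x ->
  (x - 2 ^ k.+1)./2 = x./2 - 2 ^ k /\ odd (x - 2 ^ k.+1) = odd x.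
  move=> lex; split; last by rewrite oddB // oddX addbF.
  by rewrite -[in RHS](subnK lex) half_add2exp addnK.
have side x y : (2 ^ k.+1 <= x) && binodd (x - 2 ^ k.+1) y =
    [&& 2 ^ k <= x./2, binodd (x./2 - 2 ^ k) y./2 & ~~ (odd x && odd y)].
  case: (boolP (2 ^ k.+1 <= x)) => [lex|]; last by rewrite geE => /negPf ->.
  by rewrite -geE lex /= binodd_half; have [-> ->] := subE x lex.
rewrite !side binodd_half [odd b && odd a]andbC !andbA.
case: (boolP (odd a && odd b)) => no; first by rewrite !andbF.
rewrite !andbT IH // -(half_add no) -geE //.
Qed.

(** The digits of [v], [A] and [N] are nested: [A] inherits the ones below bit [d] from [v] and the
    zero at bit [d] from [N]. *)
Lemma lowz_between d v A N : odd 'C(A, v) -> odd 'C(N, A) ->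
  lowz d v -> lowz d N -> lowz d A.
Proof.
elim: d v A N => [|d IH] v A N.
  rewrite !lowz0 => _; rewrite odd_bin_half => /andP[_ h] _ oN.
  by apply: contra oN => oA; rewrite oA in h.
rewrite !lowzS odd_bin_half => /andP[h1 i1];
  rewrite odd_bin_half => /andP[h2 i2].
case/andP=> ov l1 /andP[_ l2]; rewrite ov /= in i1; rewrite i1 /=.
exact: IH h1 h2 l1 l2.
Qed.

(** * Removals and additions split over the two halves *)

Definition removals k (X : {fset nat}) : nat :=
  \sum_(x <- X | is_bead_hook X (2 ^ k) x) odd_beads (slide X x (x - 2 ^ k)).

Definition additions k (X : {fset nat}) : nat :=
  \sum_(x <- X | x + 2 ^ k \notin X) odd_beads (slide X x (x + 2 ^ k)).

Lemma odd_removals k X : 2 ^ k <= weight X -> odd (removals k X) = odd_beads X.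
Proof. by move=> le; rewrite (odd_beads_rec le). Qed.

Lemma odd_beads_half X : odd_beads X ->
  [/\ weight X <= (half_weight false X + half_weight true X).*2.+1,
      forall b, binodd (half_weight b X) (half_weight (~~ b) X) &
    forall b, odd_beads (half b X)].
Proof.
rewrite odd_beadsE => /and4P[h1 h2 h3 h4]; split=> // -[] //=.
by rewrite binoddC.
Qed.

(** A move inside one half changes the weight of [X] by twice the change in that half, so the
    condition on the 2-core carries over. *)
Lemma odd_beads_slide_half X (b : bool) y z : odd_beads X -> y \in half b X ->
  z \notin half b X ->
  odd_beads (slide X (b + y.*2) (b + z.*2)) =
  binodd (half_weight b X + z - y) (half_weight (~~ b) X)
    && odd_beads (slide (half b X) y z).
Proof.
move=> oX yX nzX; have [K _ oh] := odd_beads_half oX.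
have xX : b + y.*2 \in X by rewrite -in_half.
have nzX' : b + z.*2 \notin X by rewrite -in_half.
have e := weight_slide xX nzX'; have ey := weight_slide yX nzX.
have le := double_half_weight_le (slide X (b + y.*2) (b + z.*2)).
have e1 : half_weight b (slide X (b + y.*2) (b + z.*2)) =
  half_weight b X + z - y.
  by rewrite /half_weight half_slide; move: ey; rewrite -/(half_weight b X);
    lia.
have e2 : half_weight (~~ b) (slide X (b + y.*2) (b + z.*2)) =
  half_weight (~~ b) X.
  by rewrite /half_weight halfN_slide.
rewrite odd_beadsE /odd_halves.
have -> : weight (slide X (b + y.*2) (b + z.*2)) <=
    (half_weight false (slide X (b + y.*2) (b + z.*2)) + half_weight true
      (slide X (b + y.*2) (b + z.*2))).*2.+1.
  by move: ey; rewrite -/(half_weight b X);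
    case: (b) e1 e2 e le K => /= -> -> e le K; lia.
have := half_slide b X y z; have := halfN_slide b X y z.
case: (b) e1 e2 oh => /= -> -> oh -> ->.
  by rewrite (oh false) binoddC.
by rewrite (oh true) andbT.
Qed.

Lemma sum_double_half (X : {fset nat}) (P : pred nat) (F : nat -> nat) :
  \sum_(x <- X | P x) F x =
  \sum_(y <- half false X | P (false + y.*2)) F (false + y.*2) +
  \sum_(y <- half true X | P (true + y.*2)) F (true + y.*2).
Proof. by rewrite big_mkcond sum_half -!big_mkcond. Qed.

Lemma removalsS k X : odd_beads X ->
  removals k.+1 X = \sum_(b : bool) ((2 ^ k <= half_weight b X) &&
    binodd (half_weight b X - 2 ^ k) (half_weight (~~ b) X)) * removals k (half
      b X).
Proof.
move=> oX; rewrite /removals sum_double_half addnC big_bool.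
have step b : \sum_(y <- half b X | is_bead_hook X (2 ^ k.+1) (b + y.*2))
    odd_beads (slide X (b + y.*2) (b + y.*2 - 2 ^ k.+1)) =
  ((2 ^ k <= half_weight b X)
    && binodd (half_weight b X - 2 ^ k) (half_weight (~~ b) X)) *
  \sum_(y <- half b X | is_bead_hook (half b X) (2 ^ k) y)
     odd_beads (slide (half b X) y (y - 2 ^ k)).
  rewrite big_distrr /= big_seq_cond [RHS]big_seq_cond expnS mul2n.
  apply: eq_big => [y|y /andP[yX]]; first by rewrite is_bead_hook_half.
  rewrite is_bead_hook_half => hy; have le := bead_hook_weight yX hy.
  move: (hy) => /andP[ley nX].
  have -> : b + y.*2 - (2 ^ k).*2 = b + (y - 2 ^ k).*2 by lia.
  rewrite odd_beads_slide_half // /half_weight le mulnb.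
  by have -> : weight (half b X) + (y - 2 ^ k) - y =
    weight (half b X) - 2 ^ k by lia.
by congr (_ + _); apply: step.
Qed.

Lemma additionsS k X : odd_beads X ->
  additions k.+1 X = \sum_(b :
    bool) binodd (half_weight b X + 2 ^ k) (half_weight (~~ b) X) * additions k
      (half b X).
Proof.
move=> oX; rewrite /additions sum_double_half addnC big_bool.
have step b : \sum_(y <- half b X | b + y.*2 + 2 ^ k.+1 \notin X)
    odd_beads (slide X (b + y.*2) (b + y.*2 + 2 ^ k.+1)) =
  binodd (half_weight b X + 2 ^ k) (half_weight (~~ b) X) *
  \sum_(y <- half b X | y + 2 ^ k \notin half b X) odd_beads (slide (half b X)
    y (y + 2 ^ k)).
  have e y : b + y.*2 + 2 ^ k.+1 = b + (y + 2 ^ k).*2 by rewrite expnS; lia.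
  rewrite big_distrr /= big_seq_cond [RHS]big_seq_cond.
  apply: eq_big => [y|y]; first by rewrite e [y + _ \in _]in_half.
  rewrite e => /andP[yX]; rewrite -in_half => nX.
  rewrite odd_beads_slide_half // mulnb.
  by have -> : half_weight b X + (y + 2 ^ k) - y =
    half_weight b X + 2 ^ k by lia.
by congr (_ + _); apply: step.
Qed.

(** * Padding by zero parts, and the 2-quotient tower *)

Definition shift (X : {fset nat}) :
  {fset nat} := (0 |` [fset x.+1 | x in X])%fset.

Lemma in_shiftS X x : (x.+1 \in shift X) = (x \in X).
Proof.
rewrite in_fset1U /=; apply/imfsetP/idP => [[y /= yX [e]]|xX];
  first by rewrite e.
by exists x.
Qed.

Lemma in_shift0 X : 0 \in shift X.
Proof. by rewrite !inE. Qed.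

Lemma shift_beads m la : size la <= m -> shift (beads m la) = beads m.+1 la.
Proof.
move=> sz; apply/fsetP=> -[|x].
  rewrite in_shift0; apply/esym; rewrite mem_beads; apply/mapP; exists m.
    by rewrite mem_iota add0n ltnSn.
  by rewrite nth_default // subnn.
rewrite in_shiftS !mem_beads; apply/mapP/mapP => -[i];
  rewrite mem_iota add0n => lti e.
  by exists i; [rewrite mem_iota; lia | rewrite e subSS -addnS; lia].
have [e'|ne] := eqVneq i m; first by move: e; rewrite e' nth_default // subnn.
by exists i; [rewrite mem_iota; lia | lia].
Qed.

Lemma bead_partn_shift X : bead_partn (shift X) = bead_partn X.
Proof.
have sz := size_bead_partn X.
by rewrite -{1}(beadsK X) shift_beads // bead_partn_beads
  ?is_partition_bead_partn // ltnW.
Qed.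

Lemma card_shift X : #|` shift X| = #|` X|.+1.
Proof.
rewrite -{1}(beadsK X) shift_beads ?size_bead_partn // card_beads //.
by case/andP: (is_partition_bead_partn X).
Qed.

Lemma slide_shift X x y : slide (shift X) x.+1 y.+1 = shift (slide X x y).
Proof.
by apply/fsetP=> -[|z]; rewrite in_slide ?in_shiftS ?in_shift0 ?in_slide
  ?in_shiftS //.
Qed.

(** The new bead at 0 must contribute nothing: its target 2^k is occupied because 2^k - 1 is in
    [X]. *)
Lemma additions_shift k X :
    (forall y, y < 2 ^ k -> y \in X) -> additions k (shift X) = additions k X.
Proof.
move=> hX; have pX : perm_eq (shift X) (0 :: [seq x.+1 | x <- X]).
  apply: uniq_perm; rewrite ?fset_uniq //=.
    rewrite map_inj_uniq ?fset_uniq ?andbT; last by move=> x y [].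
    by apply/mapP=> -[].
  move=> [|x]; first by rewrite in_shift0 inE eqxx.
  by rewrite in_shiftS inE (mem_map succn_inj).
have q0 : 0 < 2 ^ k by rewrite expn_gt0.
rewrite /additions (perm_big _ pX) big_cons add0n /=.
rewrite -(prednK q0) in_shiftS hX ?prednK //= big_map.
apply: eq_big => [x|x _]; first by rewrite addSn in_shiftS.
by rewrite addSn slide_shift /odd_beads bead_partn_shift.
Qed.

(** Two new beads fall one on each runner, so the quotient depends only on the parity of the number
    of beads. *)
Lemma half_shift2 b X : half b (shift (shift X)) = shift (half b X).
Proof.
apply/fsetP=> -[|y]; first by rewrite in_half in_shift0; case: b;
  rewrite ?in_shiftS in_shift0.
by rewrite in_half doubleS !addnS !in_shiftS in_half.
Qed.

Lemma bead_partn_half_seq (xs : seq nat) (X : {fset nat}) (b : bool) :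
  sort geq X = xs ->
  bead_partn (half b X) = partn_of_beta [seq x./2 | x <- xs & odd x == b].
Proof.
move=> e; rewrite /bead_partn; congr partn_of_beta.
have sx : sorted gtn xs by rewrite -e sorted_sort_fset.
have gtn_trans : transitive gtn by move=> x y z /= h1 h2;
  apply: ltn_trans h2 h1.
have sy : sorted gtn [seq x./2 | x <- xs & odd x == b].
  rewrite sorted_map; have := sorted_filter gtn_trans (fun x => odd x == b) sx.
  move=> sf; have all_b : all (fun x =>
    odd x == b) [seq x <- xs | odd x == b] by apply: filter_all.
  elim: [seq x <- xs | odd x == b] sf all_b => // x [|y l] IH //=.
  case/andP=> ltyx sl /and3P[/eqP ox /eqP oy al].
  apply/andP; split; last by apply: IH => //=; rewrite oy eqxx al.
  by have := odd_double_half x; have := odd_double_half y; rewrite ox oy; lia.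
apply: (sorted_eq (leT := gtn)) => //.
- by move=> a c /=; lia.
- exact: sorted_sort_fset.
rewrite perm_sort; apply: uniq_perm; rewrite ?fset_uniq //.
  by move: sy; rewrite gtn_sorted_uniq_geq => /andP[].
move=> y; rewrite in_half; apply/idP/mapP => [yX|[x]].
  exists (b + y.*2); last by rewrite half_bit_double.
  by rewrite mem_filter oddD odd_double addbF oddb eqxx -e mem_sort.
rewrite mem_filter -e mem_sort => /andP[/eqP <- xX] ->.
by rewrite odd_double_half.
Qed.

(** [quotient2] takes the least even number of beads; any other even number is reached by double
    shifts. *)
Lemma quotient2_half X b : ~~ odd #|` X| ->
  quotient2 (bead_partn X) b = bead_partn (half b X).
Proof.
move=> ev; have sz := size_bead_partn X; have pX := is_partition_bead_partn X.
have sla : sorted geq (bead_partn X) by case/andP: pX.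
set m0 := size (bead_partn X) + odd (size (bead_partn X)).
have ev0 : ~~ odd m0 by rewrite /m0 oddD oddb addbb.
have le0 : m0 <= #|` X|.
  rewrite /m0; case o: (odd _); rewrite ?addn1 ?addn0 //.
  by rewrite ltn_neqAle sz andbT; apply: contra ev => /eqP <-.
have -> : quotient2 (bead_partn X) b =
  bead_partn (half b (beads m0 (bead_partn X))).
  by rewrite (@bead_partn_half_seq (beta_set m0 (bead_partn X))) // sort_beads.
have [t et] : exists t, #|` X| = m0 + t.*2.
  exists (#|` X| - m0)./2; rewrite -[LHS](subnKC le0); congr (_ + _).
  by rewrite -[LHS]odd_double_half oddB // (negPf ev) (negPf ev0).
rewrite -[in RHS](beadsK X) et; elim: (t) => [|s ->]; first by rewrite addn0.
have lem : size (bead_partn X) <= m0 + s.*2 by rewrite /m0; lia.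
rewrite doubleS !addnS -shift_beads; last exact: leqW.
by rewrite -shift_beads // half_shift2 bead_partn_shift.
Qed.

(** [quotient_row] grows at the bottom of the tower, whereas the inductions below start at the top,
    with the two components of [la]. *)
Lemma quotient_rowS k la : quotient_row k.+1 la =
  quotient_row k (quotient2 la false) ++ quotient_row k (quotient2 la true).
Proof.
elim: k la => [|k IH] la; first by [].
have rowE j l : quotient_row j.+1 l =
  flatten [seq [:: quotient2 nu false;
    quotient2 nu true] | nu <- quotient_row j l] by [].
by rewrite rowE IH map_cat flatten_cat -!rowE.
Qed.

Lemma size_quotient_row k la : size (quotient_row k la) = 2 ^ k.
Proof.
elim: k la => [|k IH] la //.
by rewrite quotient_rowS size_cat !IH expnS mul2n addnn.
Qed.

(** * Removing the largest 2-power hook *)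

Lemma no_hook_small (Y : {fset nat}) q z : weight Y < q -> z \in Y -> q <= z ->
  z - q \in Y.
Proof.
move=> lt zY le; apply/negPn/negP=> nz.
by have := @bead_hook_weight Y q z zY; rewrite /is_bead_hook le nz => /(_ isT);
  lia.
Qed.

Lemma weight_top_hook r X : odd_beads X -> 2 ^ r <= weight X ->
  exists2 x, x \in X & is_bead_hook X (2 ^ r) x.
Proof.
move=> oX le; have := odd_removals le; rewrite oX /removals big_seq_cond.
case: (boolP (has (fun x => is_bead_hook X (2 ^ r) x) X)) =>
  [/hasP[x xX hx] _|/hasPn nh].
  by exists x.
by rewrite big1 // => x /andP[xX hx]; have := nh x xX; rewrite /= hx.
Qed.

(** The 2^r-hook is unique: once it is removed the weight is below 2^r, so no other bead can still
    drop by 2^r. *)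
Lemma odd_beads_top r X x : 2 ^ r <= weight X -> weight X < (2 ^ r).*2 ->
  x \in X -> is_bead_hook X (2 ^ r) x ->
  odd_beads X = odd_beads (slide X x (x - 2 ^ r)).
Proof.
move=> le lt xX hx; rewrite -(odd_removals le) /removals big_mkcond.
move: (hx) => /andP[lex nX].
rewrite (big_fsetD1 x) //= hx /=.
rewrite big1_seq ?addn0 ?oddb // => z /= ; rewrite !inE => /andP[nzx zX].
case: ifP => // hz; move: (hz) => /andP[lez nz].
have zX' : z \in slide X x (x - 2 ^ r) by rewrite in_slide nzx zX orbT.
have := no_hook_small _ zX' lez;
  rewrite (weight_slide_hook xX hx) => /(_ ltac:(lia)).
rewrite in_slide (negPf nz) andbF orbF => /eqP e.
by case/eqP: nzx; lia.
Qed.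

Lemma odd_beads_no_top r X : 2 ^ r <= weight X ->
  (forall z, z \in X -> ~~ is_bead_hook X (2 ^ r) z) -> odd_beads X = false.
Proof.
move=> le nh; case oX: (odd_beads X) => //.
have [z zX hz] := weight_top_hook oX le.
by have := nh z zX; rewrite hz.
Qed.

(** * The top hook before and after the move of one bead *)

Section TopMove.

Variables (r : nat) (X : {fset nat}) (x : nat).
Let Q := 2 ^ r.
Hypotheses (leX : Q <= weight X) (ltX : weight X < Q.*2).
Hypotheses (xX : x \in X) (hx : is_bead_hook X Q x).

Let X' := slide X x (x - Q).
Let lex : Q <= x. Proof. by case/andP: hx. Qed.
Let nX : x - Q \notin X. Proof. by case/andP: hx. Qed.
Let Q0 : 0 < Q. Proof. by rewrite expn_gt0. Qed.

Variables (u v : nat).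
Hypotheses (uX : u \in X) (vX : v \notin X) (uv : u != v %[mod Q]).
Let M := slide X u v.
Hypotheses (leM : Q <= weight M) (ltM : weight M < Q.*2).

Let closed z : z \in X' -> Q <= z -> z - Q \in X'.
Proof. by apply: no_hook_small; rewrite (weight_slide_hook xX hx); lia. Qed.

Lemma modQ_sub z : Q <= z -> z - Q = z %[mod Q].
Proof. by move=> le; rewrite -[in RHS](subnK le) modnDr. Qed.

(** The move avoids both ends of the top hook, so the same hook is stripped from [M]. *)
Lemma top_slide_generic : u != x -> v != x - Q ->
  odd_beads M = odd_beads (slide X' u v).
Proof.
move=> nux nvx; have xM : x \in M by rewrite in_slide [x == u]eq_sym nux xX
  orbT.
have nM : x - Q \notin M.
  by rewrite in_slide [_ == v]eq_sym (negPf nvx) (negPf nX) andbF.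
rewrite (odd_beads_top leM ltM xM); last by rewrite /is_bead_hook lex.
congr odd_beads; apply/fsetP=> z; rewrite !in_slide.
case: (eqVneq z (x - Q)) => [->|nz] /=.
  rewrite (_ : (x - Q != u)) ?orbT //; apply: contra nX => /eqP ->; exact: uX.
case: (eqVneq z v) => [->|nzv] //=; last by rewrite andbCA.
by rewrite (_ : v != x) //; apply: contra vX => /eqP ->.
Qed.

(** The bead of the hook itself moves. The top hook of [M] can then only drop [v] to [v - Q]; if
    that position is taken, [M] has no top hook and is not odd. *)
Lemma top_slide_from : u = x -> Q <= v ->
  odd_beads M = (v - Q \notin X') && odd_beads (slide X' (x - Q) (v - Q)).
Proof.
move=> ux lev; have nvQ : v - Q != x - Q.
  by apply: contra uv => /eqP e; rewrite ux; apply/eqP; congr (_ %% _); lia.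
have inX' z : z != x -> z != x - Q -> (z \in X') = (z \in X).
  by move=> n1 n2; rewrite in_slide (negPf n1) (negPf n2).
have nvQx : v - Q != x.
  by apply: contra uv => /eqP e; rewrite ux -e modQ_sub.
have nvx : v != x by apply: contra vX => /eqP ->.
case: (boolP (v - Q \in X')) => [vX'|nvX'] /=.
  apply: (odd_beads_no_top leM) => z zM; apply/negP=> /andP[lez].
  rewrite in_slide negb_or -/Q => /andP[nzv nz].
  move: zM; rewrite in_slide => /predU1P[ez|/andP[nzu zX]].
    case/negP: nz; rewrite ez; rewrite inX' // in vX'; rewrite vX' andbT ux //.
  have zX' : z \in X'.
    rewrite inX' ?zX //; first by rewrite -ux.
    by apply: contra nX => /eqP <-.
  have := closed zX' lez; rewrite in_slide => /predU1P[e|/andP[n1 n2]];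
    last first.
    by case/negP: nz; rewrite n2 andbT ux.
  by case/eqP: nzu; rewrite ux -(subnK lex) -e subnK.
have vM : v \in M by rewrite in_slide eqxx.
have nM : v - Q \notin M.
  rewrite in_slide -(inX' _ nvQx nvQ) (negPf nvX') andbF orbF.
  by have := Q0; lia.
rewrite (odd_beads_top leM ltM vM); last by rewrite /is_bead_hook lev.
congr odd_beads; apply/fsetP=> z; rewrite !in_slide ux.
case: (eqVneq z (v - Q)) => //= nz.
case: (eqVneq z v) => [->|nzv] /=.
  by rewrite (negPf vX) !andbF orbF; apply/esym/negbTE; rewrite negb_and negbK;
    case: eqP.
case: (eqVneq z (x - Q)) => [->|nzx] //=.
by rewrite (negPf nX) andbF.
Qed.

(** The bead [u] fills the position into which [x] would drop, so the top hook of [M] can only drop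
    [u + Q] into the place left by [u]. *)
Lemma top_slide_to : u != x -> v = x - Q ->
  odd_beads M = (u + Q \in X') && odd_beads (slide X' (u + Q) x).
Proof.
move=> nux vx; have nuQx : u + Q != x.
  apply: contra uv => /eqP e; rewrite vx; apply/eqP; rewrite modQ_sub // -e.
  by rewrite modnDr.
have nuxQ : u != x - Q by apply: contra nX => /eqP <-.
have nuQxQ : u + Q != x - Q.
  apply: contra uv => /eqP e; rewrite vx -e modnDr //.
have inX' z : z != x -> z != x - Q -> (z \in X') = (z \in X).
  by move=> n1 n2; rewrite in_slide (negPf n1) (negPf n2).
rewrite inX' //; case: (boolP (u + Q \in X)) => [uQX|nuQX] /=.
  have uM : u + Q \in M.
    by rewrite in_slide uQX andbT; apply/orP; right; have := Q0; lia.
  rewrite (odd_beads_top leM ltM uM); last first.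
    by rewrite /is_bead_hook leq_addl addnK in_slide vx (negPf nuxQ) eqxx.
  rewrite addnK; congr odd_beads; apply/fsetP=> z; rewrite !in_slide vx.
  case: (eqVneq z u) => [->|nzu] /=.
    by rewrite (negPf nux) (negPf nuxQ) uX /= andbT; have := Q0; lia.
  case: (eqVneq z x) => [->|nzx] /=.
    by rewrite xX orbT andbT eq_sym nuQx.
  by [].
apply: (odd_beads_no_top leM) => z zM; apply/negP=> /andP[lez].
rewrite in_slide negb_or -/Q vx => /andP[nzx nz].
have uQ : z - Q != u -> z - Q \notin X by move=> h; rewrite h in nz.
move: zM; rewrite in_slide vx => /predU1P[ez|/andP[nzu zX]].
  have zX' : z \in X' by rewrite ez in_slide eqxx.
  have nzu : z - Q != u.
    apply: contra uv => /eqP e; rewrite vx -ez -e modQ_sub //.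
  have := closed zX' lez; rewrite in_slide (negPf nzx) /= (negPf (uQ nzu))
    andbF.
  by [].
case: (eqVneq (z - Q) u) => [e|nzu'].
  by case/negP: nuQX; rewrite -e subnK.
case: (eqVneq z x) => [e|nzx']; first by case/eqP: nzx; rewrite e.
have zX' : z \in X' by rewrite in_slide nzx' zX orbT.
have := closed zX' lez; rewrite in_slide (negPf nzx) /= (negPf (uQ nzu')) andbF.
by [].
Qed.

End TopMove.

(** With [succn] or [predn] for [s], adding and removing a box are treated at once. *)
Definition moves (s : nat -> nat) (X : {fset nat}) : nat :=
  \sum_(u <- X | s u \notin X) odd_beads (slide X u (s u)).

Lemma fset_bound (X : {fset nat}) : exists N, forall z, z \in X -> z < N.
Proof.
exists (\sum_(z <- X) z).+1 => z zX; rewrite ltnS (big_fsetD1 z zX) /=.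
exact: leq_addr.
Qed.

Lemma moves_iota s X N : (forall z, z \in X -> z < N) ->
  moves s X = \sum_(u <- iota 0 N) [&& u \in X,
    s u \notin X & odd_beads (slide X u (s u))].
Proof.
move=> hN; have pX : perm_eq X [seq u <- iota 0 N | u \in X].
  apply: uniq_perm; rewrite ?fset_uniq ?filter_uniq ?iota_uniq // => z.
  rewrite mem_filter mem_iota add0n.
  by case zX: (z \in X) => //=; rewrite hN.
rewrite /moves (perm_big _ pX) big_filter_cond big_mkcond.
by apply: eq_bigr => u _; case: (u \in X); case: (s u \notin X).
Qed.

Lemma sum_iota_involution N (h : nat -> nat) (F : nat -> nat) :
  involutive h -> (forall u, u < N -> h u < N) ->
  \sum_(u <- iota 0 N) F (h u) = \sum_(u <- iota 0 N) F u.
Proof.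
move=> hK hN; rewrite -(big_map h xpredT F); apply: perm_big; apply: uniq_perm.
- by rewrite map_inj_uniq ?iota_uniq //; apply: inv_inj.
- exact: iota_uniq.
move=> z; rewrite -{1}(hK z) mem_map; last exact: inv_inj.
rewrite !mem_iota !add0n; apply/idP/idP => /hN //.
by rewrite hK.
Qed.

(* Moves of the two bead sets correspond under the involution that exchanges
   the positions [x] and [x - 2 ^ r], and their preimages under [s]. *)
Lemma moves_top r (X : {fset nat}) x (s : nat -> nat) p :
  2 ^ r <= weight X -> weight X < (2 ^ r).*2 ->
  x \in X -> is_bead_hook X (2 ^ r) x ->
  (forall u, u \in X -> s u \notin X ->
    2 ^ r + u <= weight X + s u < (2 ^ r).*2 + u) ->
  (forall u, u \in X -> s u \notin X -> u != s u %[mod 2 ^ r]) ->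
  s p = x - 2 ^ r -> s (p + 2 ^ r) = x -> s x = s (x - 2 ^ r) + 2 ^ r ->
  (forall u, s u = x - 2 ^ r -> u = p) ->
  (forall u, s u = x -> u = p + 2 ^ r) ->
  p != x %[mod 2 ^ r] -> s x != x ->
  moves s X = moves s (slide X x (x - 2 ^ r)).
Proof.
set Q := 2 ^ r => leX ltX xX hx Hs Hm sp spQ sx sI1 sI2 px sxx.
set X' := slide X x (x - Q); have Q0 : 0 < Q by rewrite expn_gt0.
move: (hx) => /andP[lex nX].
have ltX' : weight X' < Q by rewrite (weight_slide_hook xX hx); lia.
have closed z : z \in X' -> Q <= z -> z - Q \in X' by apply: no_hook_small.
have inX' z : z != x -> z != x - Q -> (z \in X') = (z \in X).
  by move=> n1 n2; rewrite in_slide (negPf n1) (negPf n2).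
have xX' : x \notin X' by rewrite in_slide eqxx orbF; lia.
have xQX' : x - Q \in X' by rewrite in_slide eqxx.
have np1 : p != x by apply: contra px => /eqP ->.
have np2 : p != x - Q.
  by apply: contra px => /eqP ->; apply/eqP; apply: modQ_sub.
have np3 : p + Q != x by apply: contra px => /eqP <-; rewrite modnDr.
have np4 : p + Q != x - Q.
  apply: contra px => /eqP e; apply/eqP.
  by rewrite -[LHS](modnDr p) e; apply: modQ_sub.
have nxQ : x - Q != x by lia.
have npQ : p + Q != p by lia.
have [N hN] : exists N, [/\ forall z, z \in X -> z < N,
    forall z, z \in X' -> z < N, x < N & p + Q < N].
  have [N1 h1] := fset_bound X; have [N2 h2] := fset_bound X'.
  by exists (N1 + N2 + x.+1 + (p + Q).+1); split=> [z /h1|z /h2||]; lia.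
case: hN => hN1 hN2 hNx hNp.
pose h u := if u == x then x - Q else if u == x - Q then x
  else if u == p then p + Q else if u == p + Q then p else u.
have hK : involutive h.
  move=> u; rewrite /h; case: (eqVneq u x) => [->|n1].
    by rewrite (negPf nxQ) eqxx.
  case: (eqVneq u (x - Q)) => [->|n2]; first by rewrite eqxx.
  case: (eqVneq u p) => [->|n3].
    by rewrite (negPf np3) (negPf np4) (negPf npQ) eqxx.
  case: (eqVneq u (p + Q)) => [->|n4].
    by rewrite (negPf np1) (negPf np2) eqxx.
  by rewrite (negPf n1) (negPf n2) (negPf n3) (negPf n4).
have hN u : u < N -> h u < N.
  by rewrite /h; do 4?case: ifP => _; lia.
rewrite (moves_iota _ hN1) (moves_iota _ hN2) -[RHS](sum_iota_involution _ hK
  hN).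
apply: eq_bigr => u _; congr nat_of_bool; rewrite /h.
have Mbounds w : w \in X -> s w \notin X ->
    Q <= weight (slide X w (s w)) /\ weight (slide X w (s w)) < Q.*2.
  by move=> wX sX; have := weight_slide wX sX; have := Hs w wX sX; lia.
case: (eqVneq u x) => [->|n1].
  rewrite xX xQX' /=; case: (boolP (s x \in X)) => sX /=.
    apply/esym/negbTE; rewrite negb_and negbK; apply/orP; left.
    rewrite -[s (x - Q)](addnK Q) -sx; apply: closed;
      last by rewrite sx leq_addl.
    by rewrite inX' //; apply: contra nX => /eqP <-.
  have [l1 l2] := Mbounds x xX sX.
  have := top_slide_from leX ltX xX hx xX sX (Hm x xX sX) l1 l2 erefl.
  rewrite -/Q -/X' sx leq_addl addnK => -> //.
case: (eqVneq u (x - Q)) => [->|n2].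
  by rewrite (negPf nX) (negPf xX').
case: (eqVneq u p) => [->|n3].
  rewrite sp spQ xX' nX /=; case: (boolP (p \in X)) => pX /=.
    have nspX : s p \notin X by rewrite sp.
    have [l1 l2] := Mbounds p pX nspX.
    by have := top_slide_to leX ltX xX hx pX nspX (Hm p pX nspX) l1 l2 np1 sp;
      rewrite sp.
  apply/esym/negbTE; rewrite negb_and; apply/orP; left.
  apply: contra pX => h1; have := closed _ h1 (leq_addl _ _).
  by rewrite addnK inX'.
case: (eqVneq u (p + Q)) => [->|n4].
  by rewrite spQ xX sp xQX' !andbF.
have n5 : s u != x - Q by apply: contra n3 => /eqP /sI1 ->.
have n6 : s u != x by apply: contra n4 => /eqP /sI2 ->.
rewrite (inX' u n1 n2) (inX' (s u) n6 n5).
case: (boolP (u \in X)) => uX //=; case: (boolP (s u \in X)) => suX //=.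
have [l1 l2] := Mbounds u uX suX.
exact: (top_slide_generic xX hx uX suX l1 l2 n1 n5).
Qed.

Lemma additions0_moves X : additions 0 X = moves succn X.
Proof.
by rewrite /additions /moves expn0; apply: eq_big => [u|u _]; rewrite addn1.
Qed.

Lemma removals0_moves X : removals 0 X = moves predn X.
Proof.
rewrite /removals /moves expn0 big_seq_cond [RHS]big_seq_cond.
apply: eq_big => [u|u _]; last by rewrite subn1.
rewrite /is_bead_hook subn1; case uX: (u \in X) => //=.
by case: u uX => [|u] //= ->.
Qed.

Lemma neq_mod1 Q u : 1 < Q -> u != u.+1 %[mod Q].
Proof.
move=> Q1; rewrite -addn1 -{1}[u]addn0 eqn_modDl mod0n modn_small //.
Qed.

(** The bound on the weight keeps every extension below 2^(r+1), so [X] and its extensions share the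
    same top power. *)
Lemma additions0_top r X x : 0 \in X -> 2 ^ r <= weight X ->
  (weight X).+1 < (2 ^ r).*2 ->
  x \in X -> is_bead_hook X (2 ^ r) x ->
    additions 0 X = additions 0 (slide X x (x - 2 ^ r)).
Proof.
move=> X0 le lt xX hx; move: (hx) => /andP[lex nX].
have Q1 : 1 < 2 ^ r by move: le lt; case: (2 ^ r) => [|[|q]] //; lia.
(* Position 0 is occupied, so the target of the hook has a predecessor, which serves as [p] in
   [moves_top]. *)
have xgt : 0 < x - 2 ^ r by rewrite lt0n; apply: contra nX => /eqP ->.
rewrite !additions0_moves; apply: (@moves_top r X x succn (x - 2 ^ r).-1) => //.
- exact: ltnW.
- by move=> u _ _; lia.
- by move=> u _ _; apply: neq_mod1.
- by rewrite prednK.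
- lia.
- lia.
- by move=> u <-.
- by move=> u; lia.
- rewrite -[X in _ != X %[mod _]](subnK lex) modnDr -{2}(prednK xgt).
  exact: neq_mod1.
- by lia.
Qed.

Lemma removals0_top r X x : 0 \in X -> 2 ^ r < weight X ->
  weight X < (2 ^ r).*2 ->
  x \in X -> is_bead_hook X (2 ^ r) x ->
    removals 0 X = removals 0 (slide X x (x - 2 ^ r)).
Proof.
move=> X0 le lt xX hx; move: (hx) => /andP[lex nX].
have Q1 : 1 < 2 ^ r by move: le lt; case: (2 ^ r) => [|[|q]] //; lia.
have xgt : 0 < x - 2 ^ r by rewrite lt0n; apply: contra nX => /eqP ->.
have pos u : u \in X -> u.-1 \notin X -> 0 < u.
  by case: u => // _; rewrite X0.
rewrite !removals0_moves; apply: (@moves_top r X x predn (x - 2 ^ r).+1) => //.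
- exact: ltnW.
- by move=> u uX sX; have := pos u uX sX; lia.
- move=> u uX sX; rewrite eq_sym -{2}(prednK (pos u uX sX)).
  exact: neq_mod1.
- lia.
- lia.
- by move=> u; lia.
- by move=> u; lia.
- rewrite -[X in _ != X %[mod _]](subnK lex) modnDr eq_sym.
  exact: neq_mod1.
- by lia.
Qed.

(** * Cores *)

Lemma modn_sub_self q z : q <= z -> z = z - q %[mod q].
Proof. by move=> le; rewrite -[in LHS](subnK le) modnDr. Qed.

(** The number of beads on runner [i] of the q-abacus, an invariant of hook removal. *)
Definition residues q i (X : {fset nat}) : nat := \sum_(x <- X) (x %% q == i).

Definition hookfree q (X : {fset nat}) :=
    forall z, z \in X -> q <= z -> z - q \in X.

Lemma residues_slide q i X x y : x \in X -> y \notin X -> x = y %[mod q] ->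
  residues q i (slide X x y) = residues q i X.
Proof.
move=> xX yX e; rewrite /residues /slide big_fsetU1 /=;
  last by rewrite !inE (negPf yX) andbF.
by rewrite [in RHS](big_fsetD1 x) //= e.
Qed.

Lemma antitone_sum (p : nat -> bool) N t : (forall s, p s.+1 -> p s) ->
  (forall s, p s -> s < N) -> p t = (t < \sum_(s < N) p s).
Proof.
move=> anti; elim: N p t anti => [|N IH] p t anti hN.
  by rewrite big_ord0; apply/negbTE/negP => /hN.
rewrite big_ord_recl /=; case p0: (p 0); last first.
  have none s : p s = false.
    by elim: s => [//|s IHs]; apply/negbTE/negP=> /anti; rewrite IHs.
  by rewrite none big1 // => i _; rewrite none.
case: t => [|t]; first by rewrite p0.
rewrite add1n ltnS; apply: (IH (fun s => p s.+1)) => s; first exact: anti.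
by move/hN.
Qed.

Lemma residuesE q i X N : i < q -> (forall z, z \in X -> z < N) ->
  residues q i X = \sum_(t < N) (t * q + i \in X).
Proof.
move=> ltiq hN; have q0 : 0 < q by lia.
have pX : perm_eq [seq x <- X | x %% q == i]
    [seq t * q + i | t <- iota 0 N & t * q + i \in X].
  apply: uniq_perm; rewrite ?filter_uniq ?fset_uniq //.
    rewrite map_inj_uniq ?filter_uniq ?iota_uniq // => a b /addIn /eqP.
    by rewrite eqn_pmul2r // => /eqP.
  move=> x; rewrite mem_filter; apply/andP/mapP => [[/eqP e xX]|[t]].
    exists (x %/ q); last by rewrite -e -divn_eq.
    rewrite mem_filter -e -divn_eq xX mem_iota add0n /=.
    by apply: leq_ltn_trans (leq_div _ _) (hN x xX).
  rewrite mem_filter => /andP[tX _] ->; split=> //.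
  by rewrite modnMDl modn_small.
rewrite /residues -(big_mkord xpredT (fun t => nat_of_bool (t * q + i \in X))).
transitivity (\sum_(x <- X | x %% q == i) 1); first by rewrite [RHS]big_mkcond;
  apply: eq_bigr => x _; case: eqP.
rewrite -big_filter (perm_big _ pX) big_map big_filter big_mkcond /index_iota
  subn0.
by apply: eq_bigr => t _; case: (_ \in X).
Qed.

Lemma hookfreeE q X x : 0 < q -> hookfree q X ->
  (x \in X) = (x %/ q < residues q (x %% q) X).
Proof.
move=> q0 hf; have [N hN] := fset_bound X.
rewrite (residuesE (ltn_pmod x q0) hN).
rewrite -(@antitone_sum (fun t => t * q + x %% q \in X)).
- by rewrite -divn_eq.
- move=> s h; have := hf _ h; rewrite mulSn => /(_ ltac:(lia)).
  by have -> : q + s * q + x %% q - q = s * q + x %% q by lia.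
move=> s /hN; apply: leq_ltn_trans.
by apply: leq_trans (leq_addr _ _); rewrite leq_pmulr.
Qed.

(* A hook-free bead set is pushed down on each runner of the abacus. *)
Lemma hookfree_unique q X Y : 0 < q -> hookfree q X -> hookfree q Y ->
  (forall i, residues q i X = residues q i Y) -> X = Y.
Proof.
move=> q0 hX hY e; apply/fsetP=> x.
by rewrite (hookfreeE _ q0 hX) (hookfreeE _ q0 hY) e.
Qed.

Lemma hook_removals_bead_partn q X nu : 0 < q ->
  nu \in hook_removals q (bead_partn X) ->
  exists2 x, x \in X & is_bead_hook X q x /\ nu =
    bead_partn (slide X x (x - q)).
Proof.
move=> q0 hnu.
have := sum_hook_removals (is_partition_bead_partn X) (size_bead_partn X) (fun
  mu => mu == nu) q0.
rewrite beadsK => e.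
case: (boolP (has (fun x =>
  is_bead_hook X q x && (nu == bead_partn (slide X x (x - q)))) X)).
  by case/hasP=> x xX /andP[hx /eqP ->]; exists x.
move/hasPn=> none; have : \sum_(mu <- hook_removals q (bead_partn X)) (mu ==
  nu) = 0.
  rewrite e big1_seq // => x /andP[hx xX]; have := none x xX.
  by rewrite /= hx /= eq_sym => /negPf ->.
by rewrite (big_rem nu) //= eqxx.
Qed.

Lemma hook_removals_nil q X : 0 < q -> hook_removals q (bead_partn X) = [::] ->
  hookfree q X.
Proof.
move=> q0 e z zX lez; apply/negPn/negP=> nz.
have := sum_hook_removals (is_partition_bead_partn X) (size_bead_partn X)
  (fun=> 1) q0.
by rewrite beadsK e big_nil big_mkcond (big_fsetD1 z) //= /is_bead_hook lez nz.
Qed.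

(** The iteration has either stopped at a hook-free set or lost at least one box per step, so
    [weight X] steps reach weight 0 at the latest. *)
Lemma core_bead_partn q X : 0 < q -> exists Y : {fset nat},
  [/\ core q (bead_partn X) = bead_partn Y, #|` Y| = #|` X|, hookfree q Y &
      forall i, residues q i Y = residues q i X].
Proof.
move=> q0; rewrite /core.
set step := fun nu : seq nat => head nu (hook_removals q nu).
have iterP j : exists Y : {fset nat},
  [/\ iter j step (bead_partn X) = bead_partn Y, #|` Y| = #|` X|,
      forall i, residues q i Y =
        residues q i X & hookfree q Y \/ weight Y + j <= weight X].
  elim: j => [|j [Y [e c ri hf]]]; first by exists X; split=> //; right;
    rewrite addn0.
  rewrite iterS e /step; case E: (hook_removals q (bead_partn Y)) => [|nu l] /=.
    by exists Y; split=> //; left; apply: hook_removals_nil.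
  have [|x xY [hx ->]] := @hook_removals_bead_partn q Y nu q0;
    first by rewrite E inE eqxx.
  move: (hx) => /andP[lex nY]; exists (slide Y x (x - q)); split=> //.
  - by rewrite card_slide.
  - by move=> i; rewrite residues_slide //; apply: modn_sub_self.
  case: hf => [hf|le]; first by case/negP: nY; apply: hf.
  by right; rewrite (weight_slide_hook xY hx); have := bead_hook_weight xY hx;
    lia.
have [Y [e c ri hf]] := iterP (weight X); exists Y; split=> //.
case: hf => // le; move=> z zY lez; apply: no_hook_small => //; lia.
Qed.

(** A move along a runner, in either direction, keeps the runner counts, and these determine the
    core. *)
Lemma core_slide q X x y : 0 < q -> x \in X -> y \notin X -> x = y %[mod q] ->
  core q (bead_partn (slide X x y)) = core q (bead_partn X).
Proof.
move=> q0 xX yX e.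
have [Y [-> cY hY rY]] := core_bead_partn X q0.
have [Z [-> cZ hZ rZ]] := core_bead_partn (slide X x y) q0.
congr bead_partn; apply: (hookfree_unique q0) => // i.
by rewrite rZ rY residues_slide.
Qed.

Lemma core_small q X : weight X < q -> core q (bead_partn X) = bead_partn X.
Proof.
move=> lt; have q0 : 0 < q by lia.
have [Y [-> cY hY rY]] := core_bead_partn X q0.
congr bead_partn; apply: (hookfree_unique q0) => // z zX.
exact: no_hook_small.
Qed.

(** * Adding and removing one box *)

Lemma sum_eq_mem (X : {fset nat}) x : \sum_(u <- X) (u == x) = (x \in X).
Proof.
transitivity (count_mem x X); last by rewrite count_uniq_mem ?fset_uniq.
by rewrite -sum1_count [RHS]big_mkcond; apply: eq_bigr => u _ /=;
  case: (u == x).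
Qed.

Lemma mem_beads_nil m x : (x \in beads m [::]) = (x < m).
Proof.
rewrite mem_beads; apply/mapP/idP => [[i]|lt].
  by rewrite mem_iota nth_nil => lti ->; lia.
by exists (m - x.+1); rewrite ?mem_iota ?nth_nil; lia.
Qed.

Lemma weight0_beads X : weight X = 0 -> X = beads #|` X| [::].
Proof.
move=> e; rewrite -{1}(beadsK X); congr beads.
have /andP[_] := is_partition_bead_partn X; move: e; rewrite /weight.
by case: (bead_partn X) => // -[] // n l; rewrite inE.
Qed.

Lemma hook_to_beads_nil q X x : x \in X -> is_bead_hook X q x -> weight X = q ->
  slide X x (x - q) = beads #|` X| [::].
Proof.
move=> xX hx e; have e0 := weight_slide_hook xX hx.
move: hx => /andP[_ nX]; rewrite e subnn in e0.
by have := weight0_beads e0; rewrite card_slide.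
Qed.

(** Stripping top hooks leads to a weight that is a power of 2. There the partition is a hook with
    at most two removable boxes, and the number of those leaving an odd partition is odd. *)
Lemma removals0_eq1 X : odd_beads X -> 0 \in X -> 0 < weight X ->
  removals 0 X = 1.
Proof.
have [n] := ubnP (weight X); elim: n X => // n IH X ltn oX X0 pos.
have /andP[le lt] := @trunc_log_bounds 2 (weight X) isT pos.
set r := trunc_log 2 (weight X) in le lt.
have lt2 : weight X < (2 ^ r).*2 by rewrite -mul2n -expnS.
have [x xX hx] := weight_top_hook oX le.
move: (hx) => /andP[lex nX].
have [e|ne] := eqVneq (weight X) (2 ^ r); last first.
  have lt' : 2 ^ r < weight X by rewrite ltn_neqAle eq_sym ne le.
  have := weight_slide_hook xX hx; have q0 : 0 < 2 ^ r by rewrite expn_gt0.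
  move=> ex; rewrite (removals0_top X0 lt' lt2 xX hx); apply: IH.
  - by rewrite ex; lia.
  - by rewrite -(odd_beads_top le lt2 xX hx).
  - rewrite in_slide X0 andbT; apply/orP; right; lia.
  - by rewrite ex; lia.
have eI := hook_to_beads_nil xX hx e.
have odn : odd (removals 0 X) by rewrite odd_removals // expn0.
suff : removals 0 X <= 2 by move: odn; case: (removals 0 X) => [|[|[|]]].
have XE z : z \in X -> z = x \/ z < #|` X|.
  move=> zX; have [->|nzx] := eqVneq z x; first by left.
  by right; rewrite -mem_beads_nil -eI in_slide nzx zX orbT.
(* The removable boxes of a hook are the end of the arm, at the bead [x], and the foot of the leg,
   at the bead just above the empty position. *)
apply: (@leq_trans (\sum_(u <- X) ((u == x) + (u == (x - 2 ^ r).+1)))).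
  rewrite /removals big_mkcond big_seq [X in _ <= X]big_seq;
    apply: leq_sum => u uX.
  case: ifP => // /andP[leu nu]; apply: leq_trans (leq_b1 _) _.
  have [->|ltu] := XE u uX; first by rewrite eqxx.
  rewrite (_ : u == (x - 2 ^ r).+1); first by rewrite addn1.
  have : u - 1 \in slide X x (x - 2 ^ r) by rewrite eI mem_beads_nil; lia.
  by rewrite in_slide (negPf nu) andbF orbF => /eqP; lia.
rewrite big_split /= !sum_eq_mem;
  exact: (@leq_add _ _ 1 1 (leq_b1 _) (leq_b1 _)).
Qed.

Lemma beads_hook m a b : 0 < a -> b < m ->
  beads m (a :: nseq b 1) = slide (beads m [::]) (m - b.+1) (a + (m - 1)).
Proof.
move=> a0 ltb; apply/fsetP=> x; rewrite in_slide mem_beads_nil mem_beads.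
have nE i : nth 0 (a :: nseq b 1) i = if i == 0 then a else (i <= b).
  by case: i => [|i] //=; rewrite nth_nseq; case: ltnP.
apply/mapP/idP => [[i]|].
  rewrite mem_iota add0n nE => lti ->; case: (eqVneq i 0) => [->|n0].
    by rewrite eqxx.
  by case: (leqP i b) => h /=; apply/orP; right; lia.
case/predU1P=> [->|/andP[ne lt]].
  by exists 0; rewrite ?mem_iota ?nE /=; lia.
have [h|h] := leqP (m - b) x.
  exists (m - x); first by rewrite mem_iota; lia.
  rewrite nE; have -> : (m - x == 0) = false by lia.
  have -> : (m - x <= b) = true by lia.
  by rewrite /=; lia.
exists (m - x.+1); first by rewrite mem_iota; lia.
rewrite nE; have -> : (m - x.+1 == 0) = false by lia.
have -> : (m - x.+1 <= b) = false by lia.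
by rewrite /=; lia.
Qed.

(** A hook partition is one hook added to the empty partition: a single bead [z] leaves the initial
    segment. *)
Lemma is_hook_beadsP X : 0 < weight X ->
  reflect (exists2 z, z < #|` X| <= z + weight X &
             X = slide (beads #|` X| [::]) z (z + weight X))
          (is_hook (bead_partn X)).
Proof.
move=> pos; set m := #|` X|; have sz := size_bead_partn X; rewrite -/m in sz.
apply: (iffP idP) => [|[z /andP[ltz lez] eX]].
  move: (is_partition_bead_partn X) sz (beadsK X) pos;
    rewrite /weight /is_hook -/m.
  case: (bead_partn X) => [|[|a] l] //=; first by case/andP; rewrite inE.
  move=> _ sz eX _ /all_pred1P el; set b := size l in el sz.
  exists (m - b.+1); first by rewrite el sumn_nseq; lia.
  rewrite -eX el beads_hook //; congr (slide _ _ _).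
  by rewrite /= sumn_nseq mul1n; lia.
have -> : bead_partn X = (z + weight X - (m - 1)) :: nseq (m - z.+1) 1.
  rewrite -[RHS](@bead_partn_beads m); last first.
  - by rewrite /= size_nseq; lia.
  - rewrite /is_partition /= inE mem_nseq /= negb_or andbF andbT.
    apply/andP; split; last by lia.
    have : sorted geq (nseq (m - z.+1) 1) by elim: (_ - _) => //= -[|j].
    case: (m - z.+1) => //= j -> ; rewrite andbT; lia.
  rewrite beads_hook; [ | lia | lia]; congr bead_partn; rewrite {1}eX.
  congr (slide _ _ _); lia.
rewrite /is_hook /=; apply/allP=> y; rewrite mem_nseq => /andP[_ /eqP ->] //.
Qed.

(** The 2^r-hook of an odd partition of 2^r is the whole diagram. With [pow_odd_beads] this
    identifies the odd partitions of 2^r with the hooks. *)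
Lemma odd_beads_pow r X : weight X = 2 ^ r ->
  odd_beads X -> exists2 z, z < #|` X| & z + 2 ^ r >= #|` X| /\ X =
    slide (beads #|` X| [::]) z (z + 2 ^ r).
Proof.
move=> e oX; have [|x xX hx] := @weight_top_hook r X oX; first by rewrite e.
move: (hx) => /andP[lex nX]; have eI := hook_to_beads_nil xX hx e.
have q0 : 0 < 2 ^ r by rewrite expn_gt0.
exists (x - 2 ^ r); first by rewrite -mem_beads_nil -eI in_slide eqxx.
rewrite subnK //; split; last by rewrite -eI mvK.
rewrite leqNgt -mem_beads_nil -eI in_slide eqxx orbF; lia.
Qed.

Lemma pow_odd_beads r X z : weight X = 2 ^ r -> z < #|` X| ->
  #|` X| <= z + 2 ^ r ->
  X = slide (beads #|` X| [::]) z (z + 2 ^ r) -> odd_beads X.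
Proof.
move=> e ltz lez eX; set m := #|` X| in ltz lez eX.
have zI : z \in beads m [::] by rewrite mem_beads_nil.
have nI : z + 2 ^ r \notin beads m [::] by rewrite mem_beads_nil -leqNgt.
have q0 : 0 < 2 ^ r by rewrite expn_gt0.
have xX : z + 2 ^ r \in X by rewrite eX in_slide eqxx.
have hx : is_bead_hook X (2 ^ r) (z + 2 ^ r).
  rewrite /is_bead_hook leq_addl addnK eX in_slide eqxx orbF; lia.
rewrite (@odd_beads_top r X _ _ _ xX hx) ?e //; last by lia.
apply: odd_beads_weight0; rewrite (weight_slide_hook xX hx) e; lia.
Qed.

(** The odd extensions are hooks of 2^d, so only a hook can be extended, at its arm or at its leg;
    for d = 0 the two coincide. *)
Lemma additions0_base d X : 0 \in X -> weight X = 2 ^ d - 1 ->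
  additions 0 X = is_hook (bead_partn X) * (if d == 0 then 1 else 2).
Proof.
move=> X0 e; set m := #|` X|; have q0 : 0 < 2 ^ d by rewrite expn_gt0.
have m0 : 0 < m by rewrite /m cardfs_gt0; apply/fset0Pn; exists 0.
pose M u := slide X u u.+1.
have szM u : u \in X -> u.+1 \notin X -> weight (M u) = 2 ^ d /\ #|` M u| = m.
  by move=> uX suX; have := weight_slide uX suX; rewrite card_slide // -/(M u);
    lia.
rewrite additions0_moves /moves.
case: d e q0 szM => [|d] e q0 szM /=.
  have eX := weight0_beads e; rewrite -/m in eX.
  have -> : is_hook (bead_partn X) by rewrite {1}eX bead_partn_beads.
  transitivity (\sum_(u <- X) (u == m.-1)); last first.
    by rewrite sum_eq_mem eX mem_beads_nil prednK ?leqnn.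
  rewrite big_mkcond big_seq [RHS]big_seq; apply: eq_bigr => u uX.
  rewrite (_ : (u.+1 \notin X) = (u == m.-1)); last first.
    by move: uX; rewrite eX !mem_beads_nil; lia.
  case: eqP => // eu; rewrite odd_beads_weight1 //.
  have suX : u.+1 \notin X by rewrite eX mem_beads_nil eu prednK // ltnn.
  by case: (szM u uX suX).
set Q := 2 ^ d.+1 in e q0 szM *.
have p0 : 0 < 2 ^ d by rewrite expn_gt0.
have Q2 : 1 < Q by rewrite /Q expnS; lia.
have pos : 0 < weight X by lia.
have IP z : (z \in beads m [::]) = (z < m) by apply: mem_beads_nil.
case: (is_hook_beadsP pos) => [[z /andP[ltz lez] eX]|nh];
  rewrite ?mul1n ?mul0n; last first.
  rewrite big1_seq // => u /andP[suX uX].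
  case oM: (odd_beads _) => //; case: nh.
  have [sM cM] := szM u uX suX.
  have [z ltz [lez eM]] := odd_beads_pow sM oM;
    rewrite cM -/Q -/(M u) in ltz lez eM.
  have eX : X = slide (M u) u.+1 u by rewrite /M mvK.
  have sM1 : u.+1 \in M u by rewrite in_slide eqxx.
  have nuM : u \notin M u by rewrite in_slide eqxx orbF; lia.
  rewrite -/m e; move: sM1 nuM;
    rewrite eM !in_slide !IP => /predU1P[su|/andP[nz su]] nuM.
    exists z; first by rewrite ltz; move: nuM; case: eqP => /=; lia.
    rewrite eX eM; apply/fsetP=> y; rewrite !in_slide !IP.
    have -> : u = z + (Q - 1) by lia.
    by move: nuM; lia.
  have uz : u = z by move: nuM; lia.
  exists z.+1; first by lia.
  rewrite eX eM uz; apply/fsetP=> y; rewrite !in_slide !IP; lia.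
rewrite -/m e in eX lez ltz.
have z0 : 0 < z.
  by move: X0; rewrite eX in_slide IP; lia.
have XE y : (y \in X) = (y == z + (Q - 1)) || (y != z)
  && (y < m) by rewrite eX in_slide IP.
(* The arm grows at the bead [z + (Q - 1)], the leg at the bead [z - 1] just below the empty
   position. *)
transitivity (\sum_(u <- X) ((u == z + (Q - 1)) + (u == z - 1))); last first.
  by rewrite big_split /= !sum_eq_mem !XE; lia.
rewrite big_mkcond big_seq [RHS]big_seq; apply: eq_bigr => u uX.
have good w : u.+1 \notin X -> M u = slide (beads m [::]) w (w + Q) -> w < m ->
  m <= w + Q ->
    odd_beads (M u).
  move=> suX eM ltw lew; have [sM cM] := szM u uX suX.
  by apply: (@pow_odd_beads d.+1 (M u) w); rewrite ?cM.
have [eu|nu1] := eqVneq u (z + (Q - 1)).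
  have suX : u.+1 \notin X by rewrite XE; lia.
  rewrite suX (good z suX) //; last by lia.
    by rewrite eu; lia.
  apply/fsetP=> y; rewrite /M !in_slide XE IP eu; lia.
have [eu|nu2] := eqVneq u (z - 1).
  have suX : u.+1 \notin X by rewrite XE; lia.
  rewrite suX (good (z - 1) suX) //; [|lia|lia].
  apply/fsetP=> y; rewrite /M !in_slide XE IP eu; lia.
(* The only other addable box is the inner corner, which destroys the hook shape. *)
case: ifP => // suX; rewrite -/(M u); case oM: (odd_beads _) => //.
have [sM cM] := szM u uX suX.
have [w ltw [lew eM]] := odd_beads_pow sM oM; rewrite cM -/Q in ltw lew eM.
have h1 : z + (Q - 1) \in M u by rewrite /M in_slide XE eqxx /=; lia.
have h2 : u.+1 \in M u by rewrite in_slide eqxx.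
move: h1 h2 suX uX; rewrite eM !in_slide !IP !XE; lia.
Qed.

(** Stripping a 2^r-hook with d < r changes neither the weight modulo 2^(d+1) nor the 2^d-core; this
    goes on until the weight is 2^d - 1. *)
Lemma additions0E d X : odd_beads X -> 0 \in X -> lowz d (weight X) ->
  additions 0 X = is_hook (core (2 ^ d) (bead_partn X)) * (if d == 0 then 1
    else 2).
Proof.
have [n] := ubnP (weight X); elim: n X => // n IH X ltn oX X0 lw.
have q0 : 0 < 2 ^ d by rewrite expn_gt0.
have ed : 2 ^ d.+1 = (2 ^ d).*2 by rewrite expnS mul2n.
have [lt|ge] := ltnP (weight X) (2 ^ d.+1).
  have e : weight X = 2 ^ d - 1 by move: lw;
    rewrite /lowz modn_small // => /eqP.
  by rewrite core_small; [apply: additions0_base | rewrite e; lia].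
have pos : 0 < weight X by lia.
have /andP[le lt] := @trunc_log_bounds 2 (weight X) isT pos.
set r := trunc_log 2 (weight X) in le lt.
have lt2 : weight X < (2 ^ r).*2 by rewrite -mul2n -expnS.
have ltdr : d < r.
  by rewrite ltnNge; apply/negP=> ler;
    have := leq_pexp2l (isT : 0 < 2) (ler : r.+1 <= d.+1); lia.
have dv : 2 ^ d.+1 %| 2 ^ r by apply: dvdn_exp2l.
(* The left side is 2^d modulo 2^(d+1), so it is not the next power of 2, and no extension leaves
   the range of the top hook. *)
have ne : (weight X).+1 != (2 ^ r).*2.
  apply/eqP=> e; move: lw; rewrite /lowz => /eqP lw.
  have : (weight X).+1 %% 2 ^ d.+1 = 0.
    by apply/eqP; rewrite e -mul2n; apply: dvdn_mull.
  by rewrite -addn1 -modnDml lw subnK // modn_small; lia.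
have lt3 : (weight X).+1 < (2 ^ r).*2 by rewrite ltn_neqAle ne.
have [x xX hx] := weight_top_hook oX le; move: (hx) => /andP[lex nX].
have ex := weight_slide_hook xX hx; have qr0 : 0 < 2 ^ r by rewrite expn_gt0.
rewrite (additions0_top X0 le lt3 xX hx) IH.
- congr (nat_of_bool (is_hook _) * _); apply: core_slide => //.
  rewrite -{1}(subnK lex) -modnDmr.
  have /eqP -> : 2 ^ d %| 2 ^ r by apply: dvdn_exp2l; apply: ltnW.
  by rewrite addn0.
- by rewrite ex; lia.
- by rewrite -(odd_beads_top le lt2 xX hx).
- rewrite in_slide X0 andbT; apply/orP; right; lia.
rewrite /lowz ex -(eqP lw); apply/eqP.
rewrite -[in RHS](subnK le) -modnDmr.
by have /eqP -> := dv; rewrite addn0.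
Qed.

(** * Counting odd extensions *)

Lemma half_weight_sum X : odd_beads X ->
  (weight X)./2 = half_weight false X + half_weight true X.
Proof.
move=> oX; have [K _ _] := odd_beads_half oX; have := double_half_weight_le X.
lia.
Qed.

Lemma half_initial k X b : (forall y, y < 2 ^ k.+1 -> y \in X) ->
  forall y, y < 2 ^ k -> y \in half b X.
Proof. by move=> h y lt; rewrite in_half; apply: h; rewrite expnS; case: b;
  lia. Qed.

(** By [binodd_sub2exp] exactly one half can lose its share of the weight and keep the digits
    disjoint; induction finds one hook there. This is the uniqueness on which [f_map] rests. *)
Lemma removals_eq1 k X : odd_beads X -> (forall y, y < 2 ^ k -> y \in X) ->
  2 ^ k <= weight X -> removals k X = 1.
Proof.
elim: k X => [|k IH] X oX hX le.
  by apply: removals0_eq1 => //; apply: hX.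
have [_ bo oh] := odd_beads_half oX; have hs := half_weight_sum oX.
have lea : 2 ^ k <= half_weight false X + half_weight true X by rewrite -hs;
  move: le; rewrite expnS; lia.
have := binodd_sub2exp lea; rewrite (bo false) /= => /esym.
rewrite removalsS // big_bool /=.
have dnb b : 2 ^ k <= half_weight b X -> removals k (half b X) = 1.
  by move=> leb; apply: IH => //; apply: half_initial.
case: (leqP (2 ^ k) (half_weight true X)) => lt;
  case: (leqP (2 ^ k) (half_weight false X)) => lf //=;
  rewrite ?(dnb _ lt) ?(dnb _ lf) ?mul0n ?addn0 ?add0n ?muln1 //=.
- by case: (binodd _ _); case: (binodd _ _).
- by move=> ->.
by rewrite addbF => ->.
Qed.

Lemma even_card_beads X : exists Y, [/\ bead_partn Y = bead_partn X,
  ~~ odd #|` Y| & Y = X \/ Y = shift X].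
Proof.
case o: (odd #|` X|); last by exists X; split=> //; [rewrite o | left].
by exists (shift X); split;
  [exact: bead_partn_shift | rewrite card_shift /= o | right].
Qed.

Lemma odd_bin_half_weight k X b : odd_beads X ->
  odd 'C(weight X %/ 2 ^ k.+1, half_weight b X %/ 2 ^ k).
Proof.
move=> oX; have [_ bo _] := odd_beads_half oX.
rewrite divn_2expS half_weight_sum // (_ : _ + _ =
  half_weight b X + half_weight (~~ b) X); last first.
  by case: b => //=; rewrite addnC.
by have [-> ] := binodd_divn k (bo b).
Qed.

Lemma mem_quotient_rowS k X nu : odd_beads X ->
  nu \in quotient_row k.+1 (bead_partn X) ->
  exists Y b, [/\ bead_partn Y = bead_partn X,
    odd_beads Y & nu \in quotient_row k (bead_partn (half b Y))].
Proof.
move=> oX; have [Y [eY ev _]] := even_card_beads X.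
rewrite -eY quotient_rowS !quotient2_half // mem_cat.
have oY : odd_beads Y by rewrite /odd_beads eY.
by case/orP=> h; exists Y; [exists false | exists true].
Qed.

(** The odd binomial coefficient says that the digits of [sumn nu] are among those of
    [weight X %/ 2 ^ k]; it passes down the tower by transitivity. *)
Lemma quotient_row_mem k X nu : odd_beads X ->
  nu \in quotient_row k (bead_partn X) ->
  odd 'C(weight X %/ 2 ^ k, sumn nu) /\ exists2 Y,
    nu = bead_partn Y & odd_beads Y.
Proof.
elim: k X => [|k IH] X oX.
  rewrite inE => /eqP ->; rewrite expn0 divn1 binn; split=> //.
  by exists X.
case/(mem_quotient_rowS oX)=> Y [b [eY oY hnu]].
have [_ _ oh] := odd_beads_half oY.
have [h1 h2] := IH _ (oh b) hnu; split=> //.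
apply: odd_bin_trans h1; rewrite /weight -eY.
exact: odd_bin_half_weight.
Qed.

Lemma goodE d Y : odd_beads Y ->
  good d (bead_partn Y) = lowz d (weight Y)
    && is_hook (core (2 ^ d) (bead_partn Y)).
Proof.
move=> oY; rewrite /good -/(odd_beads Y) oY /= /lowz (modn_small (m := 2 ^ d -
  1)) //.
have : 0 < 2 ^ d by rewrite expn_gt0.
by rewrite expnS; lia.
Qed.

Definition extension_count (d : nat) := if d == 0 then 1 else 2.

Lemma additionsE k d X : odd_beads X -> (forall y, y < 2 ^ k -> y \in X) ->
  lowz d (weight X %/ 2 ^ k) ->
  additions k X = count (good d) (quotient_row k (bead_partn X)) *
    extension_count d.
Proof.
elim: k X => [|k IH] X oX hX.
  rewrite expn0 divn1 => lw; rewrite /= addn0 goodE // lw /=.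
  by apply: additions0E => //; apply: hX.
(* The halves are the 2-quotient only for an even number of beads; a shift changes the parity but
   not the count. *)
wlog ev : X oX hX / ~~ odd #|` X|.
  move=> wl lw; case o: (odd #|` X|); last by apply: wl => //; rewrite o.
  rewrite -(additions_shift hX) -(bead_partn_shift X); apply: wl.
  - by rewrite /odd_beads bead_partn_shift.
  - by case=> [|y] lty; rewrite ?in_shift0 // in_shiftS; apply: hX; apply: ltnW.
  - by rewrite card_shift /= o.
  by rewrite /weight bead_partn_shift.
move=> lw; have [_ bo oh] := odd_beads_half oX.
have eS b : (weight X)./2 = half_weight b X + half_weight (~~ b) X.
  by rewrite half_weight_sum //; case: b => //=; rewrite addnC.
have lwb b : lowz d ((half_weight b X + half_weight (~~ b) X) %/ 2 ^ k) by
  rewrite -eS -divn_2expS.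
have step b : binodd (half_weight b X + 2 ^ k) (half_weight (~~ b) X) *
  additions k (half b X) =
    count (good d) (quotient_row k (bead_partn (half b X))) * extension_count d.
  rewrite (binodd_add2exp (bo b) (lwb b)); case: (boolP (lowz d _)) => lb.
    by rewrite mul1n; apply: IH => //; apply: half_initial.
  (* A half whose weight fails [lowz d] yields no extension. It has no good entry either: the digits
     of such an entry, of the half and of [X] are nested, and [lowz_between] would give [lowz d] for
     the half. *)
  rewrite mul0n; case: (posnP (count (good d) (quotient_row k (bead_partn (half
    b X))))) => [->//|].
  rewrite -has_count => /hasP[nu hnu gnu].
  have [h1 [Y eY oY]] := quotient_row_mem (oh b) hnu.
  move: gnu; rewrite eY goodE // => /andP[lnu _].
  case/negP: lb; rewrite eY in h1; apply: (lowz_between h1) lnu lw.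
  exact: odd_bin_half_weight.
rewrite additionsS // quotient_rowS count_cat !quotient2_half // big_bool !step
  /=.
by rewrite -mulnDl addnC.
Qed.

Lemma core1 Y : core 1 (bead_partn Y) = [::].
Proof.
have [Z [-> _ hZ _]] := core_bead_partn Y (isT : 0 < 1).
have e : weight Z = 0.
  case: (posnP (weight Z)) => // /weight_gt0_hook[x xZ /andP[lex nx]].
  by rewrite (hZ x xZ lex) in nx.
by rewrite (weight0_beads e) bead_partn_beads.
Qed.

(** At each level the two halves share no digit, so the units bit of [weight X %/ 2 ^ k] goes to a
    single entry of the row, or to none if it is 0. *)
Lemma count_odd_quotient_row k X : odd_beads X ->
  count (fun nu => odd (sumn nu)) (quotient_row k (bead_partn X)) =
    odd (weight X %/ 2 ^ k).
Proof.
elim: k X => [|k IH] X oX; first by rewrite expn0 divn1 /= addn0.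
have [Y [eY ev _]] := even_card_beads X.
have oY : odd_beads Y by rewrite /odd_beads eY.
have [_ bo oh] := odd_beads_half oY.
have eP : weight X = weight Y by rewrite /weight eY.
rewrite eP -eY quotient_rowS count_cat !quotient2_half // !IH //.
rewrite divn_2expS half_weight_sum //; have [-> ] := binodd_divn k (bo false).
rewrite /= oddD binodd_half => /andP[_].
rewrite -/(half_weight false Y) -/(half_weight true Y).
by case: (odd _); case: (odd _).
Qed.

(** For d = 0 no entry has odd size and 1-cores are empty, so all 2^k entries are good. For d > 0 a
    good entry has odd size, and at most one entry does. *)
Lemma count_good k d X : odd_beads X -> lowz d (weight X %/ 2 ^ k) ->
  (d = 0 -> count (good d) (quotient_row k (bead_partn X)) = 2 ^ k) /\
  (0 < d -> count (good d) (quotient_row k (bead_partn X)) <= 1).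
Proof.
move=> oX lw; have co := count_odd_quotient_row k oX; split=> [d0|dpos].
  rewrite -(size_quotient_row k (bead_partn X)); apply/eqP; rewrite -all_count.
  apply/allP=> nu hnu; have [_ [Y eY oY]] := quotient_row_mem oX hnu.
  rewrite eY goodE // d0 expn0 core1 andbT lowz0 /weight -eY.
  apply/negP=> onu; move: lw; rewrite d0 lowz0 => /negPf;
    rewrite -[odd _]lt0b -co.
  by rewrite -has_count => /negP[]; apply/hasP; exists nu.
apply: (@leq_trans (count (fun nu =>
  odd (sumn nu)) (quotient_row k (bead_partn X)))); last first.
  by rewrite co leq_b1.
rewrite (@eq_in_count _ _ (fun nu => good d nu && odd (sumn nu))).
  by apply: sub_count => nu /andP[].
move=> nu hnu /=.
case g: (good d nu) => //=; have [_ [Y eY oY]] := quotient_row_mem oX hnu.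
move: g; rewrite eY goodE // => /andP[].
by case: (d) dpos => // d' _; rewrite lowzS => /andP[].
Qed.

Lemma sum_odd_removals k Y :
  count odd_partn (hook_removals (2 ^ k) (bead_partn Y)) = removals k Y.
Proof.
have q0 : 0 < 2 ^ k by rewrite expn_gt0.
have := sum_hook_removals (is_partition_bead_partn Y) (size_bead_partn Y) (fun
  nu => odd_partn nu) q0.
rewrite beadsK /removals /odd_beads => <-.
by rewrite -sum1_count big_mkcond; apply: eq_bigr => nu _; case: odd_partn.
Qed.

Lemma size_le_sumn (la : seq nat) : 0 \notin la -> size la <= sumn la.
Proof.
elim: la => //= x l IH; rewrite inE negb_or => /andP[x0 /IH].
by case: x x0 => //= x _; lia.
Qed.

Lemma leq_mem_sumn (la : seq nat) x : x \in la -> x <= sumn la.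
Proof.
by elim: la => //= y l IH; rewrite inE => /predU1P[->|/IH]; lia.
Qed.

Lemma beads_initial m q la : size la + q <= m ->
    forall y, y < q -> y \in beads m la.
Proof.
move=> le y lt; rewrite mem_beads; apply/mapP; exists (m - y.+1).
  by rewrite mem_iota; lia.
by rewrite nth_default; lia.
Qed.

Lemma is_partn_facts m mu : is_partn m mu -> [/\ is_partition mu,
  sumn mu = m & size mu <= m].
Proof.
case/and3P=> h1 h2 /eqP h3; split=> //; first by rewrite /is_partition h1.
by rewrite -h3 size_le_sumn.
Qed.

(** * Fibres of [f_map] as added hooks *)

Section ENum.

Variables (n k : nat) (la : seq nat).
Hypothesis hla : is_partn (n - 2 ^ k) la.

Let q := 2 ^ k.
(** A partition of [n] has at most [n] parts, so with [n + q] beads all positions below [q] are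
    occupied, and hooks that create new rows are seen too. *)
Let M := n + q.
Let X := beads M la.

Let pla : is_partition la. Proof. by case/and3P: hla => h1 h2 _;
  rewrite /is_partition h1. Qed.
Let sla : sumn la = n - q. Proof. by case/and3P: hla => _ _ /eqP. Qed.
Let q0 : 0 < q. Proof. by rewrite expn_gt0. Qed.

Let sz : size la <= M.
Proof. by have [_ _] := is_partn_facts hla; rewrite /M; lia. Qed.

Lemma bead_partn_X : bead_partn X = la.
Proof. by rewrite /X bead_partn_beads. Qed.

Lemma card_X : #|` X| = M.
Proof. by rewrite /X card_beads //; case/andP: pla. Qed.

Lemma weight_X : weight X = n - q.
Proof. by rewrite /weight bead_partn_X. Qed.

Hypotheses (hk : 2 ^ k < n) (hodd : odd_partn la).

(** By [removals_eq1] the filtered list in [f_map] is a singleton, and [la] passes the filter. *)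
Lemma f_map_mem mu Y : is_partn n mu -> odd_partn mu -> bead_partn Y = mu ->
  #|` Y| = M ->
  (f_map k mu == la) = (la \in hook_removals q mu).
Proof.
move=> hmu omu eY cY; have [pmu smu szmu] := is_partn_facts hmu.
have oY : odd_beads Y by rewrite /odd_beads eY.
have hY y : y < 2 ^ k -> y \in Y.
  by rewrite -(beadsK Y) cY eY; apply: beads_initial; rewrite /M /q; lia.
have leY : 2 ^ k <= weight Y by rewrite /weight eY smu ltnW.
have := removals_eq1 oY hY leY;
  rewrite -sum_odd_removals eY -/q -size_filter /f_map -/q.
case E: [seq nu <- hook_removals q mu | odd_partn nu] => [|nu [|nu' l]] //= _.
have : (la \in [seq nu <- hook_removals q mu | odd_partn nu]) =
  (la \in hook_removals q mu).
  by rewrite mem_filter hodd.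
by rewrite E inE eq_sym.
Qed.

Let ext x := bead_partn (slide X x (x + q)).
Let L := [seq x <- X | (x + q \notin X) && odd_beads (slide X x (x + q))].

(** Raising a bead of [X] by [q] and removing the resulting hook are inverse to each other; with
    equal numbers of beads, equal partitions have equal bead sets. *)
Lemma memL mu : [&& is_partn n mu, odd_partn mu & f_map k mu == la] =
  (mu \in [seq ext x | x <- L]).
Proof.
apply/idP/mapP => [/and3P[hmu omu hf]|[x]].
  have [pmu smu szmu] := is_partn_facts hmu.
  have szM : size mu <= M by rewrite /M; lia.
  have eY : bead_partn (beads M mu) = mu by rewrite bead_partn_beads.
  have cY : #|` beads M mu| = M by rewrite card_beads //; case/andP: pmu.
  move: hf; rewrite (f_map_mem hmu omu eY cY) -eY.
  case/(hook_removals_bead_partn q0)=> y yY [hy ela].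
  move: (hy) => /andP[ley nY].
  have eX : X = slide (beads M mu) y (y - q).
    by apply: bead_partn_inj; [rewrite card_X card_slide | rewrite
      bead_partn_X].
  have eYX : slide X (y - q) y = beads M mu by rewrite eX mvK.
  exists (y - q); last by rewrite /ext subnK // eYX eY.
  rewrite mem_filter subnK // eYX /odd_beads eY omu andbT.
  by rewrite eX !in_slide !eqxx /= andbT; lia.
rewrite mem_filter => /andP[/andP[nX oY] xX] emu.
set Y := slide X x (x + q) in oY.
have cY : #|` Y| = M by rewrite card_slide // card_X.
have eY : bead_partn Y = mu by rewrite emu.
have sY : weight Y = n by have := weight_slide xX nX; rewrite weight_X -/Y; lia.
have hmu : is_partn n mu.
  rewrite -eY; have /andP[h1 h2] := is_partition_bead_partn Y.
  by apply/and3P; split=> //; apply/eqP.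
have omu : odd_partn mu by rewrite -eY.
rewrite hmu omu (f_map_mem hmu omu eY cY) /= -eY.
have xqY : x + q \in Y by rewrite in_slide eqxx.
have hx : is_bead_hook Y q (x + q).
  rewrite /is_bead_hook leq_addl addnK in_slide eqxx orbF; lia.
have := sum_hook_removals (is_partition_bead_partn Y) (size_bead_partn Y) (fun
  nu => nu == la) q0.
rewrite beadsK [X in _ = X]big_mkcond [X in _ =
  X](big_fsetD1 (x + q)) //= hx addnK mvK // bead_partn_X eqxx.
case: (boolP (la \in _)) => // nla; rewrite big1_seq // => nu /= hnu.
by case: eqP => // e; rewrite -e hnu in nla.
Qed.

Lemma uniq_ext : uniq [seq ext x | x <- L].
Proof.
rewrite map_inj_in_uniq ?filter_uniq ?fset_uniq // => x y.
rewrite !mem_filter => /andP[/andP[nx _] xX] /andP[/andP[ny _] yX] e.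
have /fsetP/(_ x) : slide X x (x + q) = slide X y (y + q).
  by apply: bead_partn_inj => //; rewrite !card_slide.
rewrite !in_slide eqxx xX andbT orbF /= => h; move: ny; move: h.
case: (eqVneq x y) => // _; rewrite orbT => /eqP; lia.
Qed.

Lemma e_num_additions : e_num n k la = additions k X.
Proof.
rewrite /additions -/q sum_nat_cond_leq.
transitivity (size [seq ext x | x <- L]); last first.
  rewrite size_map size_filter -sum1_count big_mkcond.
  by apply: eq_bigr => x _; case: (_ && _).
rewrite /e_num; set S := [set s | _].
pose g (s : n.-bseq 'I_n.+1) := [seq val p | p <- s].
have injg : injective g.
  move=> s t /(inj_map val_inj) e; exact: val_inj.
rewrite cardE -(size_map g); apply: perm_size; apply: uniq_perm.
- by rewrite map_inj_uniq ?enum_uniq.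
- exact: uniq_ext.
move=> mu; rewrite -memL; apply/mapP/idP => [[s]|hmu].
  by rewrite mem_enum inE => h ->.
case/and3P: (hmu) => hp _ _; have [pmu smu szmu] := is_partn_facts hp.
have les : size [seq inord x : 'I_n.+1 | x <- mu] <= n by rewrite size_map.
have es : g (Bseq les) = mu.
  rewrite /g /= -map_comp -[RHS]map_id; apply/eq_in_map => x xmu /=.
  by rewrite inordK // ltnS -smu; apply: leq_mem_sumn.
by exists (Bseq les); rewrite ?es // mem_enum inE -/(g _) es.
Qed.

End ENum.

Theorem theorem3p5 (n k : nat) (la : seq nat) (hn : 1 <= n) (hk : 2 ^ k < n)
    (hla : is_partn (n - 2 ^ k) la) (hodd : odd_partn la) :
  (e_num n k la <> 0 <->
     exists2 nu, nu \in quotient_row k la & good (d_num n k) nu) /\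
  (e_num n k la <> 0 ->
     (d_num n k = 0 -> e_num n k la = 2 ^ k) /\
     (0 < d_num n k -> e_num n k la = 2)).
Proof.
have q0 : 0 < 2 ^ k by rewrite expn_gt0.
pose X := beads (n + 2 ^ k) la; set d := d_num n k.
have eX : bead_partn X = la := bead_partn_X hla.
have oX : odd_beads X by rewrite /odd_beads eX.
have sX : weight X = n - 2 ^ k := weight_X hla.
(* The quotient of n - 2^k by 2^k is one less than that of n, so its lowest zero bit is the 2-adic
   valuation of the latter. *)
have lw : lowz d (weight X %/ 2 ^ k).
  rewrite lowz_logn sX /d /d_num -{2}(subnK (ltnW hk)) divnDr // divnn q0 addn1.
  by [].
have hX y : y < 2 ^ k -> y \in X.
  apply: beads_initial; have [_ _] := is_partn_facts hla; lia.
rewrite (e_num_additions hla hk hodd) -/X (additionsE oX hX lw) eX.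
have [c0 c1] := count_good oX lw; rewrite eX in c0 c1.
set c := count _ _ in c0 c1 *.
have hc : reflect (exists2 nu, nu \in quotient_row k la & good d nu) (0 < c).
  by rewrite -has_count; apply: hasP.
have ext0 : 0 < extension_count d by rewrite /extension_count; case: ifP.
split; first split=> [ne|/hc cpos]; [apply/hc|..].
- by rewrite lt0n; apply/eqP=> e; apply: ne; rewrite e.
- by apply/eqP; rewrite -lt0n muln_gt0 cpos.
move=> /eqP; rewrite -lt0n muln_gt0 => /andP[cpos _]; split=> [d0|dpos].
  by rewrite /extension_count d0 muln1 c0.
have := c1 dpos; rewrite /extension_count; case: (d) dpos => // d' _.
by case: (c) cpos => [|[|]].
Qed.
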